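(* There exists a constant $C>0$ such that the number $S(n)$ of multiplicative Sidon subsets of $[n]=\{1,\ldots,n\}$ satisfies $$T(n)\cdot 2^{(\sqrt{2}+o(1))\frac{n^{3/4}}{(\log n)^{3/2}}}\le S(n)\le T(n)\cdot 2^{C\frac{n^{3/4}}{(\log n)^{3/2}}},$$ where $$T(n):=\prod_{p \text{ prime: } n^{2/3}< p\le n}\left(\lfloor n/p\rfloor+1\right),$$ and $o(1)$ denotes a quantity tending to $0$ as $n\to\infty$.
   Context: A set $S\subseteq\mathbb{N}$ is a multiplicative Sidon set if there are no distinct elements $a_1,a_2,b_1,b_2\in S$ with $a_1a_2=b_1b_2$ (i.e. the products of pairs of elements of $S$ are distinct). $S(n)$ denotes the number of subsets of $[n]$ (including the empty set) that are multiplicative Sidon sets. *)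

(* Defs.v *)
From mathcomp Require Import all_boot.

Set Implicit Arguments.
Unset Strict Implicit.
Unset Printing Implicit Defensive.

(* An element i : 'I_n represents the integer i+1 of [n] = {1,...,n}. *)

Definition mult_sidon (n : nat) (A : {set 'I_n}) : bool :=
  [forall a1 in A, forall a2 in A, forall b1 in A, forall b2 in A,
     [&& a1 != a2, a1 != b1, a1 != b2, a2 != b1, a2 != b2 & b1 != b2] ==>
     ((a1.+1 * a2.+1)%N != (b1.+1 * b2.+1)%N)].

Definition S (n : nat) : nat := #|[set A : {set 'I_n} | mult_sidon A]|.

(* T(n) = prod_{p prime, n^{2/3} < p <= n} (floor(n/p) + 1).
   n^{2/3} < p  <->  n^2 < p^3 for naturals. *)
Definition T (n : nat) : nat :=
  \prod_(p < n.+1 | prime p && (n ^ 2 < p ^ 3)) (n %/ p).+1.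

(* Main.v *)
(** Lower bound.  Choosing for every prime p > n^(2/3) at most one multiple of p
    gives T(n) sets.  To each of them one may add any set of products r s <= n
    of smaller primes that are the edges of a C4-free graph, because an equality
    of two products of such edges closes a 4-cycle.  The vertices are the first
    q^2 primes (q prime), labelled by pairs (a, b) over F_q, and the graphs are
    the classes b + d - (a + c)^2 = t; by pigeonhole some t gives a 1/q fraction
    of all admissible pairs.  The j-th prime is at most j sqrt(n) / M for
    M = (1.7 sqrt n) / ln n, so that all pairs below the hyperbola i j <= M^2 are
    admissible, also those with one coordinate far above M.  The latter gain more
    than the factor sqrt 2, so Chebyshev's bound suffices in place of the prime
    number theorem, and o(1) may be taken to be 0.

    Upper bound.  For every large prime p all but one multiple of p in the set are
    superfluous: the others inject into pairs of cofactors, and there are few.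
    An integer without large prime factor is either u v with v < n^(1/2 - c) and
    u < n^(3/4 - c), where the Kovari-Sos-Turan bound leaves few elements, or u v
    with v free of small primes and u = a s with a >= v free of small primes.
    The latter elements are sorted into dyadic boxes by v and s; each box is a
    C4-free bipartite graph with parts of sizes O(2^(-k) sqrt(n) / log n) and
    O(2^k sqrt(n) / log n), and the Kleitman-Winston method counts these graphs
    with a bound that is summable over the boxes. *)

Require Import Defs.
From Stdlib Require Import Reals Lra.
From Coquelicot Require Rcomplements.
From mathcomp Require all_boot ssralg countalg finalg zmodp zify ring.
Open Scope R_scope.

Module Development.
Import all_boot ssralg countalg finalg zmodp zify.
Set Implicit Arguments.
Unset Strict Implicit.
Unset Printing Implicit Defensive.
Local Open Scope nat_scope.

(** * Independent sets and C4-free bipartite graphs *)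

(** The constant sqrt 2 is 2^(3/2) / 2: with M = 2 sqrt n / ln n primes below sqrt n and q = sqrt M,
    the M^2 / 2 pairs of these primes leave M^(3/2) / 2 edges in one class. For q = k sqrt M and the
    whole hyperbola the number is about M^(3/2) (1/2 + 2 ln k) / k, which stays above 0.8 M^(3/2)
    for k between sqrt 3 and 2 sqrt 3. This leaves room both for the factor 1.7 in M and for a prime
    q that is known only up to a factor 2. In the upper bound the difficulty is not to lose powers
    of log n. Both parts of a box must be thinner by log n than intervals, which is why v and a have
    no small prime factors; the remaining factor s only multiplies the number of boxes, and v <= a
    bounds that number. Powers of n become integer exponents through a scale g with n <= 2^(80 g),
    tight up to a constant factor: 40 stands for sqrt n, 54 lies just above n^(2/3), 60 stands for
    n^(3/4), and 59 is the exponent of the error terms. *)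

Lemma leq_exp_base a b l : a <= b -> a ^ l <= b ^ l.
Proof. by case: l => // l; rewrite leq_exp2r. Qed.

Section Container.
Variables (Q : finType) (adj : rel Q).

Definition stable_sets (B : {set Q}) (d : nat) : {set {set Q}} :=
  [set D : {set Q} | [&& D \subset B, #|D| == d &
     [forall a in D, forall b in D, ~~ adj a b]]].

(* A vertex [b] of large degree is either avoided, or chosen at the price of all its
   neighbours; after [l] choices fewer than [R] candidates remain. *)
Lemma stable_sets_container (B0 : {set Q}) (tau R M d : nat) :
  0 < tau ->
  (forall B : {set Q}, B \subset B0 -> R <= #|B| ->
     exists2 b, b \in B & #|B| <= tau * #|[set c in B | adj b c]|) ->
  (forall d', d' <= d -> 'C(R, d') <= M) ->
  forall l m (B : {set Q}) d', B \subset B0 ->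
    d' <= d -> #|B| <= m ->
    m * tau.-1 ^ l < R * tau ^ l ->
    #|stable_sets B d'| <= M * m.+1 ^ l.
Proof.
move=> tau_gt0 dense binM l m B.
elim: {B}_.+1 {-2}B (ltnSn #|B|) l m => // k IH B ltBk l m d' sB led' leBm ltm.
case: (ltnP #|B| R) => [ltBR|leRB].
  apply: (@leq_trans M); last by rewrite leq_pmulr // expn_gt0.
  apply: leq_trans (binM _ led').
  apply: (@leq_trans 'C(#|B|, d')); last by rewrite leq_bin2l // ltnW.
  rewrite -cards_draws; apply: subset_leq_card; apply/subsetP => D.
  by rewrite !inE => /and3P[-> ->].
have [b bB denseb] := dense _ sB leRB.
case: l ltm => [|l] ltm.
  by move: ltm; rewrite !expn0 !muln1 => ltm; lia.
have B_gt0 : 0 < #|B| by apply/card_gt0P; exists b.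
pose B1 := B :\ b; pose B2 := (B :\: [set c in B | adj b c]) :\ b.
have cB1 : #|B| = #|B1|.+1 by rewrite (cardsD1 b B) bB add1n.
have sB1 : B1 \subset B0 by apply: subset_trans sB; apply: subD1set.
have sB2 : B2 \subset B0.
  by apply: subset_trans sB; apply: subset_trans (subsetDl _ _); apply: subD1set.
have ltB2 : #|B2| < #|B|.
  rewrite cB1 ltnS; apply: subset_leq_card; apply: setSD; exact: subsetDl.
have leB2 : #|B2| <= #|B| - #|[set c in B | adj b c]|.
  rewrite -cardsDS; last by apply/subsetP => c; rewrite inE => /andP[].
  by apply: subset_leq_card; apply: subsetDl.
pose ext : {set {set Q}} :=
  if d' is e.+1 then [set b |: D | D : {set Q} in stable_sets B2 e] else set0.
have sub : stable_sets B d' \subset stable_sets B1 d' :|: ext.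
  rewrite /ext; apply/subsetP => D; rewrite !inE => /and3P[sDB /eqP cD stD].
  case: (boolP (b \in D)) => bD; last first.
    by rewrite subsetD1 sDB bD /= cD eqxx stD.
  apply/orP; right; case: d' @ext cD {led'} => [|e] ? cD.
    by move/eqP: cD; rewrite cards_eq0 => /eqP D0; rewrite D0 inE in bD.
  apply/imsetP; exists (D :\ b); last by rewrite setD1K.
  rewrite inE; apply/and3P; split.
  - apply/subsetP => c; rewrite !inE => /andP[-> cDD] /=.
    rewrite (subsetP sDB) //= andbT.
    by move/forall_inP/(_ _ bD)/forall_inP/(_ _ cDD): stD.
  - by move: cD; rewrite (cardsD1 b D) bD add1n => -[->].
  - apply/forall_inP => x; rewrite inE => /andP[_ xD].
    apply/forall_inP => y; rewrite inE => /andP[_ yD].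
    by move/forall_inP/(_ _ xD)/forall_inP/(_ _ yD): stD.
have m_gt0 : 0 < m by lia.
have H1 : #|stable_sets B1 d'| <= M * m ^ l.+1.
  rewrite -{1}(prednK m_gt0); apply: IH => //; lia.
have H2 : #|ext| <= M * m ^ l.
  rewrite /ext; move: {H1 sub} led'; rewrite /ext; case: d' @ext => [|e] ? led'; first by rewrite cards0.
  apply: leq_trans (leq_imset_card _ _) _.
  apply: (@leq_trans (M * #|B2|.+1 ^ l)); last first.
    rewrite leq_mul2l leq_exp_base ?orbT //; lia.
  apply: IH => //; try lia.
  (* The density at [b] gives [#|B2| * tau <= #|B| * tau.-1], which pays for lowering [l.+1] to
     [l]. *)
  rewrite -(ltn_pmul2l tau_gt0); apply: (@leq_ltn_trans (m * tau.-1 ^ l.+1)).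
    rewrite expnS !mulnA leq_mul2r; apply/orP; right; nia.
  by apply: leq_trans ltm _; rewrite expnS; lia.
apply: leq_trans (subset_leq_card sub) _.
apply: leq_trans (leq_card_setU _ _).1 _.
apply: leq_trans (leq_add H1 H2) _.
(* The two branches add up through [m ^ l.+1 + m ^ l <= m.+1 ^ l.+1]. *)
rewrite -mulnDr leq_mul2l; apply/orP; right.
rewrite !expnS -{2}(mul1n (m ^ l)) -mulnDl addn1 leq_mul2l /=.
by apply: leq_exp_base.
Qed.
End Container.

(** * Codegrees in linear hypergraphs *)

Lemma sqr_sum_le (I : finType) (A : {set I}) (d : I -> nat) :
  (\sum_(x in A) d x) ^ 2 <= #|A| * \sum_(x in A) d x ^ 2.
Proof.
have -> : (\sum_(x in A) d x) ^ 2 = \sum_(x in A) \sum_(y in A) d x * d y.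
  rewrite -mulnn big_distrl /=; apply: eq_bigr => x _.
  by rewrite big_distrr.
rewrite -(leq_pmul2l (isT : 0 < 2)) big_distrr /=.
apply: (@leq_trans (\sum_(x in A) \sum_(y in A) (d x ^ 2 + d y ^ 2))).
  apply: leq_sum => x _; rewrite big_distrr /=; apply: leq_sum => y _.
  by have := nat_Cauchy (d x) (d y) => -[].
rewrite (eq_bigr (fun x => #|A| * d x ^ 2 + \sum_(y in A) d y ^ 2)); last first.
  by move=> x _; rewrite big_split /= sum_nat_const.
by rewrite big_split /= sum_nat_const -big_distrr /= mul2n addnn.
Qed.

Section Codegree.
Variables (P Q : finType) (A : {set P}) (N : P -> {set Q}).

Definition codeg (a b : Q) : bool :=
  (a != b) && [exists x in A, (a \in N x) && (b \in N x)].

Hypothesis linN : forall x y a b, x \in A -> y \in A -> a != b ->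
  a \in N x -> b \in N x -> a \in N y -> b \in N y -> x = y.

(** By [linN] two distinct elements lie in at most one [N x], so [codeg b c] equals the number of
    [x] whose [N x] contains both. The second sum on the left is the diagonal [b = c]. *)
Lemma sum_codeg (B : {set Q}) :
  \sum_(b in B) #|[set c in B | codeg b c]| + \sum_(x in A) #|B :&: N x|
    = \sum_(x in A) #|B :&: N x| ^ 2.
Proof.
have codegE b c : b != c ->
    (codeg b c : nat) = \sum_(x in A) ((b \in N x) && (c \in N x)).
  move=> nbc; rewrite /codeg nbc /=; case: exists_inP => [[x xA bc]|nex].
    rewrite (bigD1 x) //= bc big1 // => y /andP[yA nyx].
    case: andP => // -[bNy cNy]; case/andP: bc => bNx cNx.
    by rewrite (linN yA xA nbc bNy cNy bNx cNx) eqxx in nyx.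
  rewrite big1 // => x xA; apply/eqP; rewrite eqb0; apply/negP => bc.
  by apply: nex; exists x.
have card1 (D : {set Q}) (r : pred Q) :
    #|[set c in D | r c]| = \sum_(c in D) (r c : nat).
  rewrite -sum1_card big_mkcond [RHS]big_mkcond /=; apply: eq_bigr => c _.
  by rewrite inE; case: (c \in D) => //=; case: (r c).
have cardI x : #|B :&: N x| = \sum_(c in B) ((c \in N x) : nat).
  rewrite -card1; congr #|pred_of_set _|; by apply/setP => c; rewrite !inE.
have -> : \sum_(x in A) #|B :&: N x| ^ 2 =
    \sum_(b in B) \sum_(c in B) \sum_(x in A) ((b \in N x) && (c \in N x) : nat).
  rewrite (eq_bigr (fun x => \sum_(b in B) \sum_(c in B)
      ((b \in N x) && (c \in N x) : nat))); last first.
    move=> x _; rewrite cardI -mulnn big_distrl /=; apply: eq_bigr => b _.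
    by rewrite big_distrr /=; apply: eq_bigr => c _; rewrite mulnb.
  rewrite exchange_big /=; apply: eq_bigr => b _.
  by rewrite exchange_big.
rewrite [X in _ + X](_ : _ = \sum_(b in B) \sum_(x in A) ((b \in N x) : nat));
  last first.
  by rewrite exchange_big /=; apply: eq_bigr => x _; rewrite cardI.
rewrite -big_split /=; apply: eq_bigr => b bB.
rewrite card1 (bigD1 b) //= [RHS](bigD1 b) //= /codeg eqxx /= add0n addnC.
congr (_ + _); first by apply: eq_bigr => x _; rewrite andbb.
by apply: eq_bigr => c /andP[_ ncb]; rewrite codegE // eq_sym.
Qed.

(** There are s >= [#|B| * e] incidences between [A] and [B], so by Cauchy-Schwarz at least s^2 / p
    ordered pairs lie in a common [N x]. The hypothesis [2 * p <= #|B| * e] makes the s diagonal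
    pairs at most half of them, and some [b] reaches the average. *)
Lemma codeg_dense (B : {set Q}) (p e : nat) :
  0 < p -> #|A| <= p ->
  (forall b, b \in B -> e <= #|[set x in A | b \in N x]|) ->
  2 * p <= #|B| * e ->
  exists2 b, b \in B &
    #|B| * e ^ 2 <= 2 * p * #|[set c in B | codeg b c]|.
Proof.
move=> p_gt0 leAp degB largeB.
case: (boolP [exists b in B, #|B| * e ^ 2 <= 2 * p * #|[set c in B | codeg b c]|]).
  by case/exists_inP => b bB; exists b.
rewrite negb_exists => /forallP nex; exfalso.
have lt b : b \in B -> 2 * p * #|[set c in B | codeg b c]| < #|B| * e ^ 2.
  by move=> bB; have := nex b; rewrite bB /= -ltnNge.
have B_gt0 : 0 < #|B| by case: #|B| largeB => //; lia.
have /card_gt0P[b0 b0B] := B_gt0.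
have sumlt : 2 * p * (\sum_(b in B) #|[set c in B | codeg b c]|)
             < #|B| * (#|B| * e ^ 2).
  rewrite -[X in _ < X * _]sum1_card big_distrl big_distrr /=.
  rewrite (bigD1 b0) //= [X in _ < X](bigD1 b0) //= mul1n.
  rewrite -addSn leq_add ?lt //.
  by apply: leq_sum => b /andP[bB _]; rewrite ltnW // lt.
have sE := sum_codeg B.
have cs := sqr_sum_le A (fun x => #|B :&: N x|).
have les : #|B| * e <= \sum_(x in A) #|B :&: N x|.
  have -> : \sum_(x in A) #|B :&: N x| =
      \sum_(b in B) #|[set x in A | b \in N x]|.
    rewrite (eq_bigr (fun x => \sum_(b in B | b \in N x) 1)); last first.
      by move=> x _; rewrite sum1_card; apply: eq_card => b; rewrite !inE.
    rewrite (exchange_big_dep (mem B)) /=; last by move=> x b _ /andP[].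
    apply: eq_bigr => b bB; rewrite -sum1_card; apply: eq_bigl => x.
    by rewrite !inE bB.
  rewrite -sum_nat_const; exact: leq_sum.
move: sE cs les sumlt; set s := \sum_(x in A) _; set s2 := \sum_(x in A) _.
set k := \sum_(b in B) _; set m := #|B| in largeB *; move=> sE cs les sumlt.
have cs' : s ^ 2 <= p * s2 by apply: leq_trans cs _; rewrite leq_mul2r leAp orbT.
have h : (m * e) ^ 2 <= s ^ 2 by apply: leq_exp_base.
nia.
Qed.

(** Sets that meet every [N x] at most once are stable for [codeg]. As (1 - 1/tau)^tau <= 1/2, [tau]
    choices halve the candidates, so [tau * l2] choices exhaust fewer than [2 ^ l2] of them. *)
Lemma count_stable_ext (B : {set Q}) (p e q tau R M d l2 : nat) :
  0 < p -> #|A| <= p -> #|B| <= q -> q < 2 ^ l2 ->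
  0 < tau -> 0 < R -> 2 * p <= R * e -> 2 * p <= tau * e ^ 2 ->
  (forall b, b \in B -> e <= #|[set x in A | b \in N x]|) ->
  (forall d', d' <= d -> 'C(R, d') <= M) ->
  #|[set D : {set Q} | [&& D \subset B, #|D| == d &
      [forall x in A, #|D :&: N x| <= 1]]]| <= M * q.+1 ^ (tau * l2).
Proof.
move=> p_gt0 leAp leBq ltq tau_gt0 R_gt0 leR letau degB binM.
apply: (@leq_trans #|stable_sets codeg B d|).
  apply: subset_leq_card; apply/subsetP => D; rewrite !inE.
  case/and3P=> -> -> /= /forall_inP lin; apply/forall_inP => a aD.
  apply/forall_inP => b bD; apply/negP => /andP[nab /exists_inP[x xA /andP[ax bx]]].
  have := lin x xA; rewrite leqNgt => /negP; apply.
  rewrite (cardsD1 a) (cardsD1 b) !inE aD ax eq_sym nab bD bx //.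
apply: (@stable_sets_container _ codeg B tau R M d) => //.
  move=> B' sB' leRB'.
  have [| |b bB' h] := @codeg_dense B' p e p_gt0 leAp.
  - by move=> b bB'; apply: degB; apply: (subsetP sB').
  - by apply: leq_trans leR _; rewrite leq_mul2r leRB' orbT.
  exists b => //.
  have e_gt0 : 0 < e by case: e leR {letau degB h} => //; lia.
  rewrite -(leq_pmul2l (_ : 0 < 2 * p)); last by lia.
  apply: (@leq_trans (tau * e ^ 2 * #|B'|)); first by rewrite leq_mul2r letau orbT.
  by rewrite -mulnA (mulnC (e ^ 2)) (mulnCA (2 * p)) leq_mul2l h orbT.
have step : 2 * tau.-1 ^ tau <= tau ^ tau.
  case: tau tau_gt0 {letau} => // t _ /=.
  rewrite -{2}(addn1 t) expnDn big_ord_recl /= subn0 bin0 mul1n exp1n muln1.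
  rewrite big_ord_recl /= /bump /= add1n bin1 subSS subn0 exp1n muln1.
  by rewrite mul2n -addnn leq_add2l expnS; nia.
have bound k : 2 ^ k * tau.-1 ^ (tau * k) <= tau ^ (tau * k).
  rewrite !expnM -expnMn; exact: leq_exp_base.
case: (posnP (tau.-1 ^ (tau * l2))) => [->|t_gt0].
  by rewrite muln0 muln_gt0 R_gt0 expn_gt0 tau_gt0.
apply: (@leq_trans (2 ^ l2 * tau.-1 ^ (tau * l2))); first by rewrite ltn_mul2r t_gt0.
by apply: leq_trans (bound l2) _; rewrite leq_pmull.
Qed.
End Codegree.

(** * Factorials and binomial coefficients *)

Lemma bin_le_exp2 n k : 'C(n, k) <= 2 ^ n.
Proof.
have -> : 2 ^ n = #|powerset [set: 'I_n]| by rewrite card_powerset cardsT card_ord.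
rewrite -{1}(card_ord n) -cardsT -cards_draws; apply: subset_leq_card.
by apply/subsetP => D; rewrite !inE => /andP[].
Qed.

Lemma ffact_ge_exp z d : z ^ d <= (z + d) ^_ d.
Proof.
elim: d => [|d IH]; first by rewrite ffactn0.
by rewrite addnS ffactnS expnS leq_mul //= ltnW // ltnS leq_addr.
Qed.

(** An integral form of z^d / d! <= e^z. For d <= z the quotient is at most a binomial coefficient
    of [z + d]; beyond z each further factor [z] is smaller than the new factor of the factorial. *)
Lemma exp_le_fact z d : z ^ d <= d`! * 4 ^ z.
Proof.
have small k : k <= z -> z ^ k <= k`! * 4 ^ z.
  move=> lekz; apply: leq_trans (ffact_ge_exp z k) _.
  rewrite -bin_ffact mulnC leq_mul2l; apply/orP; right.
  apply: leq_trans (bin_le_exp2 _ _) _.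
  by rewrite (_ : 4 = 2 ^ 2) // -expnM leq_exp2l // mul2n -addnn leq_add2l.
case: (leqP d z) => [|ltzd]; first exact: small.
rewrite -(subnK (ltnW ltzd)); elim: (d - z) => [|k IH]; first exact: small.
rewrite addSn expnS factS -mulnA leq_mul //; lia.
Qed.

Lemma bin_fact_le n d : 'C(n, d) * d`! <= n ^ d.
Proof. by rewrite bin_ffact; elim: d n => // d IH [|n] //; rewrite ffactnS expnS leq_mul2l
 (leq_trans (IH _)) ?orbT ?leq_exp_base ?leq_pred. Qed.

Lemma bin_le_exp n d : 'C(n, d) <= n ^ d.
Proof. by apply: leq_trans (bin_fact_le n d); rewrite leq_pmulr ?fact_gt0. Qed.

Lemma fact_le_exp d : d`! <= d ^ d.
Proof.
have le m n : m <= n -> m`! <= n ^ m.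
  elim: m => // m IH lt; rewrite factS expnS leq_mul // IH //; exact: ltnW.
exact: le.
Qed.

(* AM-GM in disguise: [(a / d) ^ d] is maximal at [d = a / e], so a binomial
   coefficient with [R * d <= a ^ 2] is at most exponential in [a]. *)
Lemma bin_le_exp4 R d a c : R * d <= a ^ 2 * c -> 'C(R, d) <= 16 ^ a * c ^ d.
Proof.
move=> le; have f2 : 0 < d`! ^ 2 by rewrite expn_gt0 fact_gt0.
rewrite -(leq_pmul2r f2) -mulnn mulnA.
apply: (@leq_trans (R ^ d * d ^ d)).
  by rewrite leq_mul ?bin_fact_le ?fact_le_exp.
rewrite -expnMn; apply: leq_trans (leq_exp_base _ le) _.
rewrite expnMn mulnAC leq_mul2r; apply/orP; right.
have -> : 16 ^ a = (4 ^ a) ^ 2 by rewrite -expnM mulnC expnM.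
have -> : (a ^ 2) ^ d = (a ^ d) ^ 2 by rewrite -!expnM mulnC.
by rewrite mulnn -expnMn leq_exp_base // mulnC exp_le_fact.
Qed.

(** * Attaching one vertex to a C4-free graph *)

Section Extension.
Variables (P Q : finType) (A : {set P}) (B : {set Q}) (N : P -> {set Q}).

Hypothesis linN : forall x y a b, x \in A -> y \in A -> a != b ->
  a \in N x -> b \in N x -> a \in N y -> b \in N y -> x = y.

(** These are the possible neighbourhoods of a new vertex: meeting an old neighbourhood [N x] twice
    would close a 4-cycle. *)
Definition lin_sets (d : nat) : {set {set Q}} :=
  [set D : {set Q} | [&& D \subset B, #|D| == d &
      [forall x in A, #|D :&: N x| <= 1]]].

(* If [d <= be / l] it suffices to count all subsets of size [d]; for the other [d]
   the codegree graph is so dense that the fingerprints are of polylogarithmic size. *)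
Lemma card_lin_sets (al be s d c l : nat) :
  #|A| <= al * s -> #|B| <= be * s -> be * s < 2 ^ l ->
  4 * l <= al -> 2 * l ^ 2 <= be -> 16 * l ^ 4 * s <= al * be ->
  0 < c -> 4 * s * be + d <= (3 * be) ^ 2 * c ->
  (forall b, b \in B -> d * al <= #|[set x in A | b \in N x]|.+1 * be) ->
  #|lin_sets d| <= 2 ^ (13 * be) * c ^ d.
Proof.
move=> leA leB ltl leal lebe les c_gt0 led degB.
have cd_gt0 : 0 < c ^ d by rewrite expn_gt0 c_gt0.
case: (leqP (d * l) be) => [small|large].
  apply: (@leq_trans (2 ^ (13 * be))); last by rewrite leq_pmulr.
  apply: (@leq_trans 'C(#|B|, d)).
    rewrite -cards_draws; apply: subset_leq_card; apply/subsetP => D.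
    by rewrite !inE => /and3P[-> ->].
  apply: leq_trans (bin_le_exp _ _) _.
  apply: (@leq_trans ((2 ^ l) ^ d)); first by apply: leq_exp_base; lia.
  by rewrite -expnM leq_exp2l //; nia.
have l_gt0 : 0 < l by case: l large {ltl leal lebe les}; rewrite ?muln0.
have d_gt0 : 0 < d by case: d large {led degB cd_gt0}; rewrite ?mul0n.
have be_gt0 : 0 < be by nia.
have al_gt0 : 0 < al by nia.
have [s0|s_gt0] := posnP s.
  rewrite s0 muln0 in leB; move: leB; rewrite leqn0 cards_eq0 => /eqP B0.
  apply: (@leq_trans 0) => //; rewrite leqn0 cards_eq0; apply/eqP/setP => D.
  rewrite !inE B0 subset0; apply/negP => /and3P[/eqP -> ]; rewrite cards0.
  by rewrite eq_sym (gtn_eqF d_gt0).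
have dal : 4 * be <= d * al by nia.
(* [e] is the degree guaranteed by [degB], whose [.+1] accounts for the removed vertex. With [e]
   estimated by d al / (2 be), [R] and [tau] are, up to rounding, the least values with
   [2 * (al * s) <= R * e] and [2 * (al * s) <= tau * e ^ 2]; in the latter [be < d * l] turns (be /
   d)^2 into [l ^ 2]. *)
pose e := (d * al) %/ be - 1.
have e_big : d * al <= 2 * be * e.
  have := divn_eq (d * al) be; have := ltn_pmod (d * al) be_gt0.
  rewrite /e; move: (_ %/ _) (_ %% _) => k r; nia.
pose R := (4 * s * be) %/ d + 1.
have R_big : 4 * s * be <= R * d.
  have := divn_eq (4 * s * be) d; have := ltn_pmod (4 * s * be) d_gt0.
  rewrite /R; move: (_ %/ _) (_ %% _) => k r; nia.
have R_small : R * d <= 4 * s * be + d.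
  by rewrite /R mulnDl mul1n leq_add2r leq_divM.
pose tau := (8 * s * l ^ 2) %/ al + 1.
have tau_big : 8 * s * l ^ 2 <= tau * al.
  have := divn_eq (8 * s * l ^ 2) al; have := ltn_pmod (8 * s * l ^ 2) al_gt0.
  rewrite /tau; move: (_ %/ _) (_ %% _) => k r; nia.
have tau_small : tau * al <= 8 * s * l ^ 2 + al.
  by rewrite /tau mulnDl mul1n leq_add2r leq_divM.
(* The first two factors count the choices among [R] remaining candidates, by [bin_le_exp4] with
   [a = 3 * be]. The last one counts the fingerprints and is at most [2 ^ be], because
   [tau * l ^ 2 <= be]. *)
apply: (@leq_trans (16 ^ (3 * be) * c ^ d * (be * s).+1 ^ (tau * l))); last first.
  rewrite mulnAC leq_mul2r; apply/orP; right.
  apply: (@leq_trans (2 ^ (12 * be) * 2 ^ be)); last by rewrite -expnD -mulSnr.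
  apply: leq_mul; first by rewrite (_ : 16 = 2 ^ 4) // -expnM mulnA.
  apply: (@leq_trans ((2 ^ l) ^ (tau * l))); first exact: leq_exp_base.
  rewrite -expnM leq_exp2l // -(leq_pmul2r al_gt0).
  apply: (@leq_trans ((8 * s * l ^ 2 + al) * l ^ 2)).
    have -> : l * (tau * l) * al = tau * al * l ^ 2 by lia.
    by rewrite leq_mul2r tau_small orbT.
  nia.
apply: (@count_stable_ext _ _ _ _ linN B (al * s) e (be * s) tau R) => //.
- by rewrite muln_gt0 al_gt0.
- by rewrite /tau addn1.
- by rewrite /R addn1.
- rewrite -(leq_pmul2r (_ : 0 < 2 * be)); last by lia.
  apply: (@leq_trans (R * (d * al))); last by rewrite -mulnA leq_mul2l (mulnC e) e_big orbT.
  have : 4 * s * be * al <= R * d * al by rewrite leq_mul2r R_big orbT.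
  by lia.
- rewrite -(leq_pmul2r (_ : 0 < 4 * be ^ 2)); last by nia.
  apply: (@leq_trans (tau * (d * al) ^ 2)); last first.
    rewrite -mulnA leq_mul2l; apply/orP; right.
    by apply: leq_trans (leq_exp_base 2 e_big) _; lia.
  rewrite -(leq_pmul2r (_ : 0 < l ^ 2)); last by rewrite expn_gt0 l_gt0.
  have h : be ^ 2 <= (d * l) ^ 2 by apply: leq_exp_base; exact: ltnW.
  apply: (@leq_trans (al * (8 * s * l ^ 2) * be ^ 2)); first by lia.
  apply: (@leq_trans (al * (tau * al) * (d * l) ^ 2)); last by lia.
  by apply: leq_mul => //; rewrite leq_mul2l tau_big orbT.
- move=> b bB; have := degB b bB; move: #|_| => k hk.
  have := leq_divM (d * al) be; rewrite /e; move: (_ %/ _) => t ht.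
  have : t * be <= k.+1 * be by apply: leq_trans hk.
  rewrite leq_pmul2r //; lia.
- move=> d' led'; apply: (@leq_trans (16 ^ (3 * be) * c ^ d')).
    apply: bin_le_exp4; apply: leq_trans led; apply: leq_trans R_small.
    by rewrite leq_mul2l led' orbT.
  by rewrite leq_mul2l leq_pexp2l ?orbT.
Qed.
End Extension.

Lemma card_cover_le (I T : finType) (A : {set I}) (G : {set T}) (F : I -> {set T}) :
  (forall E, E \in G -> exists2 i, i \in A & E \in F i) ->
  #|G| <= \sum_(i in A) #|F i|.
Proof.
move=> cov; apply: (@leq_trans #|\bigcup_(i in A) F i|).
  apply: subset_leq_card; apply/subsetP => E /cov[i iA EF].
  by apply/bigcupP; exists i.
elim/big_rec2: _ => [|i m G' _ le]; first by rewrite cards0.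
by apply: leq_trans (leq_card_setU _ _).1 _; rewrite leq_add2l.
Qed.

Lemma card_glue_le (T D : finType) (G G' : {set T}) (F : T -> {set D})
    (glue : T -> D -> T) f :
  (forall E, E \in G -> exists2 E', E' \in G' & exists2 d, d \in F E' & E = glue E' d) ->
  (forall E', E' \in G' -> #|F E'| <= f) ->
  #|G| <= #|G'| * f.
Proof.
move=> dec leF.
apply: leq_trans (_ : \sum_(E' in G') #|glue E' @: F E'| <= _).
  apply: card_cover_le => E /dec[E' E'G [d dF ->]]; exists E' => //.
  exact: imset_f.
rewrite -sum_nat_const; apply: leq_sum => E' E'G.
by apply: leq_trans (leF _ E'G); apply: leq_imset_card.
Qed.

Lemma card_by_size (Q : finType) (F : {set {set Q}}) n f :
  (forall D, D \in F -> #|D| <= n) ->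
  (forall d, d <= n -> #|[set D in F | #|D| == d]| <= f) ->
  #|F| <= n.+1 * f.
Proof.
move=> leF lef; apply: leq_trans
  (_ : \sum_(d in [set: 'I_n.+1]) #|[set D in F | #|D| == d]| <= _).
  apply: card_cover_le => D DF; exists (Ordinal (leF D DF : #|D| < n.+1)) => //.
  by rewrite inE DF /=.
have -> : n.+1 * f = \sum_(d in [set: 'I_n.+1]) f.
  by rewrite sum_nat_const cardsT card_ord.
by apply: leq_sum => d _; apply: lef; rewrite -ltnS.
Qed.

(** * Counting C4-free bipartite graphs *)

Section Bipartite.
Variables (X Y : finType).
Implicit Types (E : {set X * Y}) (A : {set X}) (B : {set Y}).

Definition c4free E : bool :=
  [forall x, forall x', forall y, forall y',
     [&& (x, y) \in E, (x, y') \in E, (x', y) \in E & (x', y') \in E] ==>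
     (x == x') || (y == y')].

Definition bip A B : {set {set X * Y}} :=
  [set E : {set X * Y} | (E \subset setX A B) && c4free E].

Definition rowN E x := [set y | (x, y) \in E].
Definition colN E y := [set x | (x, y) \in E].

Lemma c4freeP E : reflect (forall x x' y y', (x, y) \in E -> (x, y') \in E ->
  (x', y) \in E -> (x', y') \in E -> x = x' \/ y = y') (c4free E).
Proof.
apply: (iffP idP) => [c4 x x' y y' e1 e2 e3 e4|c4].
  move/forallP/(_ x)/forallP/(_ x')/forallP/(_ y)/forallP/(_ y'): c4.
  by rewrite e1 e2 e3 e4 /= => /orP[]/eqP; [left|right].
apply/forallP => x; apply/forallP => x'; apply/forallP => y; apply/forallP => y'.
apply/implyP => /and4P[e1 e2 e3 e4].
by case: (c4 _ _ _ _ e1 e2 e3 e4) => ->; rewrite eqxx ?orbT.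
Qed.

Lemma c4free_sub E E' : E' \subset E -> c4free E -> c4free E'.
Proof.
move=> /subsetP sub /c4freeP c4; apply/c4freeP => x x' y y' e1 e2 e3 e4.
by apply: (c4 x x' y y'); apply: sub.
Qed.

Section Params.
Variables (w s j l : nat).
Hypotheses (ltsl : s * s < 2 ^ l) (ltwl : w * s < 2 ^ l) (s_gt1 : 1 < s)
  (le4w : 4 * l <= w) (le4s : 4 * l <= s) (le2w : 2 * l ^ 2 <= w)
  (le2s : 2 * l ^ 2 <= s) (le16 : 16 * l ^ 4 <= w) (lesw : s <= w * 2 ^ j)
  (w_gt0 : 0 < w).

(** A C4-free graph with parts [w * s] and [s * s] has at most on the order of w s^2 edges, that is,
    row degrees about s and column degrees about w. [FX] and [FY] are the costs of one row and one
    column: boundedly many bits per typical edge, and [2 * j] more in a column because [s] may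
    exceed [w] by a factor [2 ^ j]. *)
Let FX := (s * s).+1 * 2 ^ (13 * s).
Let FY := (w * s).+1 * 2 ^ (13 * w + 2 * w * j).

Lemma bip_remove_row A B x : x \in A -> #|A| <= w * s -> #|B| <= s * s ->
  #|[set E in bip A B | [forall y in B, #|rowN E x| * w <= #|colN E y| * s]]|
    <= #|bip (A :\ x) B| * FX.
Proof.
move=> xA leA leB.
pose glue E (D : {set Y}) := E :|: setX [set x] D.
pose F E := [set D : {set Y} | [&& D \subset B, c4free (glue E D) &
  [forall y in B, #|D| * w <= #|colN (glue E D) y| * s]]].
apply: (@card_glue_le _ _ _ _ F glue).
  move=> E; rewrite inE => /andP[]; rewrite inE => /andP[sE c4E] degE.
  have E_eq : E = glue (E :&: setX (A :\ x) B) (rowN E x).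
    apply/setP => -[x' y]; rewrite !inE /=; case: eqP => [->|nx] /=.
      by rewrite andbF.
    rewrite orbF; case: (boolP ((x', y) \in E)) => //= /(subsetP sE).
    by rewrite inE => /andP[-> ->].
  exists (E :&: setX (A :\ x) B).
    by rewrite inE subsetIr (c4free_sub _ c4E) // subsetIl.
  exists (rowN E x) => //; rewrite inE -E_eq c4E degE !andbT /=.
  by apply/subsetP => y; rewrite inE => /(subsetP sE); rewrite inE => /andP[].
move=> E; rewrite inE => /andP[sE c4E].
have leD D : D \in F E -> #|D| <= s * s.
  by rewrite inE => /and3P[sD _ _]; apply: leq_trans leB; apply: subset_leq_card.
apply: card_by_size => // d led.
(* The degree condition, once [x] itself is discounted, involves [D] only through its size, so a
   single witness [D0] supplies [degB] for the whole class. *)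
have [->|[D0]] := set_0Vmem [set D in F E | #|D| == d]; first by rewrite cards0.
rewrite !inE => /andP[/and3P[sD0 _ degD0] /eqP cD0].
apply: (@leq_trans #|lin_sets (A :\ x) B (rowN E) d|).
  apply: subset_leq_card; apply/subsetP => D; rewrite !inE.
  case/andP=> /and3P[-> c4D _] -> /=; apply/forall_inP => x'.
  rewrite !inE => /andP[nx' x'A]; rewrite leqNgt; apply/negP.
  case/card_gt1P => y [y' []]; rewrite !inE => /andP[yD x'y] /andP[y'D x'y'].
  move=> nyy'; move/c4freeP: c4D => /(_ x' x y y').
  rewrite !inE /= x'y x'y' eqxx yD y'D /= !orbT => /(_ isT isT isT isT) [] h.
    by rewrite h eqxx in nx'.
  by rewrite h eqxx in nyy'.
apply: (@leq_trans (2 ^ (13 * s) * 1 ^ d)); last by rewrite exp1n muln1.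
apply: (@card_lin_sets _ _ _ _ _ _ w s s d 1 l) => //.
- move=> x1 x2 a b _ _ nab; rewrite !inE => e1 e2 e3 e4.
  case: (c4freeP _ c4E x1 x2 a b e1 e2 e3 e4) => // h.
  by rewrite h eqxx in nab.
- by apply: leq_trans leA; apply: subset_leq_card; apply: subD1set.
- by rewrite leq_mul2r le16 orbT.
- nia.
move=> b bB; move/forall_inP/(_ b bB): degD0; rewrite cD0 => le.
apply: leq_trans le _; rewrite leq_mul2r; apply/orP; right.
apply: (@leq_trans #|x |: [set x' in A :\ x | b \in rowN E x']|); last first.
  by rewrite cardsU1 -add1n leq_add2r leq_b1.
apply: subset_leq_card; apply/subsetP => x'; rewrite !inE /=.
case: eqP => //= nx; rewrite orbF => x'b; rewrite x'b andbT.
by move/subsetP: sE => /(_ _ x'b); rewrite !inE => /andP[/andP[]].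
Qed.

(** Columns that meet in a row [x] share no other row, so deg x (deg y - 1) <= w s for a neighbour
    [x] of [y]. With deg x >= deg y s / w this bounds deg y by about w. It keeps the factor [c ^ d]
    of [card_lin_sets] down to [2 ^ (2 * w * j)]. *)
Lemma c4free_col_deg A B E y : E \in bip A B -> #|A| <= w * s -> y \in B ->
  (forall y', y' \in B -> #|colN E y| <= #|colN E y'|) ->
  (forall x, x \in A -> #|colN E y| * s <= #|rowN E x| * w) ->
  #|colN E y| <= 2 * w.
Proof.
rewrite inE => /andP[sE /c4freeP c4] leA yB miny minx.
have [c0|/card_gt0P[x]] := posnP #|colN E y|; first by rewrite c0.
rewrite inE => xy.
have xA : x \in A by move: (subsetP sE _ xy); rewrite inE => /andP[].
have disj : \sum_(y' in rowN E x) #|colN E y' :\ x| <= #|A|.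
  rewrite -sum1_card.
  rewrite (eq_bigr (fun y' => \sum_(x' in A | x' \in colN E y' :\ x) 1)); last first.
    move=> y' _; rewrite sum1_card; apply: eq_card => x'; rewrite [RHS]unfold_in !inE.
    case: (boolP ((x', y') \in E)) => [/(subsetP sE)|]; rewrite ?andbF //.
    by rewrite inE /= => /andP[->]; rewrite !andbT.
  rewrite (exchange_big_dep (mem A)) /=; last by move=> y' x' _ /andP[].
  apply: leq_sum => x' x'A; rewrite sum1_card leqNgt; apply/negP.
  case/card_gt1P => y1 [y2 [h1 h2 ny]].
  have {h1} : [&& y1 \in rowN E x, x' \in A & x' \in colN E y1 :\ x] by exact: h1.
  have {h2} : [&& y2 \in rowN E x, x' \in A & x' \in colN E y2 :\ x] by exact: h2.
  rewrite !inE x'A /= => /andP[xy2 /andP[nx x'y2]] /andP[xy1 /andP[_ x'y1]].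
  case: (c4 x' x y1 y2 x'y1 x'y2 xy1 xy2) => h; first by rewrite h eqxx in nx.
  by rewrite h eqxx in ny.
have low : #|rowN E x| * (#|colN E y| - 1) <= w * s.
  apply: leq_trans leA; apply: leq_trans disj; rewrite -sum_nat_const.
  apply: leq_sum => y'; rewrite inE => xy'.
  have y'B : y' \in B by move: (subsetP sE _ xy'); rewrite inE => /andP[].
  have := miny y' y'B; rewrite (cardsD1 x (colN E y')) inE xy'; lia.
have := minx x xA; move: low; move: #|rowN E x| #|colN E y| => r c.
case: c => // c; rewrite subn1 /= => h1 h2; rewrite leqNgt; apply/negP => h3.
have h4 : c.+1 * s * c <= w * s * w.
  by apply: (@leq_trans (r * w * c)); [rewrite leq_mul2r h2 orbT | nia].
have h5 : c.+1 * c <= w * w.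
  by rewrite -(leq_pmul2r (_ : 0 < s)); [lia | apply: ltnW].
nia.
Qed.

Lemma bip_remove_col A B y : y \in B -> #|A| <= w * s -> #|B| <= s * s ->
  #|[set E in bip A B | [forall x in A, #|colN E y| * s <= #|rowN E x| * w] &&
       [forall y' in B, #|colN E y| <= #|colN E y'|]]|
    <= #|bip A (B :\ y)| * FY.
Proof.
move=> yB leA leB.
pose glue E (D : {set X}) := E :|: setX D [set y].
pose F E := [set D : {set X} | [&& D \subset A, c4free (glue E D), #|D| <= 2 * w &
  [forall x in A, #|D| * s <= #|rowN (glue E D) x| * w]]].
apply: (@card_glue_le _ _ _ _ F glue).
  move=> E; rewrite inE => /andP[EAB]; move: (EAB).
  rewrite inE => /andP[sE c4E] /andP[degE mincol].
  have E_eq : E = glue (E :&: setX A (B :\ y)) (colN E y).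
    apply/setP => -[x y']; rewrite !inE /=; case: eqP => [->|ny] /=.
      by rewrite !andbF andbT.
    rewrite andbF orbF; case: (boolP ((x, y') \in E)) => //= /(subsetP sE).
    by rewrite inE => /andP[-> ->].
  exists (E :&: setX A (B :\ y)).
    by rewrite inE subsetIr (c4free_sub _ c4E) // subsetIl.
  exists (colN E y) => //; rewrite inE -E_eq c4E degE !andbT /=.
  rewrite (c4free_col_deg EAB leA yB) ?andbT.
  - by apply/subsetP => x; rewrite inE => /(subsetP sE); rewrite inE => /andP[].
  - by move=> y' y'B; move/forall_inP: mincol; apply.
  - by move=> x xA; move/forall_inP: degE; apply.
move=> E; rewrite inE => /andP[sE c4E].
have leD D : D \in F E -> #|D| <= w * s.
  by rewrite inE => /and4P[sD _ _ _]; apply: leq_trans leA; apply: subset_leq_card.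
apply: card_by_size => // d led.
have [->|[D0]] := set_0Vmem [set D in F E | #|D| == d]; first by rewrite cards0.
rewrite !inE => /andP[/and4P[sD0 _ le2D degD0] /eqP cD0].
rewrite cD0 in le2D.
apply: (@leq_trans #|lin_sets (B :\ y) A (colN E) d|).
  apply: subset_leq_card; apply/subsetP => D; rewrite !inE.
  case/andP=> /and4P[-> c4D _ _] -> /=; apply/forall_inP => y'.
  rewrite !inE => /andP[ny' y'B]; rewrite leqNgt; apply/negP.
  case/card_gt1P => x [x' []]; rewrite !inE => /andP[xD xy'] /andP[x'D x'y'].
  move=> nxx'; move/c4freeP: c4D => /(_ x x' y' y).
  rewrite !inE /= xy' x'y' eqxx xD x'D /= !orbT => /(_ isT isT isT isT) [] h.
    by rewrite h eqxx in nxx'.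
  by rewrite h eqxx in ny'.
apply: (@leq_trans (2 ^ (13 * w) * (2 ^ j) ^ d)); last first.
  by rewrite expnD leq_mul2l -expnM leq_exp2l // (mulnC j) leq_mul2r le2D !orbT.
apply: (@card_lin_sets _ _ _ _ _ _ s w s d (2 ^ j) l) => //.
- move=> y1 y2 a b _ _ nab; rewrite !inE => e1 e2 e3 e4.
  case: (c4freeP _ c4E a b y1 y2 e1 e3 e2 e4) => // h.
  by rewrite h eqxx in nab.
- by apply: leq_trans leB; apply: subset_leq_card; apply: subD1set.
- by rewrite mulnC leq_mul2l le16 orbT.
- by rewrite expn_gt0.
(* Now [be = w] may be smaller than [s], so that [4 * s * w] may exceed [(3 * w) ^ 2]; the factor
   [c = 2 ^ j] makes up for it. *)
- apply: (@leq_trans (9 * w * s)); first by nia.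
  by rewrite expnMn (_ : 3 ^ 2 = 9) // -mulnn -!mulnA !leq_mul2l lesw !orbT.
move=> b bA; move/forall_inP/(_ b bA): degD0; rewrite cD0 => le.
apply: leq_trans le _; rewrite leq_mul2r; apply/orP; right.
apply: (@leq_trans #|y |: [set y' in B :\ y | b \in colN E y']|); last first.
  by rewrite cardsU1 -add1n leq_add2r leq_b1.
apply: subset_leq_card; apply/subsetP => y'; rewrite !inE /=.
case: eqP => //= ny; rewrite andbF orbF => by'; rewrite by' andbT.
by move/subsetP: sE => /(_ _ by'); rewrite !inE => /andP[_ /andP[]].
Qed.

Lemma bip_set0 A B : #|A| = 0 \/ #|B| = 0 -> #|bip A B| <= 1.
Proof.
move=> AB0; rewrite -(cards1 (set0 : {set X * Y})); apply: subset_leq_card.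
apply/subsetP => E; rewrite !inE => /andP[sE _]; rewrite -subset0.
apply: subset_trans sE _; apply/subsetP => -[x y]; rewrite !inE.
by case: AB0 => /eqP; rewrite cards_eq0 => /eqP -> /=; rewrite inE ?andbF.
Qed.

(* A vertex of minimal normalised degree is removed, comparing [deg x / s] with
   [deg y / w]: all remaining vertices then meet the hypothesis of [card_lin_sets]. *)
Lemma card_bip_rec k A B : #|A| + #|B| <= k -> #|A| + #|B| <= 2 ^ l.+1 ->
  #|A| <= w * s -> #|B| <= s * s ->
  #|bip A B| <= (2 ^ l.+1) ^ (#|A| + #|B|) * FX ^ #|A| * FY ^ #|B|.
Proof.
have FX_gt0 : 0 < FX by rewrite muln_gt0 expn_gt0.
have FY_gt0 : 0 < FY by rewrite muln_gt0 expn_gt0.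
elim: k A B => [|k IH] A B lek leK leA leB.
all: have [A0|A_gt0] := posnP #|A|.
1,3: by apply: leq_trans (bip_set0 (or_introl A0)) _; rewrite !muln_gt0 !expn_gt0 FX_gt0 FY_gt0.
all: have [B0|B_gt0] := posnP #|B|.
1,3: by apply: leq_trans (bip_set0 (or_intror B0)) _; rewrite !muln_gt0 !expn_gt0 FX_gt0 FY_gt0.
  by lia.
have /card_gt0P[xi xiA] := A_gt0; have /card_gt0P[yi yiB] := B_gt0.
pose Z := (2 ^ l.+1) ^ (#|A| + #|B| - 1) * FX ^ #|A| * FY ^ #|B|.
pose GX x := [set E in bip A B | [forall y in B, #|rowN E x| * w <= #|colN E y| * s]].
pose GY y := [set E in bip A B | [forall x in A, #|colN E y| * s <= #|rowN E x| * w] &&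
       [forall y' in B, #|colN E y| <= #|colN E y'|]].
have leGX x : x \in A -> #|GX x| <= Z.
  move=> xA; have cA := cardsD1 x A; rewrite xA add1n in cA.
  apply: leq_trans (bip_remove_row xA leA leB) _.
  apply: (@leq_trans ((2 ^ l.+1) ^ (#|A :\ x| + #|B|) * FX ^ #|A :\ x| * FY ^ #|B| * FX)).
    by rewrite leq_mul2r IH ?orbT //; lia.
  rewrite /Z cA addSn subn1 /= (expnS FX).
  move: (_ ^ (_ + _)) (FX ^ _) (FY ^ _) => a b c; move: FX => f; lia.
have leGY y : y \in B -> #|GY y| <= Z.
  move=> yB; have cB := cardsD1 y B; rewrite yB add1n in cB.
  apply: leq_trans (bip_remove_col yB leA leB) _.
  apply: (@leq_trans ((2 ^ l.+1) ^ (#|A| + #|B :\ y|) * FX ^ #|A| * FY ^ #|B :\ y| * FY)).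
    by rewrite leq_mul2r IH ?orbT //; lia.
  rewrite /Z cB addnS subn1 /= (expnS FY).
  move: (_ ^ (_ + _)) (FX ^ _) (FY ^ _) => a b c; move: FY => f; lia.
pose UX := \bigcup_(x in A) GX x; pose UY := \bigcup_(y in B) GY y.
have cov : bip A B \subset UX :|: UY.
  apply/subsetP => E EAB.
  have [x0 x0A minx] := arg_minnP (fun x => #|rowN E x|) xiA.
  have [y0 y0B miny] := arg_minnP (fun y => #|colN E y|) yiB.
  rewrite inE; case: (leqP (#|rowN E x0| * w) (#|colN E y0| * s)) => [le|lt].
    apply/orP; left; apply/bigcupP; exists x0 => //; rewrite inE EAB /=.
    apply/forall_inP => y yB; apply: leq_trans le _.
    by rewrite leq_mul2r miny ?orbT.
  apply/orP; right; apply/bigcupP; exists y0 => //; rewrite inE EAB /=.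
  apply/andP; split; last by apply/forall_inP => y; exact: miny.
  apply/forall_inP => x xA.
  by apply: leq_trans (ltnW lt) _; rewrite leq_mul2r minx ?orbT.
apply: leq_trans (subset_leq_card cov) _.
apply: leq_trans (leq_card_setU _ _).1 _.
apply: (@leq_trans (#|A| * Z + #|B| * Z)).
  apply: leq_add.
    apply: (@leq_trans (\sum_(x in A) #|GX x|)).
      by apply: card_cover_le => E /bigcupP[x xA Ex]; exists x.
    by rewrite -sum_nat_const; apply: leq_sum => x; exact: leGX.
  apply: (@leq_trans (\sum_(y in B) #|GY y|)).
    by apply: card_cover_le => E /bigcupP[y yB Ey]; exists y.
  by rewrite -sum_nat_const; apply: leq_sum => y; exact: leGY.
(* One factor [2 ^ l.+1] per removal pays for the choice of the removed vertex. *)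
rewrite -mulnDl; apply: (@leq_trans (2 ^ l.+1 * Z)); first by rewrite leq_mul2r leK orbT.
have -> : #|A| + #|B| = (#|A| + #|B| - 1).+1 by lia.
by rewrite /Z subn1 /= (expnS (2 ^ l.+1)) !mulnA.
Qed.

(** Rows and columns cost 13 w s^2 and (13 + 2 j) w s^2 bits. The terms with [l] are absorbed, as
    [l] is below both [w] and [s]. *)
Lemma card_bip A B : #|A| <= w * s -> #|B| <= s * s -> 0 < l ->
  #|bip A B| <= 2 ^ (w * s * s * (40 + 2 * j)).
Proof.
move=> leA leB l_gt0.
apply: leq_trans (@card_bip_rec _ A B (leqnn _) _ leA leB) _.
  by rewrite expnS mul2n -addnn; apply: leq_add; lia.
have leFX : FX <= 2 ^ (13 * s + l) by rewrite /FX addnC expnD leq_mul2r ltsl orbT.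
have leFY : FY <= 2 ^ (13 * w + 2 * w * j + l).
  by rewrite /FY (expnD _ _ l) (mulnC _ (2 ^ l)) leq_mul2r ltwl orbT.
apply: (@leq_trans (2 ^ (l.+1 * (#|A| + #|B|)) * 2 ^ ((13 * s + l) * #|A|)
   * 2 ^ ((13 * w + 2 * w * j + l) * #|B|))).
  rewrite -expnM; apply: leq_mul; first apply: leq_mul => //.
    by rewrite expnM leq_exp_base.
  by rewrite expnM leq_exp_base.
rewrite -!expnD leq_exp2l //.
apply: (@leq_trans (l.+1 * (w * s + s * s) + (13 * s + l) * (w * s)
   + (13 * w + 2 * w * j + l) * (s * s))).
  by apply: leq_add; [apply: leq_add|]; rewrite leq_mul2l; apply/orP; right=> //; apply: leq_add.
have ls : l <= s by lia.
have lw : l <= w by lia.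
have a1 : l * (w * s) <= s * (w * s) by rewrite leq_mul2r ls orbT.
have a2 : l * (s * s) <= w * (s * s) by rewrite leq_mul2r lw orbT.
have a3 : 1 * (w * s) <= s * (w * s) by rewrite leq_mul2r ltnW ?orbT.
have a4 : 1 * (s * s) <= w * (s * s) by rewrite leq_mul2r w_gt0 orbT.
nia.
Qed.
End Params.
End Bipartite.

(** * Primes and rough numbers *)

Lemma prod_primes_dvd (s : seq nat) m :
  uniq s -> all prime s -> (forall p, p \in s -> p %| m) -> \prod_(p <- s) p %| m.
Proof.
elim: s => [|p s IH] /=; first by rewrite big_nil dvd1n.
case/andP => ps us /andP[pp ap] dv; rewrite big_cons Gauss_dvd.
  by rewrite dv ?mem_head // IH // => q qs; apply: dv; rewrite inE qs orbT.
rewrite big_seq_cond; apply: (big_ind (coprime p)) => [|a b|q].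
- by rewrite coprimen1.
- by rewrite coprimeMr => -> ->.
rewrite andbT => qs; rewrite prime_coprime // dvdn_prime2 ?(allP ap q qs) //.
by apply: contraNneq ps => ->.
Qed.

Lemma bin_odd_mid m : 'C(m.*2.+1, m) <= 4 ^ m.
Proof.
rewrite -(leq_pmul2l (isT : 0 < 2)).
have -> : 2 * 4 ^ m = 2 ^ m.*2.+1.
  by rewrite expnS -mul2n expnM.
rewrite -[2](_ : 1 + 1 = 2) // expnDn.
have lem : m < m.*2.+2 by lia.
have lem1 : m.+1 < m.*2.+2 by lia.
rewrite (bigD1 (Ordinal lem)) //= (bigD1 (Ordinal lem1)) /=; last first.
  by apply/eqP => -[]; lia.
rewrite !exp1n !muln1.
have -> : 'C(m.*2.+1, m.+1) = 'C(m.*2.+1, m).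
  by rewrite -bin_sub; [congr 'C(_, _); lia | lia].
by rewrite mulnDl mul1n addnA leq_addr.
Qed.

Definition primorial n := \prod_(0 <= p < n.+1 | prime p) p.

(** Erdos's argument: for n = 2 m + 1 the primes above m + 1 divide 'C(n, m), which is at most 4^m
    because it occurs twice in the expansion of 2^n. *)
Lemma primorial_le n : primorial n <= 4 ^ n.
Proof.
elim: {n}_.+1 {-2}n (ltnSn n) => // k IH n ltnk.
case: (leqP n 2) => [|n_gt2].
  by case: n {ltnk} => [|[|[|]]] // _; rewrite /primorial unlock.
have split m : m <= n -> primorial n = primorial m * \prod_(m.+1 <= p < n.+1 | prime p) p.
  by move=> le; rewrite /primorial (big_cat_nat (n := m.+1)).
case: (boolP (odd n)) => [nodd|neven]; last first.
  rewrite (split n.-1) ?leq_pred // prednK; last by lia.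
  rewrite big_ltn_cond // big_geq // ifN ?muln1.
    by apply: (@leq_trans (4 ^ n.-1)); [apply: IH; lia | rewrite leq_exp2l // leq_pred].
  by apply/negP => pn; have := even_prime pn; case; [lia | rewrite (negbTE neven)].
have [m Em] : exists m, n = m.*2.+1 by exists n./2; rewrite -{1}(odd_double_half n) nodd.
rewrite (split m.+1); last by lia.
apply: (@leq_trans (4 ^ m.+1 * 4 ^ m)); last by rewrite -expnD leq_exp2l //; lia.
apply: leq_mul; first by apply: IH; lia.
apply: leq_trans (bin_odd_mid m); apply: dvdn_leq; first by rewrite bin_gt0; lia.
rewrite -big_filter; apply: prod_primes_dvd.
- by rewrite filter_uniq // iota_uniq.
- exact: filter_all.
move=> p; rewrite mem_filter mem_index_iota => /andP[pp /andP[ltmp lepn]].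
have : p %| (m.*2.+1)`! by rewrite dvdn_fact // prime_gt0 //=; lia.
rewrite -(@bin_fact _ m); last by lia.
have ndv a : a < p -> (p %| a`!) = false.
  elim: a => [|a IHa] lta; first by rewrite dvdn1; case: eqP pp => // ->.
  by rewrite factS Euclid_dvdM // IHa ?gtnNdvd // ltnW.
by rewrite !Euclid_dvdM // !ndv ?orbF //; lia.
Qed.

Definition rough (t a : nat) : bool := (1 < a) && all (fun p => t < p) (primes a).

(** Every such prime contributes a factor above [2 ^ t] to [primorial z <= 4 ^ z]. *)
Lemma card_primes_range N z t :
  t * #|[set p : 'I_N | prime p & 2 ^ t < p <= z]| <= 2 * z.
Proof.
set A := [set _ | _].
rewrite -(@leq_exp2l 2) // [2 ^ (2 * z)]expnM expnM.
apply: leq_trans (primorial_le z).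
apply: (@leq_trans (\prod_(p in A) (p : nat))).
  rewrite -prod_nat_const; apply: leq_prod => p.
  by rewrite inE => /and3P[_ lt _]; exact: ltnW.
apply: dvdn_leq; first by apply/prodn_cond_gt0 => p /prime_gt0.
rewrite -big_enum -[X in X %| _]/(\prod_(i <- enum A) val i) -(big_map val xpredT id).
apply: prod_primes_dvd.
- by rewrite map_inj_uniq ?enum_uniq //; exact: val_inj.
- by apply/allP => p /mapP[q]; rewrite mem_enum inE => /andP[pq _] ->.
move=> p /mapP[q]; rewrite mem_enum inE => /and3P[pq _ leq] ->.
rewrite /primorial -big_filter (big_rem (val q)) ?dvdn_mulr //=.
by rewrite mem_filter pq mem_iota prime_gt0 //= add1n ltnS.
Qed.

Lemma rough_two_primes t a : rough t a -> a < t ^ 3 ->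
  prime a \/ exists p q, [/\ prime p, prime q, t < p, t < q & a = p * q].
Proof.
case/andP => a_gt1 /allP ra lta; have a_gt0 := ltnW a_gt1.
have dv p : prime p -> p %| a -> t < p.
  by move=> pp pa; apply: ra; rewrite mem_primes pp a_gt0.
have pp := pdiv_prime a_gt1; have pa := pdiv_dvd a.
have Ea := divnK pa; move: (pdiv a) (a %/ pdiv a) pp pa Ea => p q pp pa Ea.
have [q1|q_neq1] := eqVneq q 1; first by left; rewrite -Ea q1 mul1n.
have q_gt1 : 1 < q by case: q q_neq1 Ea => [|[|q]] // _; rewrite mul0n; lia.
have rp := pdiv_prime q_gt1; have rq := pdiv_dvd q; have Eq := divnK rq.
move: (pdiv q) (q %/ pdiv q) rp rq Eq => r k rp rq Eq.
have ra' : r %| a by rewrite -Ea dvdn_mulr.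
right; exists r, p; split => //; try exact: dv.
have [k1|k_neq1] := eqVneq k 1; first by rewrite -Ea -Eq k1 mul1n.
have k_gt1 : 1 < k by case: k k_neq1 Eq => [|[|k]] // _; rewrite mul0n; lia.
have ltk : t < pdiv k.
  apply: dv; first exact: pdiv_prime.
  by rewrite -Ea -Eq -mulnA dvdn_mulr // pdiv_dvd.
have lek := dvdn_leq (ltnW k_gt1) (pdiv_dvd k).
have h1 : t < k by apply: leq_trans lek.
have h2 : t * t <= r * p by apply: leq_mul; apply: ltnW; apply: dv.
have : t * (t * t) <= k * (r * p) by apply: leq_mul => //; exact: ltnW.
by move: lta; rewrite -Ea -Eq !expnS expn0 muln1 mulnA; lia.
Qed.

Lemma card_rough N t z : 0 < t ->
  t * #|[set a : 'I_N | rough (2 ^ t) a & (a <= z) && (a < 2 ^ (3 * t))]| <= 26 * z.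
Proof.
move=> t_gt0; pose Pr y := [set p : 'I_N | prime p & 2 ^ t < p <= y].
pose Sp (j : 'I_(3 * t)) := [set a : 'I_N |
   [exists pq in setX (Pr (2 ^ j.+1)) (Pr (z %/ 2 ^ j)), (a == pq.1 * pq.2 :> nat)]].
set A := [set _ | _].
have sub : A \subset Pr z :|: \bigcup_(j in [set: 'I_(3 * t)]) Sp j.
  apply/subsetP => a; rewrite !inE => /and3P[ra laz lat].
  have [||pa|[p [q [pp pq ltp ltq Ea]]]] := @rough_two_primes (2 ^ t) a.
  - by [].
  - by rewrite -expnM mulnC.
  - rewrite pa laz andbT; apply/orP; left; case/andP: ra => _ /allP; apply.
    by rewrite mem_primes pa prime_gt0 // dvdnn.
  apply/orP; right; have p_gt0 := prime_gt0 pp; have q_gt0 := prime_gt0 pq.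
  have [lpa lqa] : p <= a /\ q <= a by rewrite Ea; split; rewrite ?leq_pmulr ?leq_pmull.
  have [lj uj] := andP (trunc_log_bounds (isT : 1 < 2) p_gt0).
  have jt : trunc_log 2 p < 3 * t.
    by rewrite -(@ltn_exp2l 2) //; apply: leq_ltn_trans lj _; apply: leq_ltn_trans lat.
  apply/bigcupP; exists (Ordinal jt) => //; rewrite inE.
  apply/exists_inP; exists (Ordinal (leq_ltn_trans lpa (ltn_ord a)),
     Ordinal (leq_ltn_trans lqa (ltn_ord a))); last by rewrite /= Ea.
  rewrite !inE /= pp pq ltp ltq /= (ltnW uj) /=.
  rewrite leq_divRL ?expn_gt0 //; apply: leq_trans laz; rewrite Ea mulnC.
  by rewrite leq_mul2r lj orbT.
have cSp j : t ^ 2 * #|Sp j| <= 8 * z.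
  apply: (@leq_trans ((t * #|Pr (2 ^ j.+1)|) * (t * #|Pr (z %/ 2 ^ j)|))).
    rewrite mulnACA mulnn leq_mul2l; apply/orP; right.
    rewrite -cardsX.
    rewrite -(card_imset _ (@Some_inj _)).
    pose f (pq : 'I_N * 'I_N) : option 'I_N := insub (pq.1 * pq.2).
    apply: (@leq_trans #|f @: setX (Pr (2 ^ j.+1)) (Pr (z %/ 2 ^ j))|); last exact: leq_imset_card.
    apply: subset_leq_card; apply/subsetP => o /imsetP[a]; rewrite inE.
    case/exists_inP => pq pqS /eqP Ea ->; apply/imsetP; exists pq => //.
    by rewrite /f -Ea valK.
  apply: (@leq_trans ((2 * 2 ^ j.+1) * (2 * (z %/ 2 ^ j)))).
    by apply: leq_mul; apply: card_primes_range.
  have := leq_divM z (2 ^ j); rewrite expnS; lia.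
have cS : t * #|\bigcup_(j in [set: 'I_(3 * t)]) Sp j| <= 24 * z.
  rewrite -(leq_pmul2l t_gt0); apply: (@leq_trans (t ^ 2 * \sum_(j in [set: 'I_(3 * t)]) #|Sp j|)).
    rewrite mulnA mulnn leq_mul2l; apply/orP; right.
    by apply: card_cover_le => a /bigcupP[j jT aj]; exists j.
  rewrite big_distrr /=; apply: (@leq_trans (\sum_(j in [set: 'I_(3 * t)]) 8 * z)).
    by apply: leq_sum => j _.
  rewrite sum_nat_const cardsT card_ord; lia.
apply: (@leq_trans (t * (#|Pr z| + #|\bigcup_(j in [set: 'I_(3 * t)]) Sp j|))).
  rewrite leq_mul2l; apply/orP; right; apply: leq_trans (subset_leq_card sub) _.
  exact: (leq_card_setU _ _).1.
have := card_primes_range N z t; rewrite -/(Pr z); lia.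
Qed.

(** The [2 ^ i] values of [c] cancel against the shorter range [z / 2 ^ i] of [a], so the density 26
    / t survives. *)
Lemma card_rough_mul N t i z : 0 < t ->
  t * #|[set u : 'I_N | (u <= z) && [exists a : 'I_N, exists c : 'I_N,
     [&& rough (2 ^ t) a, a < 2 ^ (3 * t), 2 ^ i <= c < 2 ^ i.+1 & u == a * c :> nat]]]|
  <= 26 * z.
Proof.
move=> t_gt0; set U := [set _ | _].
pose Q y := [set a : 'I_N | rough (2 ^ t) a & (a <= y) && (a < 2 ^ (3 * t))].
pose G (c : 'I_(2 ^ i)) := [set u : 'I_N | [exists a in Q (z %/ 2 ^ i), u == a * (2 ^ i + c) :> nat]].
have cG c : #|G c| <= #|Q (z %/ 2 ^ i)|.
  rewrite -(card_imset _ (@Some_inj _)).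
  pose f (a : 'I_N) : option 'I_N := insub (a * (2 ^ i + c)).
  apply: (@leq_trans #|f @: Q (z %/ 2 ^ i)|); last exact: leq_imset_card.
  apply: subset_leq_card; apply/subsetP => o /imsetP[u]; rewrite inE.
  case/exists_inP => a aQ /eqP Eu ->; apply/imsetP; exists a => //.
  by rewrite /f -Eu valK.
apply: (@leq_trans (t * (2 ^ i * #|Q (z %/ 2 ^ i)|))).
  rewrite leq_mul2l; apply/orP; right.
  apply: (@leq_trans (\sum_(c in [set: 'I_(2 ^ i)]) #|G c|)); last first.
    apply: (@leq_trans (\sum_(c in [set: 'I_(2 ^ i)]) #|Q (z %/ 2 ^ i)|)).
      by apply: leq_sum => c _.
    by rewrite sum_nat_const cardsT card_ord.
  apply: card_cover_le => u; rewrite inE => /andP[luz /existsP[a /existsP[c]]].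
  case/and4P => ra lta /andP[lc uc] /eqP Eu.
  have ltc : c - 2 ^ i < 2 ^ i by rewrite expnS in uc; lia.
  exists (Ordinal ltc) => //; rewrite inE; apply/exists_inP; exists a.
    rewrite inE ra lta andbT /= leq_divRL ?expn_gt0 //; apply: leq_trans luz.
    by rewrite Eu leq_mul2l lc orbT.
  by rewrite /= subnKC // Eu.
have := card_rough N (z %/ 2 ^ i) t_gt0; rewrite -/(Q _).
by have := leq_divM z (2 ^ i); nia.
Qed.

Lemma leq_exp2_mul a b g : a <= b -> 2 ^ (a * g) <= 2 ^ (b * g).
Proof. by move=> le; rewrite leq_exp2l // leq_mul2r le orbT. Qed.

(** In units of n^(1/80), 38 lies below sqrt n and 58 below n^(3/4). At these sizes the edge bound
    for C4-free graphs leaves O(n^(59/80)) elements for each dyadic size of v. *)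
Definition lopsided (g m : nat) : bool :=
  [exists v : 'I_m.+1, [&& v %| m, v <= 2 ^ (38 * g) & m %/ v <= 2 ^ (58 * g)]].

(** [a] and [v] stay below [2 ^ (42 * g)], hence below the cube of the roughness bound
    [2 ^ (16 * g)], so [card_rough] applies to both. *)
Definition balanced (g u v : nat) : Prop :=
  exists a c, [/\ u = a * c, 0 < c, rough (2 ^ (16 * g)) a,
    rough (2 ^ (16 * g)) v & [/\ u < 2 ^ (42 * g), v <= a & 2 ^ (38 * g) < v]].

Lemma lopsidedI g m u v : 0 < m -> m = u * v ->
  v <= 2 ^ (38 * g) -> u <= 2 ^ (58 * g) -> lopsided g m.
Proof.
move=> m_gt0 Em lv lu; have v_gt0 : 0 < v by case: v Em {lv} => //; rewrite muln0; lia.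
have lvm : v < m.+1 by rewrite ltnS Em leq_pmull //; case: u Em {lu} => //; lia.
by apply/existsP; exists (Ordinal lvm); rewrite /= lv Em dvdn_mull // mulnK.
Qed.

(* Multiplication by primes up to [2 ^ (16 * g)] cannot jump over the window from
   [2 ^ (42 * g)] to [2 ^ (58 * g)], so if no divisor of [m] lies there, the smooth part
   of [m] can be attached to any divisor below the window; [2 ^ (40 * g)] is about
   [sqrt n]. *)
Lemma factor_split g m : 0 < g -> 0 < m -> m <= 2 ^ (80 * g) ->
  (forall p, prime p -> p %| m -> p <= 2 ^ (54 * g)) ->
  lopsided g m \/ exists u v, m = u * v /\ balanced g u v.
Proof.
move=> g_gt0 m_gt0 lem smooth.
case: (boolP (lopsided g m)) => [|nlop]; [by left | right].
(* A divisor inside the window has a codivisor of at most [2 ^ (38 * g)] and would make [m]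
   lopsided. *)
have window d : d %| m -> d <= 2 ^ (58 * g) -> d < 2 ^ (42 * g).
  move=> dm ld; rewrite ltnNge; apply/negP => gd; case/negP: nlop.
  apply: (@lopsidedI g m d (m %/ d)) => //; first by rewrite mulnC divnK.
  rewrite -(leq_pmul2r (_ : 0 < 2 ^ (42 * g))) ?expn_gt0 // -expnD -mulnDl.
  apply: (@leq_trans m); last by apply: leq_trans lem _; exact: leq_exp2_mul.
  by rewrite -{2}(divnK dm) leq_mul2l gd orbT.
pose pi := [pred p | 2 ^ (16 * g) < p].
have Em : m`_pi * m`_pi^' = m by rewrite partnC.
have absorb k d : (forall p, prime p -> p %| k -> p <= 2 ^ (16 * g)) -> 0 < k ->
    d * k %| m -> d < 2 ^ (42 * g) -> d * k < 2 ^ (42 * g).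
  elim: k.+1 {-2}k (ltnSn k) d => // n IH {}k ltk d smk k_gt0 dkm ltd.
  case: (leqP k 1) => [|k_gt1].
    by move=> lek1; rewrite (_ : k = 1) ?muln1 //; lia.
  have pr := pdiv_prime k_gt1; have dr := pdiv_dvd k; have Ek := divnK dr.
  have le_r := smk _ pr dr.
  move: (pdiv k) (k %/ pdiv k) pr dr Ek le_r => r q pr dr Ek le_r.
  have r_gt1 := prime_gt1 pr.
  have q_gt0 : 0 < q by case: q Ek; lia.
  have dq : d * q < 2 ^ (42 * g).
    apply: IH => //; first by nia.
    - by move=> p pp pq; apply: smk => //; rewrite -Ek dvdn_mulr.
    - by apply: dvdn_trans dkm; rewrite -Ek mulnA dvdn_mulr.
  apply: window => //; rewrite -Ek mulnA.
  apply: (@leq_trans (2 ^ (42 * g) * 2 ^ (16 * g))).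
    by apply: leq_mul => //; exact: ltnW.
  by rewrite -expnD -mulnDl; exact: leq_exp2_mul.
set t := m`_pi in Em; set c := m`_pi^' in Em.
have t_gt0 : 0 < t by exact: part_gt0.
have c_gt0 : 0 < c by exact: part_gt0.
have tm : t %| m by rewrite -Em dvdn_mulr.
(* [a] will be the largest such divisor of the rough part; maximality yields [b <= a] once [b]
   itself is known to be below the window. *)
pose P d := (d %| t) && (d < 2 ^ (42 * g)).
have P1 : exists d, P d.
  by exists 1; rewrite /P dvd1n /= -{1}(expn0 2) ltn_exp2l //; lia.
have Pb d : P d -> d <= t by case/andP => dt _; exact: dvdn_leq.
case: (ex_maxnP P1 Pb) => a /andP[at' lta] maxa.
have Et := divnK at'; set b := t %/ a in Et.
have bt : b %| t by rewrite -Et dvdn_mulr.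
have a_gt0 : 0 < a by apply: dvdn_gt0 at'.
have b_gt0 : 0 < b by apply: dvdn_gt0 bt.
have dvdt p : prime p -> p %| t -> 2 ^ (16 * g) < p.
  move=> pp pt; have := part_pnat pi m; rewrite /pnat => /andP[_ /allP]; apply.
  by rewrite mem_primes pp t_gt0 pt.
have ac : a * c < 2 ^ (42 * g).
  apply: absorb => //; last by have -> : m = b * (a * c) by [rewrite -Em -Et; lia]; rewrite dvdn_mull.
  move=> p pp pc; have := part_pnat pi^' m; rewrite /pnat => /andP[_ /allP].
  move/(_ p); rewrite mem_primes pp part_gt0 pc => /(_ isT).
  by rewrite !inE /= -leqNgt.
(* If [b] were beyond the window, [a] would be below [2 ^ (22 * g)]. A prime [r] of [b] lies below
   the window, so [r <= a] by maximality, and then [a * r] lies below the window as well, against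
   the maximality of [a]. *)
have ltb : b < 2 ^ (42 * g).
  case: (leqP b (2 ^ (58 * g))) => [leb|ltb].
    by apply: window => //; exact: dvdn_trans tm.
  have a_small : a < 2 ^ (22 * g).
    rewrite -(ltn_pmul2r (_ : 0 < 2 ^ (58 * g))) ?expn_gt0 // -expnD.
    rewrite -mulnDl; apply: (@leq_trans (a * b)); first by rewrite ltn_pmul2l.
    rewrite mulnC Et; apply: leq_trans (dvdn_leq m_gt0 tm) lem.
  have b_gt1 : 1 < b by apply: leq_trans ltb; rewrite ltnS expn_gt0.
  have pr := pdiv_prime b_gt1; have dr := pdiv_dvd b.
  move: (pdiv b) pr dr => r pr dr.
  have rt : r %| t by apply: dvdn_trans dr bt.
  have rm : r %| m by apply: dvdn_trans tm.
  have ltr : r < 2 ^ (42 * g).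
    apply: window => //; apply: leq_trans (smooth r pr rm) _.
    exact: leq_exp2_mul.
  have lera : r <= a by apply: maxa; rewrite /P rt.
  have art : a * r %| t by rewrite -Et mulnC dvdn_mul.
  have ltar : a * r < 2 ^ (42 * g).
    apply: window; first by apply: dvdn_trans tm.
    apply: (@leq_trans (2 ^ (22 * g) * 2 ^ (22 * g))).
      by apply: leq_mul; apply: ltnW => //; apply: leq_ltn_trans a_small.
    by rewrite -expnD -mulnDl; exact: leq_exp2_mul.
  have : a * r <= a by apply: maxa; rewrite /P art.
  by rewrite leqNgt ltn_Pmulr // prime_gt1.
have leba : b <= a by apply: maxa; rewrite /P bt.
have Emb : m = a * c * b by rewrite -Em -Et -[b * a]mulnC mulnAC.
have b_big : 2 ^ (38 * g) < b.
  rewrite ltnNge; apply/negP => leb; case/negP: nlop.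
  apply: (@lopsidedI g m (a * c) b) => //.
  by apply: leq_trans (ltnW ac) _; exact: leq_exp2_mul.
have b_gt1 : 1 < b by apply: leq_trans b_big; rewrite ltnS expn_gt0.
have rgh d : 1 < d -> d %| t -> rough (2 ^ (16 * g)) d.
  move=> d_gt1 dt; rewrite /rough d_gt1; apply/allP => p.
  rewrite mem_primes => /and3P[pp _ pd]; apply: dvdt => //.
  exact: dvdn_trans dt.
exists (a * c), b; split => //; exists a, c; split => //; try exact: rgh.
by apply: rgh => //; apply: leq_trans leba.
Qed.

(** * Counting Sidon sets from above *)

Lemma card_small_sets (I : finType) E :
  #|[set A : {set I} | #|A| <= E]| <= #|I|.+1 ^ E.
Proof.
rewrite -card_option -{2}(card_ord E) -card_ffun -cardsT.
pose F (f : {ffun 'I_E -> option I}) := [set x | [exists i, f i == Some x]].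
apply: leq_trans (leq_imset_card F _); apply: subset_leq_card.
apply/subsetP => A; rewrite inE => leA; apply/imsetP.
exists [ffun i : 'I_E => nth None (map Some (enum A)) i] => //.
apply/setP => x; rewrite inE; apply/idP/existsP => [xA|[i]].
  have lt : index x (enum A) < size (enum A) by rewrite index_mem mem_enum.
  have lt' : index x (enum A) < E by apply: leq_trans lt _; rewrite -cardE.
  exists (Ordinal lt'); rewrite ffunE /= (nth_map x) // nth_index //.
  by rewrite mem_enum.
rewrite ffunE; case: (ltnP i (size (enum A))) => lt; last first.
  by rewrite nth_default // size_map.
rewrite (nth_map x) // => /eqP[<-]; rewrite -mem_enum; exact: mem_nth.
Qed.

(** * Sidon sets as C4-free graphs *)

Section Sidon.
Variable n : nat.
Implicit Types (A Z : {set 'I_n}) (U V : {set 'I_n.+1}).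

Lemma sidonP A : reflect (forall a1 a2 b1 b2, a1 \in A -> a2 \in A -> b1 \in A ->
   b2 \in A -> [&& a1 != a2, a1 != b1, a1 != b2, a2 != b1, a2 != b2 & b1 != b2] ->
   a1.+1 * a2.+1 <> b1.+1 * b2.+1) (mult_sidon A).
Proof.
apply: (iffP idP) => [sidon_in a1 a2 b1 b2 h1 h2 h3 h4 ne|sidon_in].
  move/forall_inP/(_ _ h1)/forall_inP/(_ _ h2)/forall_inP/(_ _ h3): sidon_in.
  by move/forall_inP/(_ _ h4)/implyP/(_ ne)/eqP.
apply/forall_inP => a1 h1; apply/forall_inP => a2 h2; apply/forall_inP => b1 h3.
by apply/forall_inP => b2 h4; apply/implyP => ne; apply/eqP; apply: sidon_in.
Qed.

Lemma sidon_sub A A' : A' \subset A -> mult_sidon A -> mult_sidon A'.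
Proof.
move=> /subsetP sub /sidonP sidon_in; apply/sidonP => a1 a2 b1 b2 h1 h2 h3 h4.
by apply: sidon_in; apply: sub.
Qed.

Definition sidon_in Z := [set A : {set 'I_n} | mult_sidon A & A \subset Z].

Lemma sidon_inS Z Z' : Z \subset Z' -> #|sidon_in Z| <= #|sidon_in Z'|.
Proof.
move=> sub; apply: subset_leq_card; apply/subsetP => A; rewrite !inE.
by case/andP=> -> /= h; apply: subset_trans sub.
Qed.

Lemma card_sidon_inU Z1 Z2 : #|sidon_in (Z1 :|: Z2)| <= #|sidon_in Z1| * #|sidon_in Z2|.
Proof.
rewrite -cardsX; pose f A := (A :&: Z1, A :&: Z2).
rewrite -(@card_in_imset _ _ f (sidon_in (Z1 :|: Z2))).
  apply: subset_leq_card; apply/subsetP => _ /imsetP[A AS ->].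
  move: AS; rewrite inE => /andP[sA _].
  by rewrite !inE /= !subsetIr (sidon_sub (subsetIl A Z1) sA) (sidon_sub (subsetIl A Z2) sA).
move=> A B; rewrite !inE => /andP[_ sA] /andP[_ sB] [e1 e2].
by rewrite -(setIidPl sA) -(setIidPl sB) !setIUr e1 e2.
Qed.

Lemma card_sidon_in_bigcup (I : finType) (Z : I -> {set 'I_n}) :
  #|sidon_in (\bigcup_i Z i)| <= \prod_i #|sidon_in (Z i)|.
Proof.
elim/big_rec2: _ => [|i m Z' _ le]; last first.
  by apply: leq_trans (card_sidon_inU _ _) _; rewrite leq_mul2l le orbT.
rewrite -(cards1 (set0 : {set 'I_n})); apply: subset_leq_card.
by apply/subsetP => A; rewrite !inE subset0 => /andP[].
Qed.

Definition products V U := [set m : 'I_n | [exists v in V, exists u in U, m.+1 == v * u]].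

(** One factorisation is fixed for every [m], so that a set of integers becomes a graph with the
    same number of edges. The default pair is never reached on [products V U]. *)
Definition edge V U (m : 'I_n) : 'I_n.+1 * 'I_n.+1 :=
  odflt (ord0, ord0) [pick e in setX V U | m.+1 == e.1 * e.2].

Lemma edgeP V U m : m \in products V U ->
  edge V U m \in setX V U /\ m.+1 = (edge V U m).1 * (edge V U m).2.
Proof.
rewrite inE => /exists_inP[v vV /exists_inP[u uU /eqP Em]].
rewrite /edge; case: pickP => [e /andP[eVU /eqP h] //|/(_ (v, u))].
by rewrite inE vV uU Em eqxx.
Qed.

Lemma edge_inj V U : {in products V U &, injective (edge V U)}.
Proof.
move=> m m' /edgeP[_ e1] /edgeP[_ e2] E; apply: val_inj; apply: succn_inj => /=.
by rewrite e1 e2 E.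
Qed.

(** A 4-cycle on x, x', y, y' would give (x y)(x' y') = (x y')(x' y), and the four integers are
    distinct because their edges are. *)
Lemma sidon_in_bip V U A : A \in sidon_in (products V U) -> edge V U @: A \in bip V U.
Proof.
rewrite inE => /andP[/sidonP sA /subsetP subA]; rewrite inE; apply/andP; split.
  by apply/subsetP => _ /imsetP[m mA ->]; case: (edgeP (subA _ mA)).
apply/c4freeP => x x' y y' /imsetP[a aA Ea] /imsetP[b bA Eb] /imsetP[c cA Ec].
case/imsetP=> d dA Ed.
have [_ ea] := edgeP (subA _ aA); have [_ eb] := edgeP (subA _ bA).
have [_ ec] := edgeP (subA _ cA); have [_ ed] := edgeP (subA _ dA).
rewrite -Ea /= in ea; rewrite -Eb /= in eb; rewrite -Ec /= in ec; rewrite -Ed /= in ed.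
have [->|nx] := eqVneq x x'; [by left | right]; apply/eqP/negPn/negP => ny.
have ne i j e f : edge V U i = e -> edge V U j = f -> e != f -> i != j.
  by move=> <- <-; apply: contra_neq => ->.
apply: (sA a d b c aA dA bA cA); last by rewrite ea eb ec ed; lia.
rewrite (ne _ _ _ _ (esym Ea) (esym Ed)) ?(ne _ _ _ _ (esym Ea) (esym Eb))
  ?(ne _ _ _ _ (esym Ea) (esym Ec)) ?(ne _ _ _ _ (esym Ed) (esym Eb))
  ?(ne _ _ _ _ (esym Ed) (esym Ec)) ?(ne _ _ _ _ (esym Eb) (esym Ec)) //.
all: by rewrite xpair_eqE ?(negbTE nx) ?(negbTE ny) ?(eq_sym x') ?(eq_sym y')
  ?(negbTE nx) ?(negbTE ny) ?andbF.
Qed.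

Lemma card_sidon_in_bip V U : #|sidon_in (products V U)| <= #|bip V U|.
Proof.
rewrite -(@card_in_imset _ _ (fun A => edge V U @: A) (sidon_in (products V U))).
  by apply: subset_leq_card; apply/subsetP => _ /imsetP[A AS ->]; exact: sidon_in_bip.
move=> A B; rewrite !inE => /andP[_ /subsetP sA] /andP[_ /subsetP sB] E.
apply/setP => m; apply/idP/idP => mA.
  have : edge V U m \in edge V U @: B by rewrite -E imset_f.
  by case/imsetP => m' mB /(edge_inj (sA _ mA) (sB _ mB)) ->.
have : edge V U m \in edge V U @: A by rewrite E imset_f.
by case/imsetP => m' mB /(edge_inj (sB _ mA) (sA _ mB)) ->.
Qed.

(** The Kovari-Sos-Turan bound: the column sizes sum to [#|E|], and by [sum_codeg] their squares sum
    to at most [#|A| ^ 2] more. Cauchy-Schwarz compares the two. *)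
Lemma c4free_edges (X Y : finType) (A : {set X}) (B : {set Y}) (E : {set X * Y}) :
  E \in bip A B -> #|E| ^ 2 <= #|B| * (#|E| + #|A| ^ 2).
Proof.
rewrite inE => /andP[/subsetP sE /c4freeP c4].
have lin : forall x y a b, x \in B -> y \in B -> a != b ->
    a \in colN E x -> b \in colN E x -> a \in colN E y -> b \in colN E y -> x = y.
  move=> x y a b _ _ nab; rewrite !inE => h1 h2 h3 h4.
  by case: (c4 a b x y h1 h3 h2 h4) => // h; rewrite h eqxx in nab.
have cE : #|E| = \sum_(y in B) #|A :&: colN E y|.
  rewrite (eq_bigr (fun y => \sum_(e in E | e.2 == y) 1)); last first.
    move=> y yB; rewrite sum1_card -(card_imset _ (_ : injective (fun x : X => (x, y)))).
      apply: eq_card => -[x y']; rewrite [RHS]unfold_in.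
      apply/imsetP/andP => [[x']|[xy /eqP <-]].
        by rewrite !inE => /andP[_ h] [-> ->]; rewrite /= eqxx.
      by exists x => //; rewrite !inE xy; case/sE/setXP: xy => ->.
    by move=> x x' [].
  rewrite (exchange_big_dep (mem E)) /=; last by move=> y e _ /andP[].
  rewrite -sum1_card; apply: eq_bigr => -[x y] xyE.
  rewrite (big_pred1 y) // => y' /=; rewrite xyE /= eq_sym.
  by case: eqP => [->|_]; rewrite ?andbF // andbT; case/sE/setXP: xyE.
have := sum_codeg lin A; rewrite -cE => h.
apply: (@leq_trans (#|B| * \sum_(y in B) #|A :&: colN E y| ^ 2)).
  by rewrite {1}cE; apply: sqr_sum_le.
rewrite leq_mul2l -h addnC; apply/orP; right; rewrite leq_add2l.
rewrite -mulnn -sum_nat_const; apply: leq_sum => b _.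
by apply: subset_leq_card; apply/subsetP => c; rewrite inE => /andP[].
Qed.

Lemma card_sidon_in_edges V U A : A \in sidon_in (products V U) ->
  #|A| ^ 2 <= #|U| * (#|A| + #|V| ^ 2).
Proof.
move=> AS; have := c4free_edges (sidon_in_bip AS).
rewrite card_in_imset // => m m' mA mA'; apply: edge_inj.
  by move: AS mA; rewrite inE => /andP[_ /subsetP h]; exact: h.
by move: AS mA'; rewrite inE => /andP[_ /subsetP h]; exact: h.
Qed.

(** For a set with more than [E] elements, each hypothesis makes one of the two terms in
    [card_sidon_in_edges] less than half of the square on the left. *)
Lemma card_sidon_in_small V U E : 2 * #|U| <= E -> 2 * #|U| * #|V| ^ 2 <= E ^ 2 ->
  #|sidon_in (products V U)| <= n.+1 ^ E.
Proof.
move=> h1 h2; apply: leq_trans (leq_trans (subset_leq_card _) (card_small_sets 'I_n E)) _;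
  last by rewrite card_ord.
apply/subsetP => A AS; rewrite inE; have := card_sidon_in_edges AS.
move: #|A| #|U| #|V| h1 h2 => a u v h1 h2 h3; rewrite leqNgt; apply/negP => lt.
have : E ^ 2 < a ^ 2 by rewrite ltn_exp2r.
have : 2 * u * a <= a * a by rewrite leq_mul2r; apply/orP; right; lia.
by rewrite -!mulnn in h2 h3 *; nia.
Qed.
End Sidon.

(** * Multiples of large primes *)

Section BigPrimes.
Variable n : nat.
Implicit Types (A : {set 'I_n}) (m : 'I_n).

Definition big_prime (p : nat) : bool := prime p && (n ^ 2 < p ^ 3).

Definition big_multiples : {set 'I_n} :=
  [set m : 'I_n | [exists p : 'I_n.+1, big_prime p && (p %| m.+1)]].

Lemma big_prime_uniq p q m : big_prime p -> big_prime q -> p %| m.+1 -> q %| m.+1 -> p = q.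
Proof.
case/andP=> pp hp /andP[pq hq] dp dq; apply/eqP/negPn/negP => ne.
have n_gt0 : 0 < n by apply: leq_ltn_trans (ltn_ord m).
have dv : p * q %| m.+1.
  by rewrite Gauss_dvd ?dp ?dq // prime_coprime // dvdn_prime2.
have le : p * q <= n by apply: leq_trans (dvdn_leq _ dv) (ltn_ord m).
have h1 : (p * q) ^ 3 <= n ^ 3 by apply: leq_exp_base.
have h2 : n ^ 2 * n ^ 2 < p ^ 3 * q ^ 3 by apply: ltn_mul.
move: h1; rewrite expnMn leqNgt => /negP; apply; apply: leq_ltn_trans h2.
by rewrite -expnD leq_pexp2l.
Qed.

Definition big_factor m : 'I_n.+1 := odflt ord0 [pick p : 'I_n.+1 | big_prime p && (p %| m.+1)].
Definition cofactor m := m.+1 %/ big_factor m.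

Lemma big_factorP m : m \in big_multiples -> [/\ big_prime (big_factor m), big_factor m %| m.+1, 0 < cofactor m <= n %/ big_factor m
  & m.+1 = big_factor m * cofactor m].
Proof.
rewrite inE => /existsP[p hp]; rewrite /cofactor /big_factor; case: pickP => [q /andP[hq dq]|/(_ p)].
  rewrite hq /= dq mulnC divnK //; split=> //.
  have q_gt0 : 0 < q by case/andP: hq => /prime_gt0.
  by rewrite divn_gt0 // dvdn_leq //= leq_div2r.
by rewrite hp.
Qed.

Definition rep A (p : 'I_n.+1) : option 'I_n := [pick m in A | big_factor m == p].

(** The value 0 encodes that no multiple of [p] is present; genuine cofactors are positive. *)
Definition repfun A : {ffun 'I_n.+1 -> 'I_n.+1} :=
  [ffun p => if rep A p is Some m then inord (cofactor m) else ord0].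

Definition extra A : {set 'I_n} := [set m in A | rep A (big_factor m) != Some m].

Lemma cofactor_lt m : m \in big_multiples -> cofactor m < n.+1.
Proof.
by case/big_factorP=> _ _ /andP[_ le] _; rewrite ltnS; apply: leq_trans le (leq_div _ _).
Qed.

Lemma mem_rep A m : A \subset big_multiples ->
  (m \in A) = (m \in extra A) || (m \in big_multiples) && (repfun A (big_factor m) == cofactor m :> nat).
Proof.
move=> /subsetP sA; rewrite inE ffunE; apply/idP/orP => [mA|].
  rewrite mA (sA _ mA) /=; case: eqP => [E|_]; last by left.
  by right; rewrite E inordK ?eqxx // cofactor_lt // sA.
case=> [/andP[] //|/andP[mZ]].
have [_ _ /andP[c_gt0 _] Em] := big_factorP mZ.
rewrite /rep; case: pickP => [m' /andP[m'A /eqP E]|_]; last first.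
  by rewrite /= eq_sym => /eqP h; rewrite h in c_gt0.
have [_ _ _ Em'] := big_factorP (sA _ m'A).
rewrite inordK ?cofactor_lt ?sA // => /eqP h.
suff -> : m = m' by [].
by apply: val_inj; apply: succn_inj => /=; rewrite Em Em' E h.
Qed.

(** An extra element p c is coded by [c] and the cofactor d of the representative of p, both below
    [K]. If p' c, with representative p' d, had the same code for some p' other than p, then (p
    c)(p' d) = (p d)(p' c) would contradict the Sidon property. *)
Lemma card_extra A K : A \in sidon_in big_multiples -> n < K ^ 3 -> #|extra A| <= K * K.
Proof.
rewrite inE => /andP[/sidonP sA sub] ltK; move/subsetP: (sub) => sZ.
have ltc m : m \in big_multiples -> cofactor m < K.
  case/big_factorP=> /andP[pp hp] _ /andP[_ le] _.
  have p_gt0 := prime_gt0 pp.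
  have h : cofactor m * big_factor m <= n by rewrite -leq_divRL.
  rewrite ltnNge; apply/negP => leKc.
  have h3 : (cofactor m * big_factor m) ^ 3 <= n ^ 3 by apply: leq_exp_base.
  have h4 : n * n ^ 2 < cofactor m ^ 3 * big_factor m ^ 3.
    by apply: ltn_mul => //; apply: leq_trans ltK _; apply: leq_exp_base.
  by rewrite expnMn (expnS n 2) in h3; rewrite ltnNge h3 in h4.
have [->|[m0]] := set_0Vmem (extra A); first by rewrite cards0.
rewrite inE => /andP[m0A _].
have K_gt0 : 0 < K by apply: leq_ltn_trans (ltc _ (sZ _ m0A)).
have repE m : m \in extra A -> exists2 r, r \in A &
    [/\ big_factor r = big_factor m, r != m & repfun A (big_factor m) = inord (cofactor r)].
  rewrite inE => /andP[mA]; rewrite ffunE /rep; case: pickP => [r|/(_ m)].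
    move=> /andP[rA /eqP E] ne; exists r => //; split => //.
  by rewrite mA eqxx.
have -> : K * K = #|[set: 'I_K.-1.+1 * 'I_K.-1.+1]|.
  by rewrite cardsT card_prod card_ord prednK.
pose h m : 'I_K.-1.+1 * 'I_K.-1.+1 := (inord (repfun A (big_factor m)), inord (cofactor m)).
have inK c : c < K -> (inord c : 'I_K.-1.+1) = c :> nat.
  by move=> lt; rewrite inordK // prednK.
apply: leq_trans (_ : #|h @: extra A| <= _); last by apply: subset_leq_card; apply: subsetT.
rewrite card_in_imset // => m m' mX m'X [e1 e2].
have [r rA [Er ner fr]] := repE _ mX; have [r' r'A [Er' ner' fr']] := repE _ m'X.
have mA : m \in A by move: mX; rewrite inE => /andP[].
have m'A : m' \in A by move: m'X; rewrite inE => /andP[].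
rewrite fr fr' !inordK ?cofactor_lt ?sZ // in e1.
move/(congr1 val): e1; rewrite /= !inK ?ltc ?sZ // => cr.
move/(congr1 val): e2; rewrite /= !inK ?ltc ?sZ // => cm.
have [_ _ _ Em] := big_factorP (sZ _ mA); have [_ _ _ Em'] := big_factorP (sZ _ m'A).
have [_ _ _ Err] := big_factorP (sZ _ rA); have [_ _ _ Err'] := big_factorP (sZ _ r'A).
have [E|ne] := eqVneq (big_factor m) (big_factor m').
  by apply: val_inj; apply: succn_inj => /=; rewrite Em Em' E cm.
have neb a b : big_factor a != big_factor b -> a != b by apply: contra_neq => ->.
case: (sA m r' r m' mA r'A rA m'A); last first.
  by rewrite Em Err' Err Em' Er Er' cm cr; lia.
by rewrite ner' (eq_sym m r) ner !neb ?Er ?Er' // eq_sym.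
Qed.

(** Each function of this family stands for at most one multiple of every large prime, 0 meaning
    none. Primes that are not large get the single value 0, so the family has exactly [T n] members;
    both bounds use it. *)
Definition choices (p : 'I_n.+1) : {set 'I_n.+1} :=
  if big_prime p then [set k : 'I_n.+1 | k <= n %/ p] else [set ord0].

Lemma card_choices : #|family choices| = T n.
Proof.
rewrite card_family foldrE big_image /= /T [RHS]big_mkcond /=.
apply: eq_big => // p _; rewrite /choices /big_prime; case: ifP => _; last by rewrite cards1.
have lt : (n %/ p).+1 <= n.+1 by rewrite ltnS leq_div.
have winj : injective (widen_ord lt) by move=> i j [] /val_inj.
rewrite -[RHS]card_ord -(card_imset _ winj); apply: eq_card => k.
rewrite inE; apply/idP/imsetP => [le|[j _ ->]]; last by rewrite /= -ltnS.
by exists (Ordinal (le : k < (n %/ p).+1)) => //; apply: val_inj.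
Qed.

Lemma card_sidon_in_big K : n < K ^ 3 -> #|sidon_in big_multiples| <= T n * n.+1 ^ (K * K).
Proof.
move=> ltK; pose f A := (repfun A, extra A).
apply: (@leq_trans #|setX [set x in family choices] [set X : {set 'I_n} | #|X| <= K * K]|);
  last first.
  rewrite cardsX cardsE card_choices leq_mul2l; apply/orP; right.
  by apply: leq_trans (card_small_sets _ _) _; rewrite card_ord.
rewrite -(@card_in_imset _ _ f (sidon_in big_multiples)).
  apply: subset_leq_card; apply/subsetP => _ /imsetP[A AS ->].
  rewrite inE /=; apply/andP; split; last by rewrite inE card_extra.
  rewrite inE; apply/familyP => p; rewrite ffunE /choices.
  move: AS; rewrite inE => /andP[_ /subsetP sA].
  rewrite /rep; case: pickP => [m /andP[mA /eqP <-]|_].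
    by have [-> _ /andP[_ le] _] := big_factorP (sA _ mA); rewrite inE inordK // cofactor_lt ?sA.
  by case: ifP; rewrite inE ?eqxx.
move=> A B; rewrite !inE => /andP[_ sA] /andP[_ sB] [e1 e2].
by apply/setP => m; rewrite (mem_rep _ sA) (mem_rep _ sB) e1 e2.
Qed.
End BigPrimes.

Lemma card_ord_lt N M : #|[set v : 'I_N | v < M]| <= M.
Proof.
rewrite -(card_imset _ (@Some_inj _)) -{2}(card_ord M) -cardsT.
pose f (j : 'I_M) : option 'I_N := insub (val j).
apply: leq_trans (leq_imset_card f _); apply: subset_leq_card.
apply/subsetP => o /imsetP[v]; rewrite inE => lt ->; apply/imsetP.
by exists (Ordinal lt) => //; rewrite /f /= valK.
Qed.

(** * Sizes of the dyadic boxes *)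

Lemma polylog_le g : 1 < g -> 16 * (50 * g) ^ 4 <= 2 ^ (16 * g).
Proof.
move=> g_gt1; rewrite -(subnK g_gt1); move: (g - 2) => {g g_gt1}.
elim=> [|g IH].
  apply: (@leq_trans (2 ^ 4 * (2 ^ 7) ^ 4)); last by rewrite -expnM -expnD leq_exp2l.
  by apply: leq_mul; [rewrite (_ : 16 = 2 ^ 4) | exact: leq_exp_base].
have -> : 16 * (g.+1 + 2) = 16 + 16 * (g + 2) by rewrite addSn mulnS.
rewrite expnD; apply: (@leq_trans (2 ^ 4 * (16 * (50 * (g + 2)) ^ 4))).
  rewrite mulnCA leq_mul2l -expnMn; apply/orP; right; apply: leq_exp_base.
  by rewrite mulnCA leq_mul2l; clear; lia.
by apply: leq_mul; [rewrite leq_exp2l | apply: IH].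
Qed.

(* [y ^ 2] is of order [2 ^ (40 * g) / g], that is, [sqrt n / log n]. *)
Section Scale.
Variables (g y : nat).
Hypotheses (g_gt1 : 1 < g) (y_lo : 8 * 2 ^ (40 * g) <= y ^ 2 * g)
  (y_hi : y.-1 ^ 2 * g < 8 * 2 ^ (40 * g)).

Lemma y_ge : 2 ^ (19 * g) <= y.
Proof.
rewrite leqNgt; apply/negP => lt.
have : y ^ 2 * g < 8 * 2 ^ (40 * g); last by rewrite ltnNge y_lo.
apply: (@leq_trans (2 ^ (38 * g) * 2 ^ g).+1).
  rewrite ltnS; apply: leq_mul; last by apply: ltnW; exact: ltn_expl.
  by rewrite (_ : 38 = 19 * 2) // mulnAC expnM; apply: leq_exp_base; exact: ltnW.
rewrite -expnD -mulSnr; apply: (@leq_trans (2 * 2 ^ (40 * g))); last by rewrite leq_mul2r orbT.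
have h : 2 ^ (39 * g) <= 2 ^ (40 * g) by exact: leq_exp2_mul.
have : 0 < 2 ^ (40 * g) by rewrite expn_gt0.
move: h; move: (2 ^ _) (2 ^ _) => a b; clear; lia.
Qed.

Lemma y_le : y <= 2 ^ (20 * g + 2).
Proof.
have h : y.-1 ^ 2 < (2 ^ (20 * g + 2)) ^ 2.
  apply: (@leq_ltn_trans (y.-1 ^ 2 * g)); first by rewrite leq_pmulr // ltnW.
  apply: leq_trans y_hi _; rewrite -expnM mulnDl mulnAC expnD mulnC leq_mul2l.
  by rewrite orbT.
by rewrite ltn_exp2r // in h; case: y h.
Qed.

Section Block.
Variable k : nat.
Hypothesis ltkg : k < g.

(** With [box_w] the ceiling of y / 8^k, the part sizes [w * s] and [s * s] of [card_bip] become
    about y^2 / 4^k and 4^k y^2, as the k-th box requires, while the exponent w s^2 is about y^3 /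
    2^k and therefore summable. *)
Definition box_s := 2 ^ k * y.
Definition box_w := y.-1 %/ 8 ^ k + 1.

Let y_gt0 : 0 < y.
Proof. by apply: leq_trans y_ge; rewrite expn_gt0. Qed.

Let e8_gt0 : 0 < 8 ^ k. Proof. by rewrite expn_gt0. Qed.

Lemma e8_le_y : 8 ^ k <= y.
Proof.
apply: leq_trans y_ge; rewrite (_ : 8 = 2 ^ 3) // -expnM leq_exp2l //.
by move: ltkg; clear; lia.
Qed.

Lemma box_w_lo : y <= box_w * 8 ^ k.
Proof.
rewrite /box_w mulnDl mul1n; have := divn_eq y.-1 (8 ^ k).
have := ltn_pmod y.-1 e8_gt0; move: y_gt0 e8_gt0; clear.
move: (_ %/ _) => a; move: (_ %% _) => b; move: (8 ^ k) => c; lia.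
Qed.

Lemma box_w_hi : box_w * 8 ^ k <= 2 * y.
Proof.
rewrite /box_w mulnDl mul1n; have := leq_divM y.-1 (8 ^ k).
by have := e8_le_y; move: y_gt0; clear; lia.
Qed.

Lemma box_w_le : box_w <= y.
Proof.
by rewrite /box_w addn1; apply: leq_ltn_trans (leq_div _ _) _; rewrite prednK.
Qed.

Lemma box_w_ge : 2 ^ (16 * g) <= box_w.
Proof.
rewrite -(leq_pmul2r e8_gt0); apply: leq_trans box_w_lo; apply: leq_trans y_ge.
rewrite (_ : 8 = 2 ^ 3) // -expnM -expnD leq_exp2l //.
by move: ltkg; clear; lia.
Qed.

Lemma box_bits_le : box_w * box_s * box_s * 2 ^ k <= 2 * y ^ 3.
Proof.
have -> : box_w * box_s * box_s * 2 ^ k = box_w * 8 ^ k * y ^ 2.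
  have -> : 8 ^ k = 2 ^ k * 2 ^ k * 2 ^ k by rewrite -!expnMn.
  rewrite /box_s -mulnn; move: (2 ^ k) box_w; clear => a b; lia.
by rewrite (expnS y 2) mulnA leq_mul2r box_w_hi orbT.
Qed.

(** [j = 4 * k] because s / w is at most 2^k 8^k, and [l = 50 * g] bits suffice for the part sizes.
    The factor 8 in [y_lo] covers 26 * 4 / 16, the larger of the two densities. *)
Lemma card_bip_block (X Y : finType) (A : {set X}) (B : {set Y}) :
  16 * g * #|A| <= 26 * 2 ^ (40 * g - 2 * k) ->
  16 * g * #|B| <= 26 * 2 ^ (40 * g + 2 * k + 2) ->
  #|bip A B| <= 2 ^ (box_w * box_s * box_s * (40 + 2 * (4 * k))).
Proof.
move=> hA hB.
have g_gt0 : 0 < g by exact: ltnW.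
have E4 : (2 ^ k) ^ 2 = 4 ^ k by rewrite -expnM mulnC expnM.
have E8 : 8 ^ k = 2 ^ k * 4 ^ k by rewrite -expnMn.
have e4_gt0 : 0 < 4 ^ k by rewrite expn_gt0.
have bs2 : box_s * box_s = 4 ^ k * y ^ 2 by rewrite mulnn expnMn E4.
have hy : box_w <= box_s by apply: leq_trans box_w_le _; rewrite leq_pmull // expn_gt0.
have lbs : box_s * box_s < 2 ^ (50 * g).
  rewrite bs2; apply: (@leq_ltn_trans (2 ^ (2 * k) * (2 ^ (20 * g + 2)) ^ 2)).
    rewrite expnM; apply: leq_mul => //; apply: leq_exp_base; exact: y_le.
  rewrite -expnM -expnD ltn_exp2l //; move: ltkg g_gt1; clear; lia.
have big := polylog_le g_gt1; have bwg := box_w_ge.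
have l_gt0 : 0 < 50 * g by rewrite muln_gt0.
have p4 : 4 * (50 * g) <= 16 * (50 * g) ^ 4.
  by apply: leq_mul => //; rewrite -{1}(expn1 (50 * g)) leq_pexp2l.
have p2 : 2 * (50 * g) ^ 2 <= 16 * (50 * g) ^ 4.
  by apply: leq_mul => //; rewrite leq_pexp2l.
have p0 : 16 * (50 * g) ^ 4 <= box_w by exact: leq_trans bwg.
apply: (@card_bip _ _ box_w box_s (4 * k) (50 * g)) => //.
- by apply: leq_ltn_trans lbs; rewrite leq_mul2r hy orbT.
- apply: leq_trans hy; apply: leq_trans bwg; rewrite -{1}(expn1 2) leq_exp2l //.
  by move: g_gt0; clear; lia.
- exact: leq_trans p0.
- by apply: leq_trans hy; exact: leq_trans p0.
- exact: leq_trans p0.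
- by apply: leq_trans hy; exact: leq_trans p0.
- apply: (@leq_trans (2 ^ k * (box_w * 8 ^ k))); first by rewrite leq_mul2l box_w_lo orbT.
  rewrite mulnCA leq_mul2l; apply/orP; right.
  by rewrite (_ : 8 = 2 ^ 3) // -expnM -expnD leq_exp2l //; clear; lia.
- by rewrite /box_w addn1.
- rewrite -(leq_pmul2l (_ : 0 < 16 * g * 4 ^ k)); last by rewrite !muln_gt0 g_gt0.
  apply: (@leq_trans (26 * 2 ^ (40 * g))).
    rewrite mulnAC; apply: (@leq_trans (26 * 2 ^ (40 * g - 2 * k) * 4 ^ k)).
      by rewrite leq_mul2r hA orbT.
    rewrite -mulnA (_ : 4 = 2 ^ 2) // -expnM -expnD subnK //.
    by move: ltkg; clear; lia.
  apply: (@leq_trans (16 * (y ^ 2 * g))).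
    by move: y_lo; clear; move: (2 ^ _) => a; lia.
  have h : y * y <= y * (box_w * 8 ^ k) by rewrite leq_mul2l box_w_lo orbT.
  rewrite -mulnn; apply: (@leq_trans (16 * (y * (box_w * 8 ^ k) * g))).
    by rewrite leq_mul2l /= leq_mul2r h orbT.
  rewrite /box_s E8; clear; move: (2 ^ k) (4 ^ k) box_w => a b c; lia.
- rewrite -(leq_pmul2l (_ : 0 < 16 * g)); last by rewrite muln_gt0.
  apply: leq_trans hB _; rewrite bs2.
  rewrite addnAC expnD expnM -(mulnC (4 ^ k)) mulnCA (mulnCA (16 * g)) leq_mul2l.
  apply/orP; right; rewrite expnD.
  by move: y_lo; clear; move: (2 ^ _) => a; lia.
Qed.
End Block.

Lemma geom_sum m : \sum_(k < m) (k + 1) * (k + 5) * 2 ^ (m - k) <= 28 * 2 ^ m.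
Proof.
(* The exact value is what the induction needs. *)
suff : \sum_(k < m) (k + 1) * (k + 5) * 2 ^ (m - k) + (2 * m ^ 2 + 16 * m + 28) = 28 * 2 ^ m.
  by lia.
elim: m => [|m IH]; first by rewrite big_ord0.
rewrite big_ord_recr /= subSnn.
rewrite (eq_bigr (fun k : 'I_m => 2 * ((k + 1) * (k + 5) * 2 ^ (m - k)))); last first.
  by move=> k _; rewrite subSn ?expnS; [lia | apply: ltnW].
rewrite -big_distrr /= (expnS 2 m) mulnCA -IH; move: (\sum_(_ < _) _) => a.
by rewrite -!mulnn; lia.
Qed.

(** Bits per box times the [4 * k + 4] boxes of index [k] make 32 (k + 1) (k + 5) w s^2, where w s^2
    <= 2 y^3 / 2^k; then [geom_sum] gives 64 * 28 = 1792. *)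
Lemma sum_bits : \sum_(k < g) box_w k * box_s k * box_s k * (40 + 2 * (4 * k)) * (4 * k + 4)
   <= 1792 * y ^ 3.
Proof.
have e_gt0 : 0 < 2 ^ g by rewrite expn_gt0.
rewrite -(leq_pmul2l e_gt0) big_distrr /=.
apply: (@leq_trans (\sum_(k < g) 64 * y ^ 3 * ((k + 1) * (k + 5) * 2 ^ (g - k)))).
  apply: leq_sum => k _; have := box_bits_le (ltn_ord k).
  have -> : 2 ^ g = 2 ^ (g - k) * 2 ^ k by rewrite -expnD subnK // ltnW.
  move: (2 ^ k) (2 ^ (g - k)) (y ^ 3) (box_w k * box_s k * box_s k) => a b c d h.
  apply: (@leq_trans (32 * ((k + 1) * (k + 5)) * b * (d * a))).
    by move: (k : nat) => {h} k'; lia.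
  apply: (@leq_trans (32 * ((k + 1) * (k + 5)) * b * (2 * c))).
    by rewrite leq_mul2l h orbT.
  by move: (k : nat) => {h} k'; lia.
rewrite -big_distrr /=; have := geom_sum g; move: (\sum_(_ < _) _) (2 ^ g) (y ^ 3).
clear => a b c h; apply: (@leq_trans (64 * c * (28 * b))); last by lia.
by rewrite leq_mul2l h orbT.
Qed.
End Scale.

(** * Covering the integers up to n by boxes *)

Section Upper.
Variables (n g y : nat).
Hypotheses (g_gt1 : 1 < g) (len : n <= 2 ^ (80 * g)).

Let g_gt0 : 0 < g. Proof. exact: ltnW. Qed.

(** Without sorting by the dyadic size [k] of [v], the product #|U| #|V|^2 could only be bounded by
    the exponent 58 + 2 * 38; with [u <= 2 ^ (80 * g - k)] it is of order 2^(80 g + k). *)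
Definition Vlop (k : nat) := [set v : 'I_n.+1 | v < 2 ^ k.+1].
Definition Ulop (k : nat) := [set u : 'I_n.+1 | u < (2 ^ minn (58 * g) (80 * g - k)).+1].

(** The index [k] measures how far [v] falls below [2 ^ (40 * g)], in steps of a factor 4; [i] in
    [Ubal] is the dyadic size of the cofactor [c]. *)
Definition Vbal (k : nat) := [set v : 'I_n.+1 | rough (2 ^ (16 * g)) v &
  (v <= 2 ^ (40 * g - 2 * k)) && (v < 2 ^ (3 * (16 * g)))].

Definition Ubal (k i : nat) := [set u : 'I_n.+1 | (u <= 2 ^ (40 * g + 2 * k + 2)) &&
  [exists a : 'I_n.+1, exists c : 'I_n.+1, [&& rough (2 ^ (16 * g)) a,
     a < 2 ^ (3 * (16 * g)), 2 ^ i <= c < 2 ^ i.+1 & u == a * c :> nat]]].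

Lemma lopsided_cover (m : 'I_n) : lopsided g m.+1 ->
  m \in \bigcup_(k < (38 * g).+1) products (Vlop k) (Ulop k).
Proof.
case/existsP => v /and3P[dv lv lu].
have Em := divnK dv; set u := m.+1 %/ v in lu Em.
have v_gt0 : 0 < v by case: (posnP v) Em => // ->; rewrite muln0.
have [lo hi] := andP (trunc_log_bounds (isT : 1 < 2) v_gt0).
set k := trunc_log 2 v in lo hi.
have ltk : k < (38 * g).+1.
  by rewrite ltnS -(@leq_exp2l 2) //; apply: leq_trans lv.
have u_gt0 : 0 < u by case: (posnP u) Em => // ->; rewrite mul0n.
have ltv : v < n.+1 by apply: leq_trans (ltn_ord v) _; rewrite ltnS ltn_ord.
have ltu : u < n.+1.
  by rewrite ltnS; apply: leq_trans (leq_div _ _) _; exact: ltn_ord.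
apply/bigcupP; exists (Ordinal ltk) => //; rewrite inE; apply/exists_inP.
exists (Ordinal ltv); first by rewrite inE.
apply/exists_inP; exists (Ordinal ltu); last by rewrite /= mulnC Em.
rewrite inE /= ltnS.
suff : u <= 2 ^ (80 * g - k) by rewrite /minn; case: ifP.
have lek : k <= 80 * g.
  by apply: (@leq_trans (38 * g)); rewrite ?leq_mul2r ?orbT // -ltnS.
rewrite -(leq_pmul2r (_ : 0 < 2 ^ k)) ?expn_gt0 // -expnD subnK //.
apply: leq_trans (leq_trans (ltn_ord m) len); rewrite -Em leq_mul2l lo orbT //.
Qed.

(** From [v <= a] follows c v^2 <= u v <= 2^(80 g), so v > 2^(40 g - 2 k - 2) forces c < 2^(4 k +
    4). This is why only [4 * k + 4] values of [i] occur. *)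
Lemma balanced_cover (m : 'I_n) u v : m.+1 = u * v -> balanced g u v ->
  m \in \bigcup_(k < g) \bigcup_(i < 4 * k + 4) products (Vbal k) (Ubal k i).
Proof.
move=> Em [a [c [Eu c_gt0 ra rv [ltu leva ltv]]]].
have lem : u * v <= 2 ^ (80 * g) by rewrite -Em; apply: leq_trans len; exact: ltn_ord.
have v_gt0 : 0 < v by apply: leq_ltn_trans ltv.
have vvc : c * (v * v) <= 2 ^ (80 * g).
  apply: leq_trans lem; rewrite Eu mulnA leq_mul2r (mulnC a).
  by rewrite leq_mul2l leva !orbT.
have lev : v <= 2 ^ (40 * g).
  rewrite leqNgt; apply/negP => lt.
  have : 2 ^ (40 * g) * 2 ^ (40 * g) < v * v by apply: ltn_mul.
  rewrite -expnD -mulnDl ltnNge => /negP; apply; apply: leq_trans vvc.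
  by rewrite leq_pmull.
have [lo hi] : 2 ^ (up_log 2 v).-1 < v /\ v <= 2 ^ up_log 2 v.
  have v_gt1 : 1 < v by apply: leq_trans ltv; rewrite ltnS expn_gt0.
  by have /andP[] := up_log_bounds (isT : 1 < 2) v_gt1.
set r := up_log 2 v in lo hi.
have r_lo : 38 * g < r by rewrite -(@ltn_exp2l 2) //; apply: leq_trans hi.
have r_hi : r <= 40 * g.
  have : r.-1 < 40 * g by rewrite -(@ltn_exp2l 2) //; apply: leq_trans lev.
  by move: r_lo; clear; lia.
(* Two consecutive values of [r] share a box, which costs the [- 2] in the lower bound for [v].
   [k < g] comes from [38 * g < r]. *)
pose k := (40 * g - r)./2.
have [k1 k2 ltk] : [/\ r <= 40 * g - 2 * k, 40 * g - 2 * k <= r.+1 & k < g].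
  by rewrite /k; move: r_lo r_hi g_gt0; clear; split; lia.
have lo' : 2 ^ (40 * g - 2 * k - 2) < v.
  by apply: leq_ltn_trans lo; rewrite leq_exp2l //; move: k2; clear; lia.
have [lc hc] := andP (trunc_log_bounds (isT : 1 < 2) c_gt0).
set i := trunc_log 2 c in lc hc.
have lti : i < 4 * k + 4.
  rewrite -(@ltn_exp2l 2) // -(ltn_pmul2r (_ : 0 < v * v)) ?muln_gt0 ?v_gt0 //.
  apply: (@leq_ltn_trans (2 ^ (80 * g))).
    by apply: leq_trans vvc; rewrite leq_mul2r lc orbT.
  apply: (@leq_ltn_trans (2 ^ (4 * k + 4) * (2 ^ (40 * g - 2 * k - 2) * 2 ^ (40 * g - 2 * k - 2)))).
    by rewrite -!expnD leq_exp2l //; move: ltk g_gt1; clear; lia.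
  by rewrite ltn_pmul2l ?expn_gt0 //; apply: ltn_mul.
have u_gt0 : 0 < u by case: (posnP u) Em => // ->; rewrite mul0n.
have a_gt0 : 0 < a by apply: leq_trans leva.
have uv_n : u * v <= n by rewrite -Em ltn_ord.
have ltvn : v < n.+1 by rewrite ltnS; apply: leq_trans uv_n; rewrite leq_pmull.
have ltun : u < n.+1 by rewrite ltnS; apply: leq_trans uv_n; rewrite leq_pmulr.
have ltan : a < n.+1 by apply: leq_ltn_trans ltun; rewrite Eu leq_pmulr.
have ltcn : c < n.+1 by apply: leq_ltn_trans ltun; rewrite Eu leq_pmull.
have t48 x : x < 2 ^ (42 * g) -> x < 2 ^ (3 * (16 * g)).
  by move=> lt; apply: leq_trans lt _; rewrite mulnA; exact: leq_exp2_mul.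
apply/bigcupP; exists (Ordinal ltk) => //; apply/bigcupP; exists (Ordinal lti) => //.
rewrite inE; apply/exists_inP; exists (Ordinal ltvn).
  rewrite inE rv /=; apply/andP; split.
    by apply: leq_trans hi _; rewrite leq_exp2l.
  by apply: leq_ltn_trans lev _; rewrite ltn_exp2l // mulnA ltn_mul2r g_gt0.
apply/exists_inP; exists (Ordinal ltun); last by rewrite /= mulnC Em.
rewrite inE /=; apply/andP; split.
  rewrite -(leq_pmul2r (_ : 0 < 2 ^ (40 * g - 2 * k - 2))) ?expn_gt0 // -expnD.
  apply: (@leq_trans (2 ^ (80 * g))); last first.
    by rewrite leq_exp2l //; move: ltk g_gt1; clear; lia.
  by apply: leq_trans lem; rewrite leq_mul2l (ltnW lo') orbT.
apply/existsP; exists (Ordinal ltan); apply/existsP; exists (Ordinal ltcn).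
rewrite /= ra lc hc Eu eqxx !andbT t48 //; apply: leq_ltn_trans ltu.
by rewrite Eu leq_pmulr.
Qed.

Lemma sidon_cover :
  [set: 'I_n] \subset (big_multiples n :|: \bigcup_(k < (38 * g).+1) products (Vlop k) (Ulop k)) :|:
    \bigcup_(k < g) \bigcup_(i < 4 * k + 4) products (Vbal k) (Ubal k i).
Proof.
apply/subsetP => m _; rewrite in_setU in_setU.
case: (boolP (m \in big_multiples n)) => //= small.
have lem : m.+1 <= 2 ^ (80 * g) by apply: leq_trans len; exact: ltn_ord.
have smooth p : prime p -> p %| m.+1 -> p <= 2 ^ (54 * g).
  move=> pp pm; rewrite leqNgt; apply/negP => lt.
  have lep : p < n.+1 by rewrite ltnS; apply: leq_trans (dvdn_leq _ pm) (ltn_ord m).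
  move: small; rewrite inE negb_exists => /forallP/(_ (Ordinal lep)).
  rewrite /= pm andbT /big_prime pp /= -leqNgt leqNgt => /negP; apply.
  apply: (@leq_ltn_trans ((2 ^ (80 * g)) ^ 2)); first exact: leq_exp_base.
  apply: (@leq_ltn_trans ((2 ^ (54 * g)) ^ 3)); last by rewrite ltn_exp2r.
  by rewrite -!expnM leq_exp2l //; clear; lia.
case: (factor_split g_gt0 (ltn0Sn m) lem smooth) => [/lopsided_cover -> //|].
by case=> u [v [Em bal]]; rewrite (balanced_cover Em bal) orbT.
Qed.

Hypotheses (y_lo : 8 * 2 ^ (40 * g) <= y ^ 2 * g)
  (y_hi : y.-1 ^ 2 * g < 8 * 2 ^ (40 * g)).

Lemma card_sidon_in_bal k i : k < g -> #|sidon_in (products (Vbal k) (Ubal k i))| <=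
  2 ^ (box_w y k * box_s y k * box_s y k * (40 + 2 * (4 * k))).
Proof.
move=> ltk; apply: leq_trans (card_sidon_in_bip _ _) _.
have t_gt0 : 0 < 16 * g by rewrite muln_gt0.
by apply: (card_bip_block g_gt1 y_lo y_hi ltk); [exact: card_rough | exact: card_rough_mul].
Qed.

(** As [k <= 38 * g], 2 #|U| #|V|^2 is at most 2^(80 g + k + 4), hence at most the square of 2^(59 g
    + 2). *)
Lemma card_sidon_in_lop k : k < (38 * g).+1 ->
  #|sidon_in (products (Vlop k) (Ulop k))| <= n.+1 ^ (2 ^ (59 * g + 2)).
Proof.
move=> ltk; have cV := card_ord_lt n.+1 (2 ^ k.+1); rewrite -/(Vlop k) in cV.
have cU := card_ord_lt n.+1 (2 ^ minn (58 * g) (80 * g - k)).+1; rewrite -/(Ulop k) in cU.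
have cU' : #|Ulop k| <= 2 ^ (minn (58 * g) (80 * g - k)).+1.
  apply: leq_trans cU _; rewrite expnS mul2n -addnn -add1n leq_add2r expn_gt0 //.
apply: card_sidon_in_small.
  apply: (@leq_trans (2 * 2 ^ (58 * g).+1)).
    rewrite leq_mul2l /=; apply: leq_trans cU' _; rewrite leq_exp2l // ltnS geq_minl //.
  by rewrite -expnS leq_exp2l //; move: g_gt0; clear; lia.
apply: (@leq_trans (2 * 2 ^ (80 * g - k).+1 * (2 ^ k.+1) ^ 2)).
  apply: leq_mul; last exact: leq_exp_base.
  rewrite leq_mul2l /=; apply: leq_trans cU' _; rewrite leq_exp2l // ltnS geq_minr //.
by rewrite -expnS -!expnM -expnD leq_exp2l //; move: ltk g_gt1; clear; lia.
Qed.

Lemma card_sidon_le :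
  Defs.S n <= T n * 2 ^ (1792 * y ^ 3 +
     (80 * g + 1) * (2 ^ (54 * g) + (38 * g + 1) * 2 ^ (59 * g + 2))).
Proof.
have -> : Defs.S n = #|sidon_in [set: 'I_n]|.
  by apply: eq_card => A; rewrite !inE subsetT andbT.
apply: leq_trans (sidon_inS sidon_cover) _.
apply: leq_trans (card_sidon_inU _ _) _.
rewrite addnC expnD mulnA; apply: leq_mul.
  apply: leq_trans (card_sidon_inU _ _) _.
  have nn : n.+1 <= 2 ^ (80 * g + 1).
    by rewrite addn1 expnS mul2n -addnn -addn1 leq_add ?expn_gt0.
  rewrite mulnDr expnD mulnA; apply: leq_mul.
    (* [K = 2 ^ (27 * g)] works since 3 * 27 > 80; its square is the term [2 ^ (54 * g)]. *)
    apply: leq_trans (card_sidon_in_big (_ : n < (2 ^ (27 * g)) ^ 3)) _.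
      apply: leq_ltn_trans len _; rewrite -expnM ltn_exp2l //.
      by move: g_gt0; clear; lia.
    rewrite leq_mul2l; apply/orP; right; rewrite -expnD -mulnDl [X in _ <= X]expnM.
    exact: leq_exp_base.
  apply: leq_trans (card_sidon_in_bigcup _) _.
  apply: (@leq_trans (\prod_(k < (38 * g).+1) (n.+1 ^ (2 ^ (59 * g + 2))))).
    by apply: leq_prod => k _; apply: card_sidon_in_lop.
  rewrite prod_nat_const card_ord -expnM (mulnC _ (38 * g).+1) -(addn1 (38 * g)) [X in _ <= X]expnM.
  exact: leq_exp_base.
apply: leq_trans (card_sidon_in_bigcup _) _.
apply: leq_trans (_ : 2 ^ (\sum_(k < g) box_w y k * box_s y k * box_s y k
   * (40 + 2 * (4 * k)) * (4 * k + 4)) <= _); last first.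
  by rewrite leq_exp2l //; apply: sum_bits.
rewrite expn_sum; apply: leq_prod => k _.
apply: leq_trans (card_sidon_in_bigcup _) _.
apply: (@leq_trans (\prod_(i < 4 * k + 4)
    2 ^ (box_w y k * box_s y k * box_s y k * (40 + 2 * (4 * k))))).
  by apply: leq_prod => i _; apply: card_sidon_in_bal.
by rewrite prod_nat_const card_ord -expnM.
Qed.
End Upper.

Lemma poly_le_exp c d : exists g0, forall g, g0 <= g -> c * g ^ d <= 2 ^ g.
Proof.
exists (c * d.+1 ^ d * d.+1) => g leg; set m := g %/ d.+1.
have lem : c * d.+1 ^ d <= 2 ^ m.
  apply: ltnW; apply: leq_ltn_trans (ltn_expl m (isT : 1 < 2)).
  by rewrite /m leq_divRL.
have ltg : g <= d.+1 * 2 ^ m.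
  apply: (@leq_trans (d.+1 * m.+1)); last by rewrite leq_mul2l ltn_expl ?orbT.
  by rewrite mulnC ltnW // -ltn_divLR.
apply: (@leq_trans (c * (d.+1 ^ d * 2 ^ (m * d)))).
  by rewrite leq_mul2l expnM -expnMn leq_exp_base ?orbT.
apply: (@leq_trans (2 ^ m * 2 ^ (m * d))); first by rewrite mulnA leq_mul2r lem orbT.
by rewrite -expnD leq_exp2l // -mulnS leq_divM.
Qed.

(** The left side is 2^(59 g) times a power of g, whereas [y ^ 3] is at least of order 2^(60 g) /
    g^(3/2). Squaring removes the half-integral power. *)
Lemma error_le : exists g0, forall g y, g0 <= g -> 8 * 2 ^ (40 * g) <= y ^ 2 * g ->
  (80 * g + 1) * (2 ^ (54 * g) + (38 * g + 1) * 2 ^ (59 * g + 2)) <= y ^ 3.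
Proof.
have [g0 hg] := poly_le_exp ((81 * 161) ^ 2) 7.
exists g0.+1 => g y leg ylo; have g_gt0 : 0 < g by apply: leq_trans leg.
have h1 : (80 * g + 1) * (2 ^ (54 * g) + (38 * g + 1) * 2 ^ (59 * g + 2))
    <= 81 * 161 * g ^ 2 * 2 ^ (59 * g).
  have h : 2 ^ (54 * g) <= 2 ^ (59 * g) by exact: leq_exp2_mul.
  rewrite expnD (_ : 2 ^ 2 = 4) // -mulnn; move: h g_gt0; move: (2 ^ (54 * g)) (2 ^ (59 * g)).
  clear => a b h g_gt0.
  apply: (@leq_trans ((81 * g) * (161 * g * b))); last by lia.
  by apply: leq_mul; nia.
apply: leq_trans h1 _; rewrite -(@leq_exp2r _ _ 2) //.
have g3 : 0 < g ^ 3 by rewrite expn_gt0 g_gt0.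
rewrite -(leq_pmul2r g3).
have -> : (y ^ 3) ^ 2 * g ^ 3 = (y ^ 2 * g) ^ 3 by rewrite expnMn -!expnM.
apply: leq_trans (leq_exp_base 3 ylo).
apply: (@leq_trans ((81 * 161) ^ 2 * g ^ 7 * 2 ^ (118 * g))).
  rewrite !expnMn -!expnM (_ : 59 * g * 2 = 118 * g); last by clear; lia.
  by rewrite (_ : 7 = 2 * 2 + 3) // expnD; move: (81 ^ 2) (161 ^ 2) => a b; clear; lia.
apply: (@leq_trans (2 ^ g * 2 ^ (118 * g))).
  by rewrite leq_mul2r hg ?orbT // ltnW.
rewrite expnMn -expnM -expnD; apply: (@leq_trans (2 ^ (40 * g * 3))).
  by rewrite leq_exp2l //; clear; lia.
by rewrite leq_pmull // expn_gt0.
Qed.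

Lemma log_scale g0 : exists N, forall n, N <= n -> exists g,
  [/\ g0 < g, n <= 2 ^ (80 * g) & 2 ^ (80 * g.-1) <= n].
Proof.
exists (2 ^ (80 * g0)) => n len; have n_gt0 : 0 < n by apply: leq_trans len; rewrite expn_gt0.
have [lo hi] := andP (trunc_log_bounds (isT : 1 < 2) n_gt0).
set k := trunc_log 2 n in lo hi.
have lek : 80 * g0 <= k.
  by rewrite -ltnS -(@ltn_exp2l 2) //; apply: leq_ltn_trans hi.
exists (k %/ 80).+1; split=> /=.
- by rewrite ltnS leq_divRL // mulnC.
- apply: leq_trans (ltnW hi) _; rewrite leq_exp2l // mulnC.
  by rewrite -ltn_divLR.
- by apply: leq_trans lo; rewrite leq_exp2l // mulnC leq_divM.
Qed.

Lemma scale_y g : 0 < g -> exists y,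
  8 * 2 ^ (40 * g) <= y ^ 2 * g /\ y.-1 ^ 2 * g < 8 * 2 ^ (40 * g).
Proof.
move=> g_gt0; have ex : exists y, 8 * 2 ^ (40 * g) <= y ^ 2 * g.
  exists (8 * 2 ^ (40 * g)); rewrite -mulnn -mulnA leq_pmulr //.
  by rewrite !muln_gt0 expn_gt0 g_gt0.
case: (ex_minnP ex) => y ylo ymin; exists y; split => //.
rewrite ltnNge; apply/negP => /ymin; case: y ylo {ymin} => [|y] ylo; last by lia.
by move: ylo; rewrite leqn0 muln_eq0 expn_eq0.
Qed.

(** * Products of prime divisors of factorials *)

Lemma dvdn_logn a b : 0 < a -> 0 < b ->
  (forall p, prime p -> logn p a <= logn p b) -> a %| b.
Proof.
move=> a_gt0 b_gt0 le; apply/dvdn_partP => // p pa; rewrite p_part pfactor_dvdn //.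
  by apply: le; move: pa; rewrite mem_primes => /andP[].
by move: pa; rewrite mem_primes => /andP[].
Qed.

Lemma logn_fact_wide p n N : prime p -> n <= N ->
  logn p n`! = \sum_(1 <= k < N.+1) n %/ p ^ k.
Proof.
move=> pp le; rewrite logn_fact // [RHS](big_cat_nat (n := n.+1)) //=.
rewrite [X in _ = _ + X]big1_seq ?addn0 // => k; rewrite mem_index_iota => /andP[_ /andP[lt _]].
by rewrite divn_small //; apply: leq_ltn_trans (ltn_expl k (prime_gt1 pp)); exact: ltnW.
Qed.

(* The terms of Legendre's formula for Chebyshev's ratio [(30n)! n! / ((15n)! (10n)! (6n)!)];
   the four smaller quotients are determined by [30 * n %/ q]. *)
Lemma chebyshev_floor n q : 0 < q ->
  (30 * n) %/ q + n %/ q <= (15 * n) %/ q + (10 * n) %/ q + (6 * n) %/ q + (q <= 30 * n).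
Proof.
move=> q_gt0; have div c m : 0 < c -> m %/ q = (c * m) %/ q %/ c.
  by move=> c_gt0; rewrite -divnMA [q * c]mulnC divnMl.
rewrite (div 30 n) // (div 2 (15 * n)) // (div 3 (10 * n)) // (div 5 (6 * n)) // !mulnA.
rewrite -[q <= 30 * n](divn_gt0 (30 * n) q_gt0).
move: (_ %/ q) => x; case: x => // x /=; lia.
Qed.

(** This is lcm(1, ..., N), the exponential of Chebyshev's function psi. *)
Definition psi_prod N := \prod_(0 <= p < N.+1 | prime p) p ^ trunc_log p N.

Lemma psi_prod_gt0 N : 0 < psi_prod N.
Proof. by apply: prodn_cond_gt0 => p /prime_gt0 p_gt0; rewrite expn_gt0 p_gt0. Qed.

Lemma trunc_log_psi p N : prime p -> trunc_log p N <= logn p (psi_prod N).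
Proof.
move=> pp; have [lt|le] := ltnP N p.
  have -> : trunc_log p N = 0 by apply/eqP; rewrite trunc_log_eq0 -[N <= _]ltnS prednK ?prime_gt0 // lt orbT.
  by [].
rewrite -pfactor_dvdn ?psi_prod_gt0 // /psi_prod -big_filter.
rewrite (big_rem p) ?dvdn_mulr //=.
by rewrite mem_filter pp mem_iota prime_gt0 //= add1n ltnS.
Qed.

(** Legendre's formula for each prime p: [chebyshev_floor] loses at most 1 for every power p^k <= 30
    n with k positive, and there are [trunc_log p (30 * n)] of these. *)
Lemma fact_ratio n :
  (30 * n)`! * n`! <= (15 * n)`! * (10 * n)`! * (6 * n)`! * psi_prod (30 * n).
Proof.
have pos := fact_gt0; have ppos := psi_prod_gt0.
apply: dvdn_leq; first by rewrite !muln_gt0 !pos ppos.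
apply: dvdn_logn => [||p pp]; rewrite ?muln_gt0 ?pos ?ppos //.
rewrite !lognM ?muln_gt0 ?pos ?ppos //.
apply: leq_trans (_ : logn p (15 * n)`! + logn p (10 * n)`! + logn p (6 * n)`!
    + trunc_log p (30 * n) <= _); last by rewrite leq_add2l trunc_log_psi.
have E c : c <= 30 -> logn p (c * n)`! = \sum_(1 <= k < (30 * n).+1) (c * n) %/ p ^ k.
  by move=> le; apply: logn_fact_wide; rewrite // leq_mul2r le orbT.
have E1 := E 1 isT; rewrite mul1n in E1.
rewrite (E 30) // (E 15) // (E 10) // (E 6) // E1.
have -> : trunc_log p (30 * n) = \sum_(1 <= k < (30 * n).+1) (p ^ k <= 30 * n).
  have [n0|n_gt0] := posnP (30 * n).
    by rewrite n0 big_geq // trunc_log0.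
  have [lo hi] := andP (trunc_log_bounds (prime_gt1 pp) n_gt0).
  set t := trunc_log p _ in lo hi *.
  have lt : t < (30 * n).+1.
    by rewrite ltnS; apply: leq_trans lo; apply: ltnW; apply: ltn_expl (prime_gt1 pp).
  rewrite (big_cat_nat (n := t.+1)) //= [X in _ + X]big1_seq ?addn0; last first.
    move=> k; rewrite mem_index_iota => /andP[_ /andP[ltk _]]; apply/eqP.
    rewrite eqb0 -ltnNge; apply: leq_trans hi _.
    by rewrite leq_exp2l // prime_gt1.
  rewrite (eq_big_nat _ _ (F2 := fun=> 1)) => [|k /andP[_ ltk]].
    by rewrite sum_nat_const_nat subSS subn0 muln1.
  apply/eqP; rewrite eqb1; apply: leq_trans lo.
  by rewrite leq_exp2l // prime_gt1.
rewrite -!big_split /=; apply: leq_sum => k _.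
by apply: chebyshev_floor; rewrite expn_gt0 prime_gt0.
Qed.

Definition prime_pi z := count prime (iota 1 z).

Lemma psi_prod_le_pi N : psi_prod N <= N ^ prime_pi N.
Proof.
rewrite /psi_prod /prime_pi /index_iota subn0 /= big_cons /= -size_filter -big_filter.
case: (posnP N) => [->|N_gt0]; first by rewrite /= big_nil.
elim: [seq _ <- _ | _] => [|p s IH]; first by rewrite big_nil.
rewrite big_cons expnS; apply: leq_mul => //.
case: (ltnP 1 p) => [p_gt1|]; first by case/andP: (trunc_log_bounds p_gt1 N_gt0).
by case: p => [|[|p]] // _; rewrite ?trunc_log0n ?trunc_log1n // exp1n.
Qed.

(** Primes up to [r] contribute at most [N] each. Those beyond occur to the first power only and,
    because of the gap, are factors of [primorial z]. *)
Lemma psi_prod_gap N z r : 0 < N -> N < r.+1 ^ 2 -> z <= N ->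
  (forall p, prime p -> z < p -> p <= N -> False) ->
  psi_prod N <= N ^ r * 4 ^ z.
Proof.
move=> N_gt0 ltN lezN gap.
apply: (@leq_trans ((\prod_(0 <= p < N.+1 | prime p && (p <= r)) N) *
    \prod_(0 <= p < N.+1 | prime p && ~~ (p <= r)) p)).
  rewrite /psi_prod (bigID (fun p => p <= r)) /=; apply: leq_mul.
    apply: leq_prod => p /andP[pp _].
    by case/andP: (trunc_log_bounds (prime_gt1 pp) N_gt0).
  apply: leq_prod => p /andP[pp]; rewrite -ltnNge => ltr.
  have p_gt0 := prime_gt0 pp; rewrite -[X in _ <= X](expn1 p) leq_exp2l ?prime_gt1 //.
  rewrite -ltnS -(@ltn_exp2l p) ?prime_gt1 //.
  case/andP: (trunc_log_bounds (prime_gt1 pp) N_gt0) => lo _.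
  by apply: leq_ltn_trans lo _; apply: leq_trans ltN _; exact: leq_exp_base.
apply: leq_mul.
  rewrite big_const_seq iter_muln_1 leq_pexp2l //.
  rewrite -size_filter -{2}(size_iota 1 r); apply: uniq_leq_size.
    by rewrite filter_uniq // iota_uniq.
  move=> p; rewrite mem_filter mem_iota => /andP[/andP[pp ler] _].
  by rewrite prime_gt0 //= add1n ltnS.
apply: leq_trans (primorial_le z).
rewrite (big_cat_nat (n := z.+1)) //= [X in _ * X]big1_seq ?muln1; last first.
  move=> p; rewrite mem_index_iota => /andP[/andP[pp _] /andP[ltp leN]].
  by case: (gap p pp ltp leN).
rewrite /primorial big_mkcond [X in _ <= X]big_mkcond /=; apply: leq_prod => p _.
case pp: (prime p) => //=; case: ifP => // _; exact: prime_gt0.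
Qed.

(** * Many Sidon sets from a parabola *)

Section LowerConstruction.
Import ring GRing.Theory.
Variables (K : finFieldType) (n : nat) (r : K * K -> nat).
Hypotheses (two_neq0 : (2 != 0 :> K)%R) (r_inj : injective r)
  (r_prime : forall v, prime (r v)) (r_small : forall v, ~~ big_prime n (r v)).
Implicit Types (v w x y u : K * K) (t : K).

(* The pairs of a class have their sum on a translate of the parabola [b = a ^ 2], which is
   a Sidon set in [K * K]. *)
Definition parab v w : K := (v.2 + w.2 - (v.1 + w.1) ^+ 2)%R.

Lemma parabC v w : parab v w = parab w v.
Proof. by rewrite /parab; ring. Qed.

(** The alternating sum of the four equations is 2 (x.1 - w.1) (y.1 - u.1) = 0. Once a pair of first
    coordinates agrees, the equations make the second ones agree too. *)
Lemma parab_c4 x y u w t : parab x y = t -> parab x u = t -> parab w y = t -> parab w u = t ->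
  x = w \/ y = u.
Proof.
rewrite /parab => h1 h2 h3 h4.
have : (2 * ((x.1 - w.1) * (y.1 - u.1)) = 0 :> K)%R.
  have -> : (2 * ((x.1 - w.1) * (y.1 - u.1)) =
     (x.2 + u.2 - (x.1 + u.1) ^+ 2) - (x.2 + y.2 - (x.1 + y.1) ^+ 2) +
     (w.2 + y.2 - (w.1 + y.1) ^+ 2) - (w.2 + u.2 - (w.1 + u.1) ^+ 2) :> K)%R by ring.
  by rewrite h1 h2 h3 h4; ring.
move/eqP; rewrite mulf_eq0 (negbTE two_neq0) /= mulf_eq0 => /orP[]; rewrite subr_eq0 => /eqP e.
  left; case: x w e h1 h2 h3 h4 => [a b] [a' b'] /= -> h1 h2 h3 h4; congr pair.
  move: h1; rewrite -h3 => /(congr1 (fun z => z + (a' + y.1) ^+ 2 - y.2)%R).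
  by rewrite !addrNK !addrK.
right; case: y u e h1 h2 h3 h4 => [a b] [a' b'] /= -> h1 h2 h3 h4; congr pair.
move: h1; rewrite -h2 => /(congr1 (fun z => z + (x.1 + a') ^+ 2 - x.2)%R).
by rewrite !addrNK ![(x.2 + _)%R]addrC !addrK.
Qed.

Definition is_edge t x y m := [/\ parab x y = t, r x != r y & m = r x * r y].

Lemma is_edgeC t x y m : is_edge t x y m -> is_edge t y x m.
Proof. by case=> g ne e; split; rewrite ?[parab y x]parabC // 1?eq_sym // mulnC. Qed.

Lemma edge_dvd t x z w m : is_edge t z w m -> r x %| m -> exists u, is_edge t x u m.
Proof.
move=> e; have [_ _ em] := e; rewrite [X in _ %| X]em Euclid_dvdM // !dvdn_prime2 // => /orP[]/eqP/r_inj ->.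
  by exists w.
by exists z; apply: is_edgeC.
Qed.

(** With [a1], [b1], [b2] the products of xy, xu, yw, cancellation leaves the product of uw for
    [a2]. Unique factorisation makes uw an edge of the class, so xy, xu, wy, wu form the excluded
    4-cycle. *)
Lemma edge_core t x y x2 y2 u w a1 a2 b1 b2 : is_edge t x y a1 -> is_edge t x2 y2 a2 ->
  is_edge t x u b1 -> is_edge t y w b2 -> a1 * a2 = b1 * b2 -> b1 = a1 \/ b2 = a1.
Proof.
move=> [g1 n1 e1] E2 [g3 n3 e3] [g4 n4 e4] eq.
have rgt v : 0 < r v by apply: prime_gt0.
have Ea2 : a2 = r u * r w.
  apply/eqP; rewrite -(eqn_pmul2l (_ : 0 < a1)); last by rewrite e1 muln_gt0 !rgt.
  by rewrite eq e1 e3 e4; apply/eqP; lia.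
have guw : parab u w = t.
  have [z [g5 n5 e5]] : exists z, is_edge t u z a2.
    by apply: edge_dvd E2 _; rewrite Ea2 dvdn_mulr.
  suff -> : w = z by [].
  apply: r_inj; apply/eqP; rewrite -(eqn_pmul2l (rgt u)); apply/eqP.
  by rewrite -Ea2 e5.
case: (@parab_c4 x y u w t) => //; try by rewrite parabC.
  by move=> Exw; right; rewrite e4 e1 Exw mulnC.
by move=> Eyu; left; rewrite e3 e1 Eyu.
Qed.

(** The two distinct primes of [a1] either divide the same factor on the right, which then equals
    [a1], or they divide one each, which is the situation of [edge_core]. *)
Lemma edges_sidon t x1 y1 x2 y2 x3 y3 x4 y4 a1 a2 b1 b2 :
  is_edge t x1 y1 a1 -> is_edge t x2 y2 a2 -> is_edge t x3 y3 b1 -> is_edge t x4 y4 b2 ->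
  a1 * a2 = b1 * b2 -> a1 = b1 \/ a1 = b2.
Proof.
move=> E1 E2 E3 E4 eq; have [g1 n1 e1] := E1.
have both x3' y3' b : is_edge t x3' y3' b -> r x1 %| b -> r y1 %| b -> a1 = b.
  move=> E /(edge_dvd E)[u [g ne e]]; rewrite e Euclid_dvdM // !dvdn_prime2 //.
  rewrite [r y1 == _]eq_sym (negbTE n1) /= => /eqP yu; rewrite e1 yu //.
have dv p : p %| a1 -> prime p -> (p %| b1) || (p %| b2).
  by move=> pa pp; rewrite -Euclid_dvdM // -eq dvdn_mulr.
have /orP dx := dv (r x1) ltac:(by rewrite e1 dvdn_mulr) (r_prime _).
have /orP dy := dv (r y1) ltac:(by rewrite e1 dvdn_mull) (r_prime _).
case: dx dy => dx [] dy.
- by left; apply: both E3 dx dy.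
- have [u Eu] := edge_dvd E3 dx; have [w Ew] := edge_dvd E4 dy.
  by case: (edge_core E1 E2 Eu Ew eq) => ->; [left|right].
- have [u Eu] := edge_dvd E4 dx; have [w Ew] := edge_dvd E3 dy.
  by rewrite mulnC [RHS]mulnC mulnC in eq; case: (edge_core E1 E2 Eu Ew eq) => ->; [right|left].
- by right; apply: both E4 dx dy.
Qed.

Definition pairs : {set (K * K) * (K * K)} :=
  [set e | (r e.1 < r e.2) && (r e.1 * r e.2 <= n)].

Definition class_products t : {set 'I_n} := [set m : 'I_n |
  [exists e in pairs, (parab e.1 e.2 == t) && (m.+1 == r e.1 * r e.2)]].

Lemma class_products_edge t m : m \in class_products t -> exists x y, is_edge t x y m.+1.
Proof.
rewrite inE => /exists_inP[e]; rewrite inE => /andP[lt _] /andP[/eqP g /eqP em].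
by exists e.1, e.2; split => //; rewrite neq_ltn lt.
Qed.

Lemma class_products_small t m : m \in class_products t -> m \notin big_multiples n.
Proof.
case/class_products_edge => x [y [_ _ em]]; rewrite inE negb_exists; apply/forallP => p.
apply/negP => /andP[bp]; have pp : prime p by case/andP: bp.
rewrite em Euclid_dvdM // !dvdn_prime2 //.
by case/orP=> /eqP e; move: bp; rewrite e; [exact: (negP (r_small x)) | exact: (negP (r_small y))].
Qed.

Lemma card_class_products t : #|[set e in pairs | parab e.1 e.2 == t]| <= #|class_products t|.
Proof.
have rgt v : 0 < r v by apply: prime_gt0.
pose f (e : (K * K) * (K * K)) : option 'I_n := insub (r e.1 * r e.2).-1.
have fE e : e \in pairs -> exists2 m, f e = Some m & m.+1 = r e.1 * r e.2.
  rewrite inE => /andP[_ le].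
  have pos : 0 < r e.1 * r e.2 by rewrite muln_gt0 !rgt.
  have lt : (r e.1 * r e.2).-1 < n by rewrite prednK.
  by exists (Ordinal lt); rewrite /f ?insubT //= prednK.
rewrite -(card_imset (mem (class_products t)) (@Some_inj _)) -(@card_in_imset _ _ f).
  apply: subset_leq_card; apply/subsetP => _ /imsetP[e he ->].
  move: he; rewrite inE => /andP[ep g].
  have [m -> em] := fE e ep; apply: imset_f; rewrite inE; apply/exists_inP.
  by exists e => //; rewrite g em eqxx.
move=> e e'; rewrite !inE => /andP[ep _] /andP[ep' _] E.
have [m Em em] := fE e ltac:(by rewrite inE); have [m' Em' em'] := fE e' ltac:(by rewrite inE).
have eq : r e.1 * r e.2 = r e'.1 * r e'.2.
  by rewrite -em -em'; move: E; rewrite Em Em' => -[->].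
case/andP: ep => lt _; case/andP: ep' => lt' _.
have : r e.1 %| r e'.1 * r e'.2 by rewrite -eq dvdn_mulr.
rewrite Euclid_dvdM // !dvdn_prime2 // => /orP[]/eqP h.
  have h2 : r e.2 = r e'.2.
    by apply/eqP; rewrite -(eqn_pmul2l (rgt e.1)) eq h.
  by case: e e' h h2 {lt lt' eq em em' Em Em' E} => [a b] [a' b'] /= /r_inj -> /r_inj ->.
have h2 : r e.2 = r e'.1.
  by apply/eqP; rewrite -(eqn_pmul2l (rgt e.1)) eq h mulnC.
by move: lt; rewrite h h2 => /(ltn_trans lt'); rewrite ltnn.
Qed.

(** A prime with [c p = 0] adds nothing, since [m.+1] is positive. *)
Definition build (c : {ffun 'I_n.+1 -> 'I_n.+1}) (X : {set 'I_n}) : {set 'I_n} :=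
  X :|: [set m : 'I_n | [exists p : 'I_n.+1, big_prime n p && (m.+1 == p * c p)]].

Implicit Types (X Y : {set 'I_n}).

Lemma build_big c X t (m : 'I_n) : X \subset class_products t -> m \in build c X -> m \in big_multiples n ->
  exists p : 'I_n.+1, big_prime n p /\ m.+1 = p * c p.
Proof.
move=> /subsetP sX; rewrite inE => /orP[/sX/class_products_small/negP //|].
by rewrite inE => /existsP[p /andP[bp /eqP e]] _; exists p.
Qed.

Lemma build_sidon c X t : X \subset class_products t -> mult_sidon (build c X).
Proof.
move=> sX; apply/sidonP => a1 a2 b1 b2 h1 h2 h3 h4 ne eq.
(* A large prime dividing [a] divides [b] or [b'], but [build c X] contains at most one multiple of
   it. So all four elements come from the class. *)
have key a b b' a' : a \in build c X -> b \in build c X -> b' \in build c X ->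
    a.+1 * a'.+1 = b.+1 * b'.+1 -> a != b -> a != b' -> a \in class_products t.
  move=> ha hb hb' e n1 n2.
  case: (boolP (a \in big_multiples n)) => [aZ|].
    have [p [bp ea]] := build_big sX ha aZ.
    have pp : prime p by case/andP: bp.
    have : p %| b.+1 * b'.+1 by rewrite -e ea -mulnA dvdn_mulr.
    have same m : m \in build c X -> p %| m.+1 -> m = a.
      move=> hm pm; have mZ : m \in big_multiples n by rewrite inE; apply/existsP; exists p; rewrite bp.
      have [q [bq em]] := build_big sX hm mZ.
      have pq : p = q.
        by apply: val_inj; apply: (big_prime_uniq bp bq pm); rewrite em dvdn_mulr.
      by apply: val_inj; apply: succn_inj => /=; rewrite em ea pq.
    rewrite Euclid_dvdM // => /orP[] d; [move: n1 | move: n2];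
      by rewrite (same _ _ d) // eqxx.
  rewrite inE in ha; case/orP: ha => [/(subsetP sX) //|].
  rewrite inE => /existsP[p /andP[bp /eqP ea]]; rewrite inE => /existsP[].
  by exists p; rewrite bp ea dvdn_mulr.
case/and4P: ne => n12 n13 n14 /and3P[n23 n24 n34].
have d1 := key _ _ _ _ h1 h3 h4 eq n13 n14.
have d2 : a2 \in class_products t by apply: (key a2 b1 b2 a1); rewrite // mulnC.
have d3 : b1 \in class_products t by apply: (key b1 a1 a2 b2); rewrite // eq_sym.
have d4 : b2 \in class_products t.
  by apply: (key b2 a1 a2 b1); rewrite // 1?eq_sym // mulnC.
have [x1 [y1 E1]] := class_products_edge d1; have [x2 [y2 E2]] := class_products_edge d2.
have [x3 [y3 E3]] := class_products_edge d3; have [x4 [y4 E4]] := class_products_edge d4.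
case: (edges_sidon E1 E2 E3 E4 eq) => -[] /val_inj h.
  by rewrite h eqxx in n13.
by rewrite h eqxx in n14.
Qed.

(** [X] is recovered as the part without large prime factors, and a positive [c p] is read off from
    the only multiple of [p]. *)
Lemma build_inj t c c' X X' : c \in family (@choices n) -> c' \in family (@choices n) ->
  X \subset class_products t -> X' \subset class_products t -> build c X = build c' X' -> c = c' /\ X = X'.
Proof.
move=> /familyP fc /familyP fc' sX sX' E; split; last first.
  have XE d Y : Y \subset class_products t -> Y = build d Y :\: big_multiples n.
    move=> /subsetP sY; apply/setP => m; rewrite !inE.
    apply/idP/andP => [mY|[nb]]; first by rewrite mY; split => //; have := class_products_small (sY _ mY); rewrite inE.
    case/orP => // /existsP[p /andP[bp /eqP em]]; case/negP: nb; apply/existsP.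
    by exists p; rewrite bp em dvdn_mulr.
  by rewrite (XE c X sX) (XE c' X' sX') E.
have sub d d' Y Y' (p : 'I_n.+1) : d \in family (@choices n) -> Y' \subset class_products t ->
    build d Y = build d' Y' -> big_prime n p -> 0 < d p -> d' p = d p.
  move=> /familyP fd sY' Eb bp pos.
  have pp : prime p by case/andP: bp.
  have le : p * d p <= n.
    move: (fd p); rewrite /choices bp inE => le.
    by rewrite mulnC -leq_divRL // prime_gt0.
  have pos2 : 0 < p * d p by rewrite muln_gt0 pos prime_gt0.
  have lt : (p * d p).-1 < n by rewrite prednK.
  have mb : Ordinal lt \in build d Y.
    by rewrite !inE; apply/orP; right; apply/existsP; exists p; rewrite bp /= prednK.
  have mZ : Ordinal lt \in big_multiples n.
    by rewrite inE; apply/existsP; exists p; rewrite bp /= prednK // dvdn_mulr.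
  rewrite Eb in mb; have [q [bq em]] := build_big sY' mb mZ.
  rewrite /= prednK // in em.
  have pq : p = q.
    apply: val_inj; apply: (big_prime_uniq (m := Ordinal lt) bp bq); rewrite /= prednK //.
      exact: dvdn_mulr.
    by rewrite em; exact: dvdn_mulr.
  rewrite -pq in em; apply: val_inj; apply/eqP.
  by rewrite -(eqn_pmul2l (prime_gt0 pp)) em.
apply/ffunP => p; case: (boolP (big_prime n p)) => bp; last first.
  move: (fc p) (fc' p); rewrite /choices (negbTE bp) !inE.
  by move=> /eqP -> /eqP ->.
have [c0|pos] := posnP (c p).
  have [c'0|pos'] := posnP (c' p); first by apply: val_inj; rewrite /= c0 c'0.
  by apply: (sub c' c X' X p) => //; apply/familyP.
by apply/esym/(sub c c' X X' p) => //; apply/familyP.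
Qed.

Lemma lower_construction : exists e, T n * 2 ^ e <= Defs.S n /\ #|pairs| <= #|K| * e.
Proof.
have [t ht] : exists t, #|pairs| <= #|K| * #|[set e in pairs | parab e.1 e.2 == t]|.
  have cov : #|pairs| <= \sum_(t in [set: K]) #|[set e in pairs | parab e.1 e.2 == t]|.
    apply: card_cover_le => e ep; exists (parab e.1 e.2); first by rewrite inE.
    by rewrite inE ep eqxx.
  pose F t := #|[set e in pairs | parab e.1 e.2 == t]|.
  have [t _ tmax] := @arg_maxnP K (0%R : K) xpredT F isT.
  exists t; apply: leq_trans cov _; rewrite -cardsT -sum_nat_const.
  by apply: leq_sum => t' _; exact: tmax.
exists #|class_products t|; split; last first.
  by apply: leq_trans ht _; rewrite leq_mul2l card_class_products orbT.
rewrite -card_choices -card_powerset /Defs.S.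
have -> : #|family (@choices n)| = #|[set c in family (@choices n)]| by rewrite cardsE.
rewrite -cardsX.
rewrite -(@card_in_imset _ _ (fun cX => build cX.1 cX.2)).
  apply: subset_leq_card; apply/subsetP => _ /imsetP[[c X] h ->].
  move: h; rewrite !inE /= => /andP[_ sX].
  exact: build_sidon sX.
move=> [c X] [c' X']; rewrite !inE /= => /andP[fc sX] /andP[fc' sX'] E.
by have [-> ->] := build_inj fc fc' sX sX' E.
Qed.
End LowerConstruction.

(** * Pairs of primes below a hyperbola *)

(* Numbered from 0; the value is 0 if there are at most [j] primes up to [n]. *)
Definition nthprime (n j : nat) : nat := nth 0 [seq p <- iota 1 n | prime p] j.

Lemma nthprimeP n y j : y <= n -> j < prime_pi y ->
  prime (nthprime n j) /\ nthprime n j <= y.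
Proof.
move=> le lt; have E : nthprime n j = nth 0 [seq p <- iota 1 y | prime p] j.
  rewrite /nthprime -(subnKC le) iotaD filter_cat nth_cat size_filter.
  by rewrite -/(prime_pi y) lt.
have := mem_nth 0 (_ : j < size [seq p <- iota 1 y | prime p]).
rewrite size_filter => /(_ lt); rewrite -E mem_filter mem_iota => /and3P[-> _].
by rewrite add1n ltnS.
Qed.

Lemma nthprime_lt n i j : i < j -> j < prime_pi n -> nthprime n i < nthprime n j.
Proof.
move=> ltij ltj; apply: (sorted_ltn_nth ltn_trans) => //.
- by apply: sorted_filter; [exact: ltn_trans | exact: iota_ltn_sorted].
- by rewrite inE size_filter (ltn_trans ltij).
- by rewrite inE size_filter.
Qed.

Lemma card_interval N a b : b <= N -> b - a <= #|[set j : 'I_N | a <= j < b]|.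
Proof.
move=> leb; have lt (k : 'I_(b - a)) : a + k < N by have := ltn_ord k; lia.
pose f k : 'I_N := Ordinal (lt k).
have finj : injective f by move=> k k' [] /eqP; rewrite eqn_add2l => /eqP /val_inj.
rewrite -[X in X <= _]card_ord -(card_imset predT finj); apply: subset_leq_card.
apply/subsetP => _ /imsetP[k _ ->]; rewrite inE /= leq_addr /=.
by have := ltn_ord k; lia.
Qed.

Lemma card_hyperbola N M : M <= N ->
  \sum_(1 <= a < M.+1) (minn N (M ^ 2 %/ a) - a) <=
  #|[set e : 'I_N * 'I_N | (e.1 < e.2) && (e.1.+1 * e.2.+1 <= M ^ 2)]|.
Proof.
move=> leMN.
have -> : #|[set e : 'I_N * 'I_N | (e.1 < e.2) && (e.1.+1 * e.2.+1 <= M ^ 2)]| =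
    \sum_(i < N) #|[set j : 'I_N | (i < j) && (i.+1 * j.+1 <= M ^ 2)]|.
  rewrite -sum1dep_card -(pair_big_dep xpredT
    (fun i j : 'I_N => (i < j) && (i.+1 * j.+1 <= M ^ 2)) (fun _ _ => 1)) /=.
  by apply: eq_bigr => i _; rewrite sum1dep_card.
rewrite big_add1 /= -(subnKC leMN) big_split_ord /= big_mkord.
apply: leq_trans (leq_addr _ _); apply: leq_sum => i _; rewrite subnKC //.
apply: leq_trans (card_interval i.+1 (geq_minl N (M ^ 2 %/ i.+1))) _.
apply: subset_leq_card; apply/subsetP => j; rewrite !inE => /andP[-> /=].
by rewrite leq_min => /andP[_]; rewrite leq_divRL // mulnC.
Qed.

(** The labelling of the primes by [enum_rank] is arbitrary: the classes together exhaust all pairs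
    for any labelling. An odd [q] is needed for 2 to be invertible in ['F_q]. *)
Lemma lower_count n q M : prime q -> 2 < q -> M <= q * q -> q * q <= prime_pi n ->
  (forall j, j < q * q -> ~~ big_prime n (nthprime n j)) ->
  (forall i j, i < j -> j < q * q -> i.+1 * j.+1 <= M ^ 2 ->
     nthprime n i * nthprime n j <= n) ->
  exists e, T n * 2 ^ e <= Defs.S n /\
    \sum_(1 <= a < M.+1) (minn (q * q) (M ^ 2 %/ a) - a) <= q * e.
Proof.
move=> pq q_gt2 leM lepi small le.
have cV : #|{: 'F_q * 'F_q}| = q * q by rewrite card_prod card_Fp.
pose rk (v : 'F_q * 'F_q) : nat := enum_rank v.
have rk_lt v : rk v < q * q by rewrite -cV; exact: ltn_ord.
pose r v := nthprime n (rk v).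
have r_prime v : prime (r v).
  by case: (@nthprimeP n n (rk v)) => //; exact: leq_trans lepi.
have rlt v w : rk v < rk w -> r v < r w.
  by move=> lt; apply: nthprime_lt => //; exact: leq_trans lepi.
have r_inj : injective r.
  move=> v w E; case: (ltngtP (rk v) (rk w)) => [/rlt|/rlt|h].
  - by rewrite E ltnn.
  - by rewrite E ltnn.
  - exact: enum_rank_inj (val_inj h).
have two : (2 != 0 :> 'F_q)%R.
  rewrite -(GRing.dvdn_pcharf (pchar_Fp pq)); apply/negP => /dvdn_leq; lia.
have [e [he hp]] := lower_construction two r_inj r_prime (fun v => small _ (rk_lt v)).
exists e; split => //; rewrite card_Fp // in hp; apply: leq_trans hp.
apply: leq_trans (card_hyperbola leM) _.
rewrite -cV; pose g (ij : 'I_#|{: 'F_q * 'F_q}| * 'I_#|{: 'F_q * 'F_q}|) :=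
  (enum_val ij.1, enum_val ij.2).
rewrite -(@card_in_imset _ _ g).
  apply: subset_leq_card; apply/subsetP => _ /imsetP[[i j] h ->].
  move: h; rewrite !inE /= => /andP[lt lem].
  rewrite /r /rk /g /= !enum_valK nthprime_lt //=.
    by apply: le => //; rewrite -cV.
  by apply: leq_trans lepi; rewrite -cV.
by move=> [i j] [i' j'] _ _ [] /enum_val_inj -> /enum_val_inj ->.
Qed.

(** * Analytic estimates *)

Local Open Scope R_scope.

Lemma INR_expn a b : INR (a ^ b)%N = INR a ^ b.
Proof. by elim: b => [|b IH] //=; rewrite expnS mult_INR IH. Qed.

Lemma INR_muln a b : INR (a * b)%N = INR a * INR b.
Proof. exact: mult_INR. Qed.

Lemma INR_leq a b : (a <= b)%N -> INR a <= INR b.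
Proof. by move/leP; exact: le_INR. Qed.

Lemma INR_ltn a b : (a < b)%N -> INR a < INR b.
Proof. by move/ltP; exact: lt_INR. Qed.

Lemma Rpower_sqr_three_halves (y : R) : 0 < y -> Rpower (y ^ 2) (3 / 2) = y ^ 3.
Proof.
move=> y_gt0; rewrite -!Rpower_pow // Rpower_mult; congr Rpower.
by rewrite /=; lra.
Qed.

(** y <= 2 (y - 1) gives y^2 g <= 32 * 2^(40 g) <= 32 * 2^40 sqrt n, and ln n <= 80 g. The constant
    is 80 * 32 * 2^40, raised to the power 3/2. *)
Lemma main_term_le (n g y : nat) : (1 < g)%N -> (n <= 2 ^ (80 * g))%N ->
  (2 ^ (80 * g.-1) <= n)%N -> (8 * 2 ^ (40 * g) <= y ^ 2 * g)%N ->
  (y.-1 ^ 2 * g < 8 * 2 ^ (40 * g))%N ->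
  INR (y ^ 3) <= Rpower (2560 * 2 ^ 40) (3 / 2) *
     (Rpower (INR n) (3 / 4) / Rpower (ln (INR n)) (3 / 2)).
Proof.
move=> g_gt1 hi lo ylo yhi.
have y_gt1 : (1 < y)%N.
  apply: leq_trans (y_ge ylo); rewrite -{1}(expn1 2) leq_exp2l //.
  by move: g_gt1; clear; lia.
have n_gt1 : (1 < n)%N.
  apply: leq_trans lo; rewrite -{1}(expn1 2) leq_exp2l //.
  by move: g_gt1; clear; lia.
have n1 : 1 < INR n by rewrite -[1]/(INR 1); exact: INR_ltn.
have ln_gt0 : 0 < ln (INR n) by rewrite -ln_1; apply: ln_increasing; lra.
have g_gt0 : 0 < INR g by rewrite -[0]/(INR 0); apply: INR_ltn; exact: ltnW.
have y_gt0 : 0 < INR y by rewrite -[0]/(INR 0); apply: INR_ltn; exact: ltnW.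
have lng : ln (INR n) <= 80 * INR g.
  apply: (Rle_trans _ (ln (2 ^ (80 * g)%N))).
    apply: Rcomplements.ln_le; first lra.
    by rewrite -[2]/(INR 2) -INR_expn; exact: INR_leq.
  rewrite ln_pow; last lra.
  rewrite INR_muln (_ : INR 80 = 80); last by rewrite INR_IZR_INZ.
  have l2 : ln 2 < 1 by rewrite -[X in _ < X](ln_exp 1); apply: ln_increasing; [lra | have := @exp_ineq1 1; lra].
  by rewrite -{2}(Rmult_1_r (80 * INR g)); apply: Rmult_le_compat_l; lra.
set H := 2 ^ (40 * g.-1)%N.
have H_gt0 : 0 < H by apply: pow_lt; lra.
have Hn : H <= Rpower (INR n) (1 / 2).
  have -> : H = Rpower (H ^ 2) (1 / 2).
    rewrite -Rpower_pow // Rpower_mult (_ : INR 2 * (1 / 2) = 1) ?Rpower_1 //.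
    by rewrite /=; lra.
  apply: Rle_Rpower_l; first lra.
  split; first exact: pow_lt.
  rewrite /H -[2]/(INR 2) -INR_expn -INR_expn.
  by apply: INR_leq; apply: leq_trans lo; rewrite -expnM mulnAC.
have Y2 : INR y ^ 2 * INR g <= 32 * 2 ^ 40 * H.
  have E : 2 ^ 40 * H = INR (2 ^ (40 * g)).
    rewrite INR_expn /H -pow_add; congr (_ ^ _).
    by rewrite plusE -mulnS prednK // ltnW.
  rewrite Rmult_assoc E -INR_expn -INR_muln (_ : 32 = INR 32); last by rewrite INR_IZR_INZ.
  rewrite -INR_muln; apply: INR_leq.
  apply: (@leq_trans (4 * (y.-1 ^ 2 * g))).
    by rewrite mulnA leq_mul2r -!mulnn; apply/orP; right; move: y_gt1; clear; nia.
  by rewrite (_ : 32 = 4 * 8)%N // -mulnA leq_mul2l (ltnW yhi) orbT.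
have key : INR y ^ 2 * ln (INR n) <= 2560 * 2 ^ 40 * Rpower (INR n) (1 / 2).
  apply: (Rle_trans _ (INR y ^ 2 * (80 * INR g))).
    by apply: Rmult_le_compat_l => //; nra.
  apply: (Rle_trans _ (80 * (32 * 2 ^ 40 * H))); first lra.
  have : 0 < 2 ^ 40 by apply: pow_lt; lra.
  by move: Hn; set a := Rpower _ _; move: (2 ^ 40) => b; nra.
have pos2 : 0 < INR y ^ 2 by apply: pow_lt.
have K_gt0 : 0 < 2560 * 2 ^ 40 by apply: Rmult_lt_0_compat; [lra | apply: pow_lt; lra].
have := @Rle_Rpower_l (INR y ^ 2 * ln (INR n)) _ (3 / 2) _ (conj _ key).
rewrite -(Rpower_mult_distr (INR y ^ 2)) //.
rewrite -(Rpower_mult_distr (2560 * 2 ^ 40)) //; last exact: exp_pos.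
rewrite Rpower_sqr_three_halves // Rpower_mult (_ : 1 / 2 * (3 / 2) = 3 / 4); last lra.
move=> h; rewrite INR_expn.
have L_gt0 : 0 < Rpower (ln (INR n)) (3 / 2) by exact: exp_pos.
apply: (Rmult_le_reg_r _ _ _ L_gt0).
rewrite [X in _ <= X](_ : _ = Rpower (2560 * 2 ^ 40) (3 / 2) * Rpower (INR n) (3 / 4)).
  by apply: h; [lra | apply: Rmult_lt_0_compat].
by field; apply: Rgt_not_eq.
Qed.

Lemma sidon_upper_bound : exists C : R, 0 < C /\
  exists N : nat, forall n : nat, (N <= n)%N ->
    INR (Defs.S n) <= INR (T n) * Rpower 2 (C *
       (Rpower (INR n) (3 / 4) / Rpower (ln (INR n)) (3 / 2))).
Proof.
(* 1792 from [sum_bits] and 1 for the term bounded in [error_le]. *)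
exists (1793 * Rpower (2560 * 2 ^ 40) (3 / 2)); split.
  by apply: Rmult_lt_0_compat; [lra | exact: exp_pos].
have [g0 err] := error_le; have [N hN] := log_scale g0.+1.
exists N => n /hN[g [ltg hi lo]].
have g_gt1 : (1 < g)%N by apply: leq_trans ltg.
have [y [ylo yhi]] := scale_y (ltnW g_gt1).
have e := err g y (ltnW (ltnW ltg)) ylo.
have := card_sidon_le g_gt1 hi ylo yhi.
have mt := main_term_le g_gt1 hi lo ylo yhi.
move=> /INR_leq; rewrite INR_muln => h; apply: Rle_trans h _.
apply: Rmult_le_compat_l; first exact: pos_INR.
apply: (Rle_trans _ (INR (2 ^ (1793 * y ^ 3)))).
  apply: INR_leq; rewrite leq_exp2l //; move: e; move: (y ^ 3)%N (_ * _)%N; clear => a b; lia.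
rewrite INR_expn -[INR 2]/2 -Rpower_pow; last lra.
apply: Rle_Rpower; first lra.
rewrite INR_muln (_ : INR 1793 = 1793); last by rewrite INR_IZR_INZ.
rewrite Rmult_assoc; apply: Rmult_le_compat_l; [lra | exact: mt].
Qed.

(** * Explicit Chebyshev estimates *)

Lemma ln_le_sub1 x : 0 < x -> ln x <= x - 1.
Proof. by move=> x_gt0; have := exp_ineq1_le (ln x); rewrite exp_ln //; lra. Qed.

Lemma ln_fact_bounds k : (0 < k)%N ->
  INR k * ln (INR k) - INR k <= ln (INR k`!) <= INR k * ln (INR k) - INR k + ln (INR k) + 1.
Proof.
case: k => // k _; elim: k => [|k IH]; first by rewrite /= ln_1; lra.
set x := INR k.+1 in IH *.
have x_gt0 : 0 < x by apply: lt_0_INR; apply/ltP.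
have Ex : INR k.+2 = x + 1 by rewrite S_INR.
have f_gt0 : 0 < INR (k.+1)`! by apply: lt_0_INR; apply/ltP; exact: fact_gt0.
rewrite factS INR_muln Ex ln_mult //; last lra.
have h1 : ln (x + 1) - ln x <= / x.
  have -> : ln (x + 1) = ln x + ln ((x + 1) / x).
    rewrite -ln_mult //; last by apply: Rdiv_lt_0_compat; lra.
    by congr ln; field; lra.
  have := @ln_le_sub1 ((x + 1) / x); rewrite (_ : (x + 1) / x - 1 = / x); last by field; lra.
  have : 0 < (x + 1) / x by apply: Rdiv_lt_0_compat; lra.
  by move=> a b; have := b a; lra.
have h2 : / (x + 1) <= ln (x + 1) - ln x.
  have -> : ln x = ln (x + 1) + ln (x / (x + 1)).
    rewrite -ln_mult //; [|lra|by apply: Rdiv_lt_0_compat; lra].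
    by congr ln; field; lra.
  have := @ln_le_sub1 (x / (x + 1)); rewrite (_ : x / (x + 1) - 1 = - / (x + 1)); last by field; lra.
  have : 0 < x / (x + 1) by apply: Rdiv_lt_0_compat; lra.
  by move=> a b; have := b a; lra.
have h1' : x * (ln (x + 1) - ln x) <= 1.
  have : x * (ln (x + 1) - ln x) <= x * / x by apply: Rmult_le_compat_l; lra.
  by rewrite Rinv_r; lra.
have h2' : 1 <= (x + 1) * (ln (x + 1) - ln x).
  have : (x + 1) * / (x + 1) <= (x + 1) * (ln (x + 1) - ln x).
    by apply: Rmult_le_compat_l; lra.
  by rewrite Rinv_r; lra.
by lra.
Qed.

Lemma exp1_le : exp 1 <= 277 / 100.
Proof.
have h : exp (1 / 32) <= 32 / 31.
  have := exp_ineq1_le (- (1 / 32)); rewrite exp_Ropp => h.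
  have e_gt0 := exp_pos (1 / 32).
  have : exp (1 / 32) * (1 + - (1 / 32)) <= 1.
    by move: h; have := Rinv_r (exp (1 / 32)); nra.
  by lra.
have e x : exp (x + x) = exp x * exp x by rewrite exp_plus.
have sq x b c : exp x <= b -> b * b <= c -> exp (x + x) <= c.
  move=> h1 h2; rewrite e; apply: Rle_trans h2; have := exp_pos x => h3.
  by apply: Rmult_le_compat; lra.
have h2 := sq _ _ (10656 / 10000) h ltac:(lra).
have h3 := sq _ _ (11356 / 10000) h2 ltac:(lra).
have h4 := sq _ _ (12897 / 10000) h3 ltac:(lra).
have h5 := sq _ _ (16634 / 10000) h4 ltac:(lra).
have h6 := sq _ _ (277 / 100) h5 ltac:(lra).
by move: h6; congr (exp _ <= _); lra.
Qed.

(** 2^14 3^9 5^5 is 30^30 / (15^15 10^10 6^6), the growth rate of the factorial quotient. Rounding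
    its logarithm to 27 keeps 0.9 of Chebyshev's constant 0.921. *)
Lemma chebyshev_constant : 27 <= 14 * ln 2 + 9 * ln 3 + 5 * ln 5.
Proof.
have cube x b c : exp x <= b -> b * b * b <= c -> exp (x + x + x) <= c.
  move=> h1 h2; rewrite !exp_plus; apply: Rle_trans h2; have := exp_pos x => h3.
  have : exp x * exp x <= b * b by apply: Rmult_le_compat; lra.
  by move=> h4; apply: Rmult_le_compat; nra.
have h1 := cube _ _ (2126 / 100) exp1_le ltac:(lra).
have h2 := cube _ _ 9610 h1 ltac:(lra).
have h3 := cube _ _ (2 ^ 14 * 3 ^ 9 * 5 ^ 5) h2 ltac:(lra).
have -> : 27 = ln (exp 27) by rewrite ln_exp.
have p x : 0 < x -> forall k, 0 < x ^ k by move=> *; exact: pow_lt.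
have -> : 14 * ln 2 + 9 * ln 3 + 5 * ln 5 = ln (2 ^ 14 * 3 ^ 9 * 5 ^ 5).
  have e k x : 0 < x -> INR k * ln x = ln (x ^ k) by move=> ?; rewrite ln_pow.
  rewrite ln_mult; [|apply: Rmult_lt_0_compat; apply: p; lra|apply: p; lra].
  rewrite ln_mult; [|apply: p; lra|apply: p; lra].
  by rewrite -!e; try lra; rewrite !INR_IZR_INZ.
apply: Rcomplements.ln_le; first exact: exp_pos.
by move: h3; congr (exp _ <= _); lra.
Qed.

(** The terms n ln n and n of Stirling's formula cancel, as 30 + 1 = 15 + 10 + 6. The error terms
    come from the three upper bounds. *)
Lemma ln_psi_lower n : (0 < n)%N ->
  27 * INR n - 3 * ln (15 * INR n) - 3 <= ln (INR (psi_prod (30 * n))).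
Proof.
move=> n_gt0; have N_gt0 : 0 < INR n by apply: lt_0_INR; apply/ltP.
have fp k : 0 < INR k`! by apply: lt_0_INR; apply/ltP; exact: fact_gt0.
have pp : 0 < INR (psi_prod (30 * n)) by apply: lt_0_INR; apply/ltP; exact: psi_prod_gt0.
have H : ln (INR (30 * n)`!) + ln (INR n`!) <= ln (INR (15 * n)`!) +
    ln (INR (10 * n)`!) + ln (INR (6 * n)`!) + ln (INR (psi_prod (30 * n))).
  have pm := Rmult_lt_0_compat.
  have pm3 : 0 < INR (15 * n)`! * INR (10 * n)`! * INR (6 * n)`!.
    by apply: (pm _ _ (pm _ _ (fp _) (fp _)) (fp _)).
  rewrite -!ln_mult; try solve [exact: fp | exact: pp | exact: pm3 | exact: (pm _ _ (fp _) (fp _))].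
  apply: Rcomplements.ln_le; first exact: (pm _ _ (fp _) (fp _)).
  by rewrite -!INR_muln; apply: INR_leq; exact: fact_ratio.
have cpos c : (0 < c)%N -> (0 < c * n)%N by move=> c_gt0; rewrite muln_gt0 c_gt0.
have [b30 _] := ln_fact_bounds (cpos 30%N isT).
have [b1 _] := ln_fact_bounds n_gt0.
have [_ b15] := ln_fact_bounds (cpos 15%N isT).
have [_ b10] := ln_fact_bounds (cpos 10%N isT).
have [_ b6] := ln_fact_bounds (cpos 6%N isT).
have I c : INR (c * n) = IZR (Z.of_nat c) * INR n by rewrite INR_muln INR_IZR_INZ.
rewrite !I /= in b30 b15 b10 b6 *.
have e30 : ln (30 * INR n) = ln 2 + ln 3 + ln 5 + ln (INR n).
  by rewrite -!ln_mult; try lra; congr ln; lra.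
have e15 : ln (15 * INR n) = ln 3 + ln 5 + ln (INR n).
  by rewrite -!ln_mult; try lra; congr ln; lra.
have e10 : ln (10 * INR n) = ln 2 + ln 5 + ln (INR n).
  by rewrite -!ln_mult; try lra; congr ln; lra.
have e6 : ln (6 * INR n) = ln 2 + ln 3 + ln (INR n).
  by rewrite -!ln_mult; try lra; congr ln; lra.
rewrite e30 in b30; rewrite e15 in b15 *; rewrite e10 in b10; rewrite e6 in b6.
have l2 : 0 < ln 2 by rewrite -ln_1; apply: ln_increasing; lra.
have l3 : ln 2 <= ln 3 by apply: Rcomplements.ln_le; lra.
have l5 : ln 3 <= ln 5 by apply: Rcomplements.ln_le; lra.
have := Rmult_le_compat_l _ _ _ (Rlt_le _ _ N_gt0) chebyshev_constant.
lra.
Qed.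

Lemma ln_sublinear eps : 0 < eps -> exists Y, 0 < Y /\ forall x, Y <= x -> ln x <= eps * x.
Proof.
move=> eps_gt0; have t_gt0 : 0 < 2 / eps by apply: Rdiv_lt_0_compat; lra.
exists ((2 / eps) ^ 2); split=> [|x leYx]; first exact: pow_lt.
have x_gt0 : 0 < x by apply: Rlt_le_trans leYx; exact: pow_lt.
have s_gt0 := sqrt_lt_R0 _ x_gt0; have ss := sqrt_sqrt x (Rlt_le _ _ x_gt0).
have les : 2 / eps <= sqrt x.
  rewrite -(sqrt_pow2 (2 / eps)); last lra.
  by apply: sqrt_le_1_alt.
have -> : ln x = 2 * ln (sqrt x).
  by rewrite -{1}ss ln_mult //; lra.
have h := ln_le_sub1 s_gt0.
have : eps * (2 / eps) = 2 by field; lra.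
have := Rmult_le_compat_l eps _ _ (Rlt_le _ _ eps_gt0) les.
by nra.
Qed.

Lemma sqrt_ln_sublinear eps : 0 < eps ->
  exists Y, 0 < Y /\ forall x, Y <= x -> sqrt x * ln x <= eps * x.
Proof.
move=> eps_gt0; have [Y [Y_gt0 hY]] := @ln_sublinear (eps / 2) ltac:(lra).
exists (Y ^ 2); split=> [|x leYx]; first exact: pow_lt.
have x_gt0 : 0 < x by apply: Rlt_le_trans leYx; exact: pow_lt.
have s_gt0 := sqrt_lt_R0 _ x_gt0; have ss := sqrt_sqrt x (Rlt_le _ _ x_gt0).
have les : Y <= sqrt x.
  rewrite -(sqrt_pow2 Y); last lra.
  by apply: sqrt_le_1_alt.
have h := hY _ les; rewrite -{2 3}ss ln_mult //.
by nra.
Qed.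

Lemma INR_large Y : exists N : nat, forall n, (N <= n)%N -> Y <= INR n.
Proof.
have [N hN] := INR_unbounded Y; exists N => n /INR_leq; lra.
Qed.

(** The constant 0.88 has to exceed 0.85, half of the factor 1.7 in the choice of [M]. *)
Lemma prime_pi_lower : exists N : nat, forall y, (N <= y)%N ->
  88 / 100 * INR y <= INR (prime_pi y) * ln (INR y).
Proof.
have [Y [_ hY]] := @ln_sublinear (1 / 300) ltac:(lra).
have [N1 hN1] := INR_large Y; have [N2 hN2] := INR_large 3000.
exists (maxn 30 (maxn N1 N2)) => y; rewrite !geq_max => /and3P[le30 le1 le2].
have ly := hY _ (hN1 _ le1); have y3 := hN2 _ le2.
set n := (y %/ 30)%N; have n_gt0 : (0 < n)%N by rewrite divn_gt0.
have hn : (30 * n <= y)%N by rewrite mulnC leq_divM.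
have hn' : INR y <= 30 * INR n + 30.
  have : (y <= 30 * n + 30)%N by rewrite mulnC -mulSnr ltnW // ltn_ceil.
  by move/INR_leq; rewrite plus_INR INR_muln (_ : INR 30 = 30) // INR_IZR_INZ.
have N_gt0 : 0 < INR n by apply: lt_0_INR; apply/ltP.
have y_gt0 : 0 < INR y by lra.
have h30 : 30 * INR n <= INR y.
  by move/INR_leq: hn; rewrite INR_muln (_ : INR 30 = 30) // INR_IZR_INZ.
have l15 : ln (15 * INR n) <= ln (INR y) by apply: Rcomplements.ln_le; lra.
have lo := ln_psi_lower n_gt0.
have up : ln (INR (psi_prod (30 * n))) <= INR (prime_pi y) * ln (INR y).
  rewrite -ln_pow // -INR_expn; apply: Rcomplements.ln_le.
    by apply: lt_0_INR; apply/ltP; exact: psi_prod_gt0.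
  apply: INR_leq; apply: leq_trans (psi_prod_le_pi _) _.
  apply: (@leq_trans (y ^ prime_pi (30 * n))); first exact: leq_exp_base.
  rewrite leq_pexp2l //; first by apply: leq_trans le30.
  by rewrite /prime_pi -(subnKC hn) iotaD count_cat leq_addr.
lra.
Qed.

Lemma ln4_lt : ln 4 < 17 / 10.
Proof.
have -> : 4 = (sqrt 2) ^ 4.
  by rewrite (_ : sqrt 2 ^ 4 = (sqrt 2 * sqrt 2) * (sqrt 2 * sqrt 2)); [rewrite sqrt_sqrt; lra | ring].
have s_gt0 := sqrt_lt_R0 2 ltac:(lra).
rewrite ln_pow //; have := ln_le_sub1 s_gt0.
have : sqrt 2 < 142 / 100.
  rewrite -(sqrt_pow2 (142 / 100)); last lra.
  by apply: sqrt_lt_1_alt; lra.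
by rewrite (_ : INR 4 = 4); [lra | rewrite INR_IZR_INZ].
Qed.

(** Without such a prime psi(2 z) would be at most z ln 4 + o(z) < 1.8 z, against the lower bound
    0.9 * 2 z up to o(z). The central binomial coefficient would give only z ln 4 as lower bound and
    decide nothing, hence the finer factorial quotient. *)
Lemma prime_between : exists N : nat, forall z, (N <= z)%N ->
  exists p, [/\ prime p, (z < p)%N & (p <= 2 * z)%N].
Proof.
have [Y1 [_ hY1]] := @ln_sublinear (1 / 1000) ltac:(lra).
have [Y2 [_ hY2]] := @sqrt_ln_sublinear (1 / 100) ltac:(lra).
have [N1 hN1] := INR_large Y1; have [N2 hN2] := INR_large Y2.
have [N3 hN3] := INR_large 3000.
exists (maxn 30 (maxn N1 (maxn N2 N3))) => z.
rewrite !geq_max => /and4P[le30 le1 le2 le3].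
case: (boolP (has prime (iota z.+1 z))) => [/hasP[p]|/hasPn gap].
  rewrite mem_iota => /andP[lt le] pp; exists p; split => //.
  by rewrite mul2n -addnn -ltnS.
exfalso; set n := ((2 * z) %/ 30)%N.
have n_gt0 : (0 < n)%N by rewrite divn_gt0 // mul2n -addnn (leq_trans le30) // leq_addr.
have hn : (30 * n <= 2 * z)%N by rewrite mulnC leq_divM.
set N := (30 * n)%N in hn *.
have N_gt0 : (0 < N)%N by rewrite muln_gt0.
set r := Nat.sqrt N.
have [r1 r2] : (r ^ 2 <= N)%N /\ (N < r.+1 ^ 2)%N.
  by have := Nat.sqrt_specif N; rewrite -/r -!mulnn; lia.
have up : (psi_prod N <= (2 * z) ^ r * 4 ^ z)%N.
  have [leNz|ltzN] := leqP N z.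
    apply: leq_trans (@psi_prod_gap N N r _ _ _ _) _ => //.
      by move=> p _ a b; have := leq_trans a b; rewrite ltnn.
    by apply: leq_mul; [exact: leq_exp_base | rewrite leq_exp2l].
  apply: leq_trans (@psi_prod_gap N z r _ _ _ _) _ => //; first exact: ltnW.
    move=> p pp ltp leN; have := gap p; rewrite mem_iota pp ltp /= => /(_ _)/negP; apply => //.
    by rewrite addSn ltnS addnn -mul2n (leq_trans leN).
  by rewrite leq_mul2r leq_exp_base ?orbT.
have lo := ln_psi_lower n_gt0; rewrite -/N in lo.
have z_gt0 : 0 < INR z by have := hN3 _ le3; lra.
have Ez : INR (2 * z) = 2 * INR z by rewrite INR_muln.
have h30 : 30 * INR n <= 2 * INR z.
  by rewrite -Ez (_ : 30 = INR 30); [rewrite -INR_muln; exact: INR_leq | rewrite INR_IZR_INZ].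
have h30' : 2 * INR z <= 30 * INR n + 30.
  have : (2 * z <= 30 * n + 30)%N by rewrite [X in (_ <= X + _)%N]mulnC -mulSnr ltnW // ltn_ceil.
  by move/INR_leq; rewrite (plus_INR (30 * n)%N) Ez INR_muln (_ : INR 30 = 30) // INR_IZR_INZ.
have N0 : 0 < INR n by apply: lt_0_INR; apply/ltP.
have l15 : ln (15 * INR n) <= ln (2 * INR z) by apply: Rcomplements.ln_le; lra.
have l1 : ln (2 * INR z) <= 1 / 1000 * (2 * INR z) by apply: hY1; have := hN1 _ le1; lra.
have l2 : sqrt (2 * INR z) * ln (2 * INR z) <= 1 / 100 * (2 * INR z).
  by apply: hY2; have := hN2 _ le2; lra.
have lpos : 0 < ln (2 * INR z).
  by rewrite -ln_1; apply: ln_increasing; [lra | have := hN3 _ le3; lra].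
have rs : INR r <= sqrt (2 * INR z).
  rewrite -(sqrt_pow2 (INR r)); last exact: pos_INR.
  apply: sqrt_le_1_alt; rewrite -Ez -INR_expn; apply: INR_leq; exact: leq_trans hn.
have := INR_leq up; rewrite INR_muln !INR_expn Ez => /Rcomplements.ln_le.
have pz : 0 < 2 * INR z by lra.
rewrite (_ : INR 4 = 4); last by rewrite INR_IZR_INZ.
rewrite ln_mult; [|exact: pow_lt|apply: pow_lt; lra].
rewrite !ln_pow //; last lra.
have pp : 0 < INR (psi_prod N) by apply: lt_0_INR; apply/ltP; exact: psi_prod_gt0.
move=> /(_ pp) h.
have rl : INR r * ln (2 * INR z) <= sqrt (2 * INR z) * ln (2 * INR z).
  by apply: Rmult_le_compat_r; lra.
have z4 := Rmult_lt_compat_l _ _ _ z_gt0 ln4_lt.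
have := hN3 _ le3; lra.
Qed.


Lemma ln2_ge : 65 / 100 <= ln 2.
Proof.
have h : exp (65 / 1600) <= 10424 / 10000.
  have := exp_ineq1_le (- (65 / 1600)); rewrite exp_Ropp => h.
  have := exp_pos (65 / 1600); move: h; have := Rinv_r (exp (65 / 1600)); nra.
have sq x b c : exp x <= b -> b * b <= c -> exp (x + x) <= c.
  move=> h1 h2; rewrite exp_plus; apply: Rle_trans h2; have := exp_pos x => h3.
  by apply: Rmult_le_compat; lra.
have h2 := sq _ _ (10867 / 10000) h ltac:(lra).
have h3 := sq _ _ (11810 / 10000) h2 ltac:(lra).
have h4 := sq _ _ (13949 / 10000) h3 ltac:(lra).
have h5 := sq _ _ 2 h4 ltac:(lra).
rewrite -(ln_exp (65 / 100)); apply: Rcomplements.ln_le; first exact: exp_pos.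
by move: h5; congr (exp _ <= _); lra.
Qed.

(** This is ln (4 / K) <= 4 / K - 1 with ln 4 >= 13 / 10. It is nearly sharp around K = 4, close to
    the best value of q^2 / M. *)
Lemma ln_ge_tangent K : 0 < K -> 23 / 10 - 4 / K <= ln K.
Proof.
move=> K_gt0; have p : 0 < 4 / K by apply: Rdiv_lt_0_compat; lra.
have h := ln_le_sub1 p; have l2 := ln2_ge.
have : ln (4 / K) = 2 * ln 2 - ln K.
  by rewrite Rcomplements.ln_div //; [rewrite (_ : 4 = 2 * 2) ?ln_mult; lra | lra].
lra.
Qed.

Lemma INR_divn a b : (0 < b)%N -> INR a / INR b - 1 <= INR (a %/ b).
Proof.
move=> b_gt0; have B : 0 < INR b by apply: lt_0_INR; apply/ltP.
have /INR_leq : (a <= (a %/ b) * b + b)%N by rewrite -mulSnr ltnW // ltn_ceil.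
rewrite plus_INR INR_muln => h.
apply: (Rmult_le_reg_r (INR b)) => //.
by rewrite Rmult_minus_distr_r /Rdiv Rmult_assoc Rinv_l; lra.
Qed.

Lemma INR_subn a b : INR a - INR b <= INR (a - b).
Proof.
have /INR_leq : (a <= (a - b) + b)%N by lia.
by rewrite plus_INR; lra.
Qed.

Lemma ln_succ_le x : 0 < x -> ln (x + 1) - ln x <= / x.
Proof.
move=> x_gt0; have p : 0 < (x + 1) / x by apply: Rdiv_lt_0_compat; lra.
have := ln_le_sub1 p; rewrite Rcomplements.ln_div; try lra.
by rewrite (_ : (x + 1) / x - 1 = / x) //; field; lra.
Qed.

(** Up to a = M^2 / N the minimum is N and sums to about M^2; beyond, it is M^2 / a and sums to
    about M^2 ln (N / M). Subtracting a costs M^2 / 2. Rounding errors are of order M + N. *)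
Lemma hyperbola_sum_ge (N M : nat) : (0 < M)%N -> (M <= N)%N -> (N <= 13 * M)%N ->
  INR M ^ 2 * (1 / 2 + ln (INR N / INR M)) - 30 * INR M <=
  INR (\sum_(1 <= a < M.+1) (minn N (M ^ 2 %/ a) - a)).
Proof.
move=> M_gt0 leMN leN; have N_gt0 : (0 < N)%N by apply: leq_trans leMN.
have Mp : 0 < INR M by apply: lt_0_INR; apply/ltP.
have Np : 0 < INR N by apply: lt_0_INR; apply/ltP.
have N13 : INR N <= 13 * INR M.
  by rewrite (_ : 13 = INR 13); [rewrite -INR_muln; exact: INR_leq | rewrite INR_IZR_INZ].
set J := (M ^ 2 %/ N)%N.
have leJM : (J <= M)%N.
  by rewrite -(mulKn M M_gt0) mulnn; apply: leq_div2l.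
pose F m := INR (\sum_(1 <= a < m.+1) (minn N (M ^ 2 %/ a) - a)).
have FS m : F m.+1 = F m + INR (minn N (M ^ 2 %/ m.+1) - m.+1).
  by rewrite /F big_nat_recr //= plus_INR.
have low m : (m <= J)%N -> INR m * INR N - INR m * (INR m + 1) / 2 <= F m.
  elim: m => [|m IH] lem; first by rewrite /F big_geq //=; lra.
  rewrite FS (minn_idPl _); last first.
    by rewrite leq_divRL // mulnC -leq_divRL.
  have := IH (ltnW lem); have := INR_subn N m.+1; rewrite S_INR; nra.
have high m : (J <= m)%N -> (m <= M)%N ->
    INR J * INR N + INR M ^ 2 * (ln (INR m + 1) - ln (INR J + 1)) - (INR m - INR J)
      - INR m * (INR m + 1) / 2 <= F m.
  elim: m => [|m IH]; rewrite leq_eqVlt => /orP[/eqP <-|].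
  - by move=> _; have := low J (leqnn J); lra.
  - by [].
  - by move=> _; have := low J (leqnn J); lra.
  rewrite ltnS => leJ ltm; have := IH leJ (ltnW ltm).
  rewrite FS (minn_idPr _); last first.
    by apply: ltnW; rewrite ltn_divLR // mulnC -ltn_divLR // ltnS.
  have h1 := INR_subn (M ^ 2 %/ m.+1) m.+1.
  have h2 := @INR_divn (M ^ 2) m.+1 isT.
  have mp : 0 < INR m + 1 by have := pos_INR m; lra.
  have h3 := ln_succ_le mp.
  rewrite S_INR INR_expn in h1 h2 *.
  have h4 : INR M ^ 2 * (ln (INR m + 1 + 1) - ln (INR m + 1)) <= INR M ^ 2 / (INR m + 1).
    by apply: Rmult_le_compat_l => //; apply: Rlt_le; apply: pow_lt.
  by lra.
have := high M leJM (leqnn M); rewrite -/(F M).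
have Jn : INR M ^ 2 - INR N <= INR J * INR N.
  have := @INR_divn (M ^ 2) N N_gt0; rewrite -/J INR_expn => h.
  have := Rmult_le_compat_r _ _ _ (Rlt_le _ _ Np) h.
  by rewrite Rmult_minus_distr_r /Rdiv Rmult_assoc Rinv_l; lra.
have J0 := pos_INR J.
have JN : INR J * INR N <= INR M ^ 2.
  by rewrite -INR_expn -INR_muln; apply: INR_leq; exact: leq_divM.
have key : ln (INR N / INR M) - INR N / INR M ^ 2 <= ln (INR M + 1) - ln (INR J + 1).
  have M2 : 0 < INR M ^ 2 by apply: pow_lt.
  have q0 : 0 < INR N / INR M ^ 2 by apply: Rdiv_lt_0_compat.
  have : ln (1 + INR N / INR M ^ 2) <= INR N / INR M ^ 2.
    by have := @ln_le_sub1 (1 + INR N / INR M ^ 2); lra.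
  have p1 : 0 < 1 + INR N / INR M ^ 2 by lra.
  suff : ln (INR N / INR M) + ln (INR J + 1) <= ln (INR M + 1) + ln (1 + INR N / INR M ^ 2) by lra.
  have q1 : 0 < INR N / INR M by apply: Rdiv_lt_0_compat.
  rewrite -!ln_mult; try lra.
  apply: Rcomplements.ln_le; first by apply: Rmult_lt_0_compat; lra.
  apply: (Rmult_le_reg_r (INR M ^ 2)) => //.
  have -> : INR N / INR M * (INR J + 1) * INR M ^ 2 = INR M * (INR J * INR N + INR N).
    by field; lra.
  have -> : (INR M + 1) * (1 + INR N / INR M ^ 2) * INR M ^ 2 = (INR M + 1) * (INR M ^ 2 + INR N).
    by field; lra.
  by nra.
have M2 : 0 <= INR M ^ 2 by apply: Rlt_le; apply: pow_lt.
have := Rmult_le_compat_l _ _ _ M2 key.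
have -> : INR M ^ 2 * (ln (INR N / INR M) - INR N / INR M ^ 2)
   = INR M ^ 2 * ln (INR N / INR M) - INR N by field; lra.
by move=> a b; lra.
Qed.


(** * The size of the j-th prime *)

Section PrimeIndex.
Variables (n M : nat).
Let x := sqrt (INR n).
Let L := ln (INR n).
Hypotheses (L_big : 1000 <= L) (M_ge : 13 <= INR M) (M_le : INR M * L <= 17 / 10 * x)
  (x_big : 2197 <= x)
  (cheb : forall y : nat, x / 13 - 1 <= INR y ->
     88 / 100 * INR y <= INR (prime_pi y) * ln (INR y)).

Let xx : x * x = INR n. Proof. by rewrite /x sqrt_sqrt //; exact: pos_INR. Qed.

Let Lx : L = 2 * ln x.
Proof. by rewrite /L -xx ln_mult; lra. Qed.

(** For y = floor(x c / M), ln y is at most L / 2 + 12, so there are nearly 1.76 y / L primes up to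
    y, whereas c is about M y / x, which is at most about 1.7 y / L. *)
Lemma prime_index c : INR M / 13 <= c -> c <= 13 * INR M ->
  exists y : nat, [/\ (y <= n)%N, INR y <= x * c / INR M & c <= INR (prime_pi y)].
Proof.
move=> c_lo c_hi; have M0 : 0 < INR M by lra.
have c1 : 1 <= c by lra.
set r := c / INR M; have Er : x * c / INR M = x * r by rewrite /r; field; lra.
have r_lo : / 13 <= r.
  by apply: (Rmult_le_reg_r (INR M)) => //; rewrite /r /Rdiv Rmult_assoc Rinv_l; lra.
have r_hi : r <= 13.
  by apply: (Rmult_le_reg_r (INR M)) => //; rewrite /r /Rdiv Rmult_assoc Rinv_l; lra.
have xr0 : 0 <= x * r by apply: Rmult_le_pos; lra.
have [y [y1 y2]] := Rcomplements.nfloor_ex _ xr0.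
have xr13 : x / 13 <= x * r by apply: Rmult_le_compat_l; lra.
have xr_hi : x * r <= 13 * x by rewrite Rmult_comm; apply: Rmult_le_compat_r; lra.
have ylo : x / 13 - 1 <= INR y by lra.
have y0 : 0 < INR y by lra.
exists y; split; last 1 first.
- have ch := cheb ylo.
  have lny : ln (INR y) <= 12 + L / 2.
    apply: (Rle_trans _ (ln (13 * x))); first by apply: Rcomplements.ln_le; lra.
    by rewrite Lx ln_mult; try lra; have := @ln_le_sub1 13 ltac:(lra); lra.
  have lny0 : 0 <= ln (INR y).
    by rewrite -ln_1; apply: Rcomplements.ln_le; lra.
  have h : 88 / 100 * (x * r - 1) <= INR (prime_pi y) * (12 + L / 2).
    apply: (Rle_trans _ (INR (prime_pi y) * ln (INR y))); first lra.
    by apply: Rmult_le_compat_l => //; exact: pos_INR.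
  have cL : c * L <= 17 / 10 * (x * r).
    have -> : c = INR M * r by rewrite /r; field; lra.
    by have := Rmult_le_compat_r r _ _ ltac:(lra) M_le; lra.
  apply: (Rmult_le_reg_r (12 + L / 2)); first lra.
  apply: Rle_trans h; have := Rmult_le_compat_l c _ _ ltac:(lra) L_big; lra.
- apply/leP/INR_le; rewrite -xx.
  by apply: (Rle_trans _ (13 * x)); [lra | apply: Rmult_le_compat_r; lra].
- by rewrite Er.
Qed.

Lemma nthprime_le_real j c : INR M / 13 <= c -> c <= 13 * INR M -> INR j.+1 <= c ->
  INR (nthprime n j) <= x * c / INR M.
Proof.
move=> c_lo c_hi jc; have [y [yn yx pc]] := prime_index c_lo c_hi.
have lt : (j < prime_pi y)%N by apply/leP/INR_le; lra.
have [_ /INR_leq le] := nthprimeP yn lt; lra.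
Qed.

Lemma prime_pi_mono a b : (a <= b)%N -> (prime_pi a <= prime_pi b)%N.
Proof. by move=> le; rewrite /prime_pi -(subnKC le) iotaD count_cat leq_addr. Qed.

Lemma nthprime_many N : INR M / 13 <= INR N -> INR N <= 13 * INR M -> (N <= prime_pi n)%N.
Proof.
move=> h1 h2; have [y [yn _ pc]] := prime_index h1 h2.
apply: leq_trans (prime_pi_mono yn); exact/leP/INR_le.
Qed.

Lemma nthprime_not_big N j : INR N <= 13 * INR M -> INR M / 13 <= INR N -> (j < N)%N ->
  ~~ big_prime n (nthprime n j).
Proof.
move=> N_hi N_lo /INR_leq jN; rewrite /big_prime negb_and -leqNgt; apply/orP; right.
have h := nthprime_le_real N_lo N_hi jN.
have h13 : x * INR N / INR M <= 13 * x.
  apply: (Rmult_le_reg_r (INR M)); first lra.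
  by rewrite /Rdiv Rmult_assoc Rinv_l; [nra | lra].
apply/leP/INR_le; rewrite !INR_expn.
apply: (Rle_trans _ ((13 * x) ^ 3)).
  by apply: pow_incr; split; [exact: pos_INR | lra].
(* The bound 13 x stays below n^(2/3) = x^(4/3) as soon as x >= 13^3 = 2197. *)
rewrite -xx (_ : (13 * x) ^ 3 = 2197 * x ^ 3); last by ring.
rewrite (_ : (x * x) ^ 2 = x * x ^ 3); last by ring.
by apply: Rmult_le_compat_r => //; apply: pow_le; lra.
Qed.

Lemma nthprime_product N i j : INR M <= INR N -> INR N <= 13 * INR M ->
  (i < j)%N -> (j < N)%N -> (i.+1 * j.+1 <= M ^ 2)%N ->
  (nthprime n i * nthprime n j <= n)%N.
Proof.
move=> N_lo N_hi ltij /INR_leq jN /INR_leq; rewrite INR_muln INR_expn => ijM.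
have ij : INR i.+1 <= INR j.+1 by apply: INR_leq; rewrite ltnS ltnW.
have i1 : 1 <= INR i.+1 by rewrite -[1]/(INR 1); exact: INR_leq.
have M0 : 0 < INR M by lra.
(* The estimate for primes is available only from index M / 13 on. Raising a smaller index to M / 13
   is harmless, because the other one is at most 13 M. *)
pose c a := Rmax (INR M / 13) a.
have cP k : (INR k.+1 <= 13 * INR M) -> INR (nthprime n k) <= x * c (INR k.+1) / INR M.
  move=> hk; apply: nthprime_le_real; first exact: Rmax_l.
    by apply: Rmax_lub; lra.
  exact: Rmax_r.
have hi := cP i ltac:(lra); have hj := cP j ltac:(lra).
have cc : c (INR i.+1) * c (INR j.+1) <= INR M ^ 2.
  rewrite /c; case: (Rle_dec (INR M / 13) (INR i.+1)) => h1.
    by rewrite !Rmax_right; lra.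
  rewrite (Rmax_left _ (INR i.+1)); last lra.
  by case: (Rle_dec (INR M / 13) (INR j.+1)) => h2; [rewrite Rmax_right | rewrite Rmax_left]; nra.
apply/leP/INR_le; rewrite INR_muln -xx.
apply: (Rle_trans _ ((x * c (INR i.+1) / INR M) * (x * c (INR j.+1) / INR M))).
  by apply: Rmult_le_compat => //; exact: pos_INR.
have -> : x * c (INR i.+1) / INR M * (x * c (INR j.+1) / INR M) =
    x * x * ((c (INR i.+1) * c (INR j.+1)) / INR M ^ 2) by field; lra.
rewrite -[X in _ <= X](Rmult_1_r (x * x)); apply: Rmult_le_compat_l; first nra.
have M2 : 0 < INR M ^ 2 by apply: pow_lt.
apply: (Rmult_le_reg_r (INR M ^ 2)) => //.
by rewrite /Rdiv Rmult_assoc Rinv_l; lra.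
Qed.
End PrimeIndex.

(** For k = q / sqrt M this is (2.8 - 4 / k^2) / k >= 0.7, where [ln_ge_tangent] bounds 1/2 + ln k^2
    by the bracket. *)
Lemma cubic_ge k : 173 / 100 <= k -> k <= 348 / 100 ->
  7 / 10 * k ^ 3 <= 28 / 10 * k ^ 2 - 4.
Proof.
move=> h1 h2; have h : 0 <= (k - 173 / 100) * (348 / 100 - k) by apply: Rmult_le_pos; lra.
have h3 : 0 <= k * ((k - 173 / 100) * (348 / 100 - k)) by apply: Rmult_le_pos; lra.
nra.
Qed.

(** Division by q turns M^2 into sqrt M ^3 / k. [cubic_ge] gives the constant 0.7, and the error 30
    M costs at most 0.01 for M >= 20000. *)
Lemma edge_count_ge (n M q e : nat) : 20000 <= INR M ->
  173 / 100 * sqrt (INR M) <= INR q -> INR q <= 348 / 100 * sqrt (INR M) ->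
  INR M ^ 2 * (1 / 2 + ln (INR (q * q) / INR M)) - 30 * INR M <= INR q * INR e ->
  69 / 100 * sqrt (INR M) ^ 3 <= INR e.
Proof.
move=> M_big; set mu := sqrt (INR M) => q_lo q_hi.
have mm : mu * mu = INR M by apply: sqrt_sqrt; lra.
have mu_big : 100 <= mu.
  by rewrite -(sqrt_pow2 100); [apply: sqrt_le_1_alt; lra | lra].
set k := INR q / mu; have Eq : INR q = k * mu by rewrite /k; field; lra.
have k_lo : 173 / 100 <= k by apply: (Rmult_le_reg_r mu); lra.
have k_hi : k <= 348 / 100 by apply: (Rmult_le_reg_r mu); lra.
have kk : 0 < k * k by nra.
have EK : INR (q * q) / INR M = k * k by rewrite INR_muln -mm Eq; field; lra.
rewrite EK => h; have ln_k := ln_ge_tangent kk.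
have m4 : 0 < mu ^ 4 by apply: pow_lt; lra.
have h1 : mu ^ 4 * (28 / 10 - 4 / (k * k)) - 30 * (mu * mu) <= k * mu * INR e.
  rewrite -Eq; apply: Rle_trans h; rewrite -mm (_ : (mu * mu) ^ 2 = mu ^ 4); last by ring.
  by apply: Rplus_le_compat_r; apply: Rmult_le_compat_l; lra.
have h2 : mu ^ 3 * (28 / 10 * k ^ 2 - 4) - 30 * mu * k ^ 2 <= k ^ 3 * INR e.
  apply: (Rmult_le_reg_r mu); first lra.
  have := Rmult_le_compat_r (k * k) _ _ (Rlt_le _ _ kk) h1.
  have -> : (mu ^ 4 * (28 / 10 - 4 / (k * k)) - 30 * (mu * mu)) * (k * k) =
     (mu ^ 3 * (28 / 10 * k ^ 2 - 4) - 30 * mu * k ^ 2) * mu by field; lra.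
  by have -> : k * mu * INR e * (k * k) = k ^ 3 * INR e * mu by ring.
have k3 : 0 < k ^ 3 by apply: pow_lt; lra.
apply: (Rmult_le_reg_l (k ^ 3)) => //; apply: Rle_trans h2.
have m3 : 0 < mu ^ 3 by apply: pow_lt; lra.
have h3 := Rmult_le_compat_l _ _ _ (Rlt_le _ _ m3) (cubic_ge k_lo k_hi).
have h4 : 30 * mu * k ^ 2 <= 1 / 100 * (k ^ 3 * mu ^ 3).
  have k2 : 0 < k ^ 2 by apply: pow_lt; lra.
  have : 3000 <= k * (mu * mu) by nra.
  move=> a; have := Rmult_le_compat_l (mu * k ^ 2) _ _ _ a.
  have p : 0 <= mu * k ^ 2 by apply: Rmult_le_pos; lra.
  by move=> /(_ p); rewrite (_ : mu * k ^ 2 * (k * (mu * mu)) = k ^ 3 * mu ^ 3); [lra | ring].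
lra.
Qed.

(** Numerically 0.69 * 1.3^3 > 1.515 > sqrt 2, where 1.3^2 = 1.69 is the factor 1.7 after rounding
    [M] to an integer. *)
Lemma target_le (n M : nat) : 1 < INR n -> 0 < ln (INR n) ->
  169 / 100 * (sqrt (INR n) / ln (INR n)) <= INR M ->
  sqrt 2 * (Rpower (INR n) (3 / 4) / Rpower (ln (INR n)) (3 / 2)) <=
  69 / 100 * sqrt (INR M) ^ 3.
Proof.
set L := ln _; move=> n1 L0 hM.
have n0 : 0 < INR n by lra.
have x0 := sqrt_lt_R0 _ n0; set X := sqrt (INR n) / L in hM *.
have X0 : 0 < X by apply: Rdiv_lt_0_compat.
have -> : Rpower (INR n) (3 / 4) / Rpower L (3 / 2) = sqrt X ^ 3.
  have s0 := sqrt_lt_R0 _ X0.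
  rewrite -(Rpower_pow 3 (sqrt X)) // -Rpower_sqrt // Rpower_mult.
  have -> : / 2 * INR 3 = 3 / 2 by rewrite /=; lra.
  have R0 : Rpower L (3 / 2) <> 0 by apply: Rgt_not_eq; exact: exp_pos.
  apply: (Rmult_eq_reg_r (Rpower L (3 / 2))) => //.
  rewrite Rpower_mult_distr // (_ : X * L = sqrt (INR n)); last by rewrite /X; field; lra.
  rewrite -Rpower_sqrt // Rpower_mult (_ : / 2 * (3 / 2) = 3 / 4); last lra.
  by field.
have s2 : sqrt 2 <= 1415 / 1000.
  by rewrite -(sqrt_pow2 (1415 / 1000)); [apply: sqrt_le_1_alt; lra | lra].
have s20 := sqrt_pos 2.
have hs : 13 / 10 * sqrt X <= sqrt (INR M).
  rewrite -{1}(sqrt_pow2 (13 / 10)); last lra.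
  by rewrite -sqrt_mult; [apply: sqrt_le_1_alt; lra | lra | lra].
have sX := sqrt_pos X.
have : (13 / 10 * sqrt X) ^ 3 <= sqrt (INR M) ^ 3 by apply: pow_incr; lra.
rewrite Rpow_mult_distr; have : 0 <= sqrt X ^ 3 by apply: pow_le.
move: (sqrt X ^ 3) (sqrt (INR M) ^ 3) => a b a0 h.
have : sqrt 2 * a <= 1415 / 1000 * a by apply: Rmult_le_compat_r.
lra.
Qed.

Lemma sidon_lower_bound : exists N : nat, forall n : nat, (N <= n)%N ->
  INR (T n) * Rpower 2 (sqrt 2 * (Rpower (INR n) (3 / 4) / Rpower (ln (INR n)) (3 / 2)))
  <= INR (Defs.S n).
Proof.
have [Nc hc] := prime_pi_lower; have [Nb hb] := prime_between.
have b0 := pow2_ge_0 (INR Nb); have c0 := pos_INR Nc.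
(* 50000 ensures [M >= 20000], and [INR Nb ^ 2] ensures sqrt M >= [Nb], so that [prime_between]
   applies. *)
set D := 50000 + INR Nb ^ 2.
have D0 : 50000 <= D by rewrite /D; lra.
have [Y [Y0 hY]] := @ln_sublinear (/ (2 * D)) ltac:(apply: Rinv_0_lt_compat; lra).
have [N1 hN1] := INR_large (exp 1000).
have [N2 hN2] := INR_large ((2197 + Y + 13 * (INR Nc + 1)) ^ 2).
exists (maxn N1 N2) => n; rewrite geq_max => /andP[/hN1 n1 /hN2 n2].
set x := sqrt (INR n); set L := ln (INR n).
have n0 : 0 < INR n by have := exp_pos 1000; lra.
have L_big : 1000 <= L.
  by rewrite -(ln_exp 1000); apply: Rcomplements.ln_le => //; exact: exp_pos.
have x_big : 2197 + Y + 13 * (INR Nc + 1) <= x.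
  by rewrite -(sqrt_pow2 (2197 + _ + _)); [apply: sqrt_le_1_alt | lra].
have xx : x * x = INR n by apply: sqrt_sqrt; lra.
have lnx : D * L <= x.
  have h := hY x ltac:(lra).
  have -> : D * L = 2 * D * ln x by rewrite /L -xx ln_mult; lra.
  have : 2 * D * ln x <= 2 * D * (/ (2 * D) * x) by apply: Rmult_le_compat_l; lra.
  by rewrite -Rmult_assoc Rinv_r; lra.
have xL : D <= x / L.
  by apply: (Rmult_le_reg_r L); [lra | rewrite /Rdiv Rmult_assoc Rinv_l; lra].
have [M [M1 M2]] := Rcomplements.nfloor_ex (17 / 10 * (x / L)) ltac:(lra).
have M_big : 20000 <= INR M by lra.
set mu := sqrt (INR M).
have mm : mu * mu = INR M by apply: sqrt_sqrt; lra.
have mu_big : 141 <= mu.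
  by rewrite -(sqrt_pow2 141); [apply: sqrt_le_1_alt; lra | lra].
have s3_lo : 1731 / 1000 <= sqrt 3.
  by rewrite -(sqrt_pow2 (1731 / 1000)); [apply: sqrt_le_1_alt; lra | lra].
have s3_hi : sqrt 3 <= 17321 / 10000.
  by rewrite -(sqrt_pow2 (17321 / 10000)); [apply: sqrt_le_1_alt; lra | lra].
(* (1/2 + 2 ln k) / k is maximal at k = e^(3/4), about 2.1. A prime q between z + 1 and 2 (z + 1)
   has q / [mu] between sqrt 3 and roughly 2 sqrt 3, a range around this maximum. *)
have [z [z1 z2]] := Rcomplements.nfloor_ex (sqrt 3 * mu) ltac:(nra).
have Nb_mu : INR Nb <= mu.
  rewrite -(sqrt_pow2 (INR Nb)); last exact: pos_INR.
  by apply: sqrt_le_1_alt; rewrite /D in xL; lra.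
have zNb : (Nb <= z.+1)%N by apply/leP/INR_le; rewrite S_INR; nra.
have [q [pq ltq leq]] := hb _ zNb.
have q_lo : 173 / 100 * mu <= INR q.
  by have := INR_ltn ltq; rewrite S_INR; nra.
have q_hi : INR q <= 348 / 100 * mu.
  by have := INR_leq leq; rewrite INR_muln (_ : INR 2 = 2) // S_INR; nra.
have q2_lo : INR M <= INR (q * q) by rewrite INR_muln -mm; nra.
have q2_hi : INR (q * q) <= 13 * INR M by rewrite INR_muln -mm; nra.
have ML : INR M * L <= 17 / 10 * x.
  have : 17 / 10 * (x / L) * L = 17 / 10 * x by field; lra.
  by have := Rmult_le_compat_r L _ _ ltac:(lra) M1; lra.
have cheb y : x / 13 - 1 <= INR y -> 88 / 100 * INR y <= INR (prime_pi y) * ln (INR y).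
  by move=> hy; apply: hc; apply/leP/INR_le; lra.
have x2197 : 2197 <= x by lra.
have M13 : 13 <= INR M by lra.
have q_gt2 : (2 < q)%N.
  by apply/ltP/INR_lt; rewrite (_ : INR 2 = 2) //; nra.
have [||||e [he sum_e]] := @lower_count n q M pq q_gt2.
- exact/leP/INR_le.
- by apply: (nthprime_many L_big M13 ML x2197 cheb); lra.
- by move=> j ltj; apply: (nthprime_not_big L_big M13 ML x2197 cheb q2_hi) => //; lra.
- by move=> i j; exact: (nthprime_product L_big M13 ML x2197 cheb q2_lo q2_hi).
have hs := @hyperbola_sum_ge (q * q) M.
have e_ge : 69 / 100 * mu ^ 3 <= INR e.
  apply: (@edge_count_ge n M q e) => //.
  rewrite -INR_muln; apply: Rle_trans (INR_leq sum_e); apply: hs.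
  - by apply/ltP/INR_lt; rewrite /=; lra.
  - exact/leP/INR_le.
  - by apply/leP/INR_le; rewrite [INR (13 * M)]INR_muln (_ : INR 13 = 13) // INR_IZR_INZ.
apply: (Rle_trans _ (INR (T n * 2 ^ e))); last exact: INR_leq.
rewrite INR_muln INR_expn -[INR 2]/2 -Rpower_pow; last lra.
apply: Rmult_le_compat_l; first exact: pos_INR.
apply: Rle_Rpower; first lra.
apply: Rle_trans e_ge; apply: target_le; [|rewrite -/L; lra|rewrite -/x -/L; lra].
by have := exp_ineq1_le 1000; lra.
Qed.

Lemma sidon_lower_bound_o1 : exists g : nat -> R, Un_cv g 0 /\
  exists N : nat, forall n : nat, (N <= n)%N ->
    INR (T n) * Rpower 2 ((sqrt 2 + g n) *
      (Rpower (INR n) (3 / 4) / Rpower (ln (INR n)) (3 / 2))) <= INR (Defs.S n).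
Proof.
exists (fun=> 0); split; last first.
  by have [N hN] := sidon_lower_bound; exists N => n; rewrite Rplus_0_r; exact: hN.
by move=> eps eps_gt0; exists 0%N => n _; rewrite /Rdist Rminus_diag Rabs_R0.
Qed.

Lemma eventually_le (P : nat -> Prop) : (exists N : nat, forall n, (N <= n)%N -> P n) ->
  exists N : nat, forall n, le N n -> P n.
Proof. by case=> N hN; exists N => n /leP; exact: hN. Qed.

End Development.

Theorem theorem1p1 :
  exists C : R, 0 < C /\
    (exists g : nat -> R, Un_cv g 0 /\
       exists N : nat, forall n : nat, (N <= n)%nat ->
         INR (T n) * Rpower 2 ((sqrt 2 + g n) *
            (Rpower (INR n) (3/4) / Rpower (ln (INR n)) (3/2)))
         <= INR (S n)) /\
    (exists N : nat, forall n : nat, (N <= n)%nat ->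
         INR (S n) <= INR (T n) * Rpower 2 (C *
            (Rpower (INR n) (3/4) / Rpower (ln (INR n)) (3/2)))).
Proof.
destruct Development.sidon_upper_bound as [C [C_gt0 upper]].
destruct Development.sidon_lower_bound_o1 as [g [cvg lower]].
exists C; split; [exact C_gt0 | split].
- exists g; split; [exact cvg | exact (Development.eventually_le lower)].
- exact (Development.eventually_le upper).
Qed.
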